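(* Let the reproduction scheme satisfy Assumptions 1--6 of the context. There exist constants $r_0>0$, $\delta^0>0$, $a_0>0$, a decreasing function $\underline\delta:[0,\infty)\to(0,\delta^0)$ with $\underline\delta(y)\to0$ as $y\to\infty$, and an increasing function $g:(0,1]\to[0,\infty)$ with $g(x)\to0$ as $x\to0$, such that the following holds. For every $a\in(0,a_0)$, $A>0$, $\mathcal{R}>0$, every $y>0$ with $w(y)\le1$, every $r\ge x\ge r_0$ and every $r_\bullet\ge r_0$ with $r\ge2r_\bullet$, let $(S_n,R_n,\delta_n,I_n)$ be processes as in the context with $S_0=r$ and $\delta_n=\underline\delta(y)$ for every $n$, and write $$\tau_x=\inf\{n\ge0:S_n\le x\},\qquad\rho=\inf\{n\ge0:S_n-R_n<y\text{ or }R_n<\mathcal{R}\},$$ $$T_a=\inf\Big\{n\ge0:\ S_n<2r_\bullet\ \text{or}\ R_n\notin[r_\bullet,S_n-r_\bullet]\ \text{or}\ \delta_n\notin(0,\delta^0)\ \text{or}\ R_n>\tfrac{a}{\sqrt{w(S_n)}}\Big\},$$ $$T'=\min\big(\tau_x,\,T_a,\,\rho,\,\lfloor A/w(x)\rfloor\big).$$ Then $$\Big|w(r)-\mathbb{E}\big[W^{(r)}_{T'}\big]\Big|\le\frac{100A}{w(x)}\Big(\mathbb{P}(\Lambda>\mathcal{R})+w(y)^2g(w(y))\Big).$$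
   Context: Branching random walk. Let $\mathcal{U}=\bigcup_{n\ge0}\{1,2,\dots\}^n$. A reproduction scheme is $(\chi,\Lambda,D,(X_i)_{1\le i\le\chi(\mathbb{R})})$ where $\chi$ is a finite point process on $\mathbb{R}$, $(X_i)$ a measurable enumeration of its atoms, $\Lambda\ge0$ with $\Lambda\ge\sup\chi$ a.s. ($\sup\chi$ is the supremum of the support, $-\infty$ if $\chi=0$), and $D\ge0$; the joint law is otherwise arbitrary. From i.i.d. copies $(\chi_u,\Lambda^{(u)},D_u,(X^{(u)}_i)_i)_{u\in\mathcal{U}}$ one builds the tree $T\ni\emptyset$ with $uj\in T$ iff $u\in T$, $1\le j\le\chi_u(\mathbb{R})$, and $X_\emptyset=0$, $X_{uj}=X_u+X^{(u)}_j$, $\Lambda_u=X_u+\Lambda^{(u)}$. Let $w(r)=\frac1{\mathbb{P}(\sup_{v\in T}\Lambda_v\le r)}-1$, with $w=+\infty$ where this probability is $0$. Assumptions: (1) $\mathbb{E}[\chi(\mathbb{R})]=1$; (2) $\mathbb{E}[\int x\,d\chi(x)]=0$; (3) $\mathbb{E}[\chi(\mathbb{R})^2]=\sigma^2+1\in(1,\infty)$; (4) $\mathbb{E}[\int x^2\,d\chi(x)]=\eta^2\in(0,\infty)$; (5) $\mathbb{P}(\Lambda>r)=o(r^{-4})$ as $r\to\infty$; (6) $\mathbb{E}[D]=1$. Truncated Palm measures. For $0\le R\le r$ and $\delta>0$ let $E(r,R,\delta)=\{\chi(\mathbb{R})\le\frac{\delta}{w(r-R)}\}\cap\{\Lambda\le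 R\}$. Let $(Z,I^{(r,R,\delta)})$ be an $\mathbb{R}\times\{0,1\}$-valued random variable with $\mathbb{E}[f(Z,I^{(r,R,\delta)})]=\mathbb{E}[\int f(x,\mathbf{1}_{E(r,R,\delta)})\,d\chi(x)]$ for every positive measurable $f$. Let $P^{(r,R,\delta)}_{z,i}$ be a Markov kernel from $\mathbb{R}\times\{0,1\}$ to counting measures with $$\mathbb{E}\Big[\sum_{i=1}^{\chi(\mathbb{R})}g(X_i,\mathbf{1}_{E(r,R,\delta)},\chi-\delta_{X_i})\Big]=\mathbb{E}\Big[\int g(Z,I^{(r,R,\delta)},\phi)\,dP^{(r,R,\delta)}_{Z,I^{(r,R,\delta)}}(\phi)\Big]$$ for every positive measurable $g$, and let $M^{(r,R,\delta)}_z(A)=\int\phi(A)\,dP^{(r,R,\delta)}_{z,1}(\phi)$. Processes. $(S_n)_{n\ge0},(R_n)_{n\ge0},(\delta_n)_{n\ge0},(I_n)_{n\ge1}$ are such that $S_0=r$ and, with $\mathcal{F}_n=\sigma(S_k,R_k,\delta_k,I_k:k\le n)$, conditionally on $\mathcal{F}_n$ the pair $(S_{n+1}-S_n,I_{n+1})$ has the law of $(-Z,I^{(S_n,R_n,\delta_n)})$ (so $(S_n)$ is a random walk with i.i.d. steps). Define $$\mathcal{W}^{(r)}_n=\Big(\prod_{k=0}^{n-1}I_{k+1}\Big)\exp\Big(-\sum_{k=0}^{n-1}\big(w(S_{k+1})-\mathbb{E}[I_{k+1}w(S_{k+1})\,|\,\mathcal{F}_k]\big)-\frac12\sum_{k=0}^{n-1}\int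 w(S_k-z)\,dM^{(S_k,R_k,\delta_k)}_{S_k-S_{k+1}}(z)\Big),$$ understood as $0$ as soon as some $I_{k+1}=0$, with $\mathcal{W}^{(r)}_0=1$, and $W^{(r)}_n=\mathcal{W}^{(r)}_nw(S_n)$ (with $0\cdot\infty=0$). *)

(* Defs.v *)
(* MathComp-Analysis. *)
From HB Require Import structures.
From mathcomp Require Import all_boot all_order all_algebra.
From mathcomp Require Import all_classical all_reals all_analysis.
From mathcomp Require Import measurable_realfun.

Set Implicit Arguments.
Unset Strict Implicit.
Unset Printing Implicit Defensive.

Import Order.TTheory GRing.Theory Num.Theory.
Import numFieldNormedType.Exports.

Local Open Scope classical_set_scope.
Local Open Scope ring_scope.
Local Open Scope ereal_scope.

(* Finite counting measures on the line, with the sigma-algebra generated by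
   the evaluations phi |-> phi A. *)
Section counting_measures.
Context (R : realType).

Record fin_counting := FinCounting {
  cmeas :> {measure set R -> \bar R};
  cmeas_nat : forall A, measurable A -> exists n : nat, cmeas A = n%:R%:E }.

HB.instance Definition _ := gen_eqMixin fin_counting.
HB.instance Definition _ := gen_choiceMixin fin_counting.

Lemma dirac_sum_nat (s : seq R) (A : set R) :
  exists n : nat,
    msum (fun i => \d_(nth 0%R s i)) (size s) A = n%:R%:E :> \bar R.
Proof.
rewrite /msum; elim: (size s) => [|n [m IH]].
  by exists 0%N; rewrite big_ord0.
exists (m + (nth 0%R s n \in A))%N.
by rewrite big_ord_recr/= IH diracE natrD EFinD.
Qed.

(* sum of the Dirac masses at the entries of s, with multiplicity *)
Definition point_masses (s : seq R) : fin_counting :=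
  FinCounting (fun A _ => dirac_sum_nat s A).

HB.instance Definition _ := isPointed.Build fin_counting (point_masses [::]).

Definition evaluation_sets : set (set fin_counting) :=
  [set C | exists (A : set R) (U : set (\bar R)),
     [/\ measurable A, measurable U &
         C = [set phi : fin_counting | U (phi A)]]].

Definition counting_measures := g_sigma_algebraType evaluation_sets.

HB.instance Definition _ := Measurable.on counting_measures.

End counting_measures.

Section evaluation_kernel.
Context d (X : measurableType d) (R : realType).

Definition evaluation (p : X * counting_measures R) :
  {measure set R -> \bar R} := cmeas p.2.

Lemma measurable_evaluation U : measurable U ->
  measurable_fun [set: X * counting_measures R] (evaluation ^~ U).
Proof.
move=> mU; apply: (@measurableT_comp _ _ _ _ _ _
  (fun phi : counting_measures R => cmeas phi U)) => //.
move=> _ V mV; rewrite setTI; apply: sub_gen_smallest.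
by exists U, V.
Qed.

HB.instance Definition _ :=
  isKernel.Build _ _ _ _ R evaluation measurable_evaluation.

End evaluation_kernel.

(* Finite sequences of reals, with the sigma-algebra generated by the length
   and the entries: a random element of this space is a measurable enumeration
   (X_i) of the atoms of a finite point process. Enumerations start at 0. *)
Definition finite_seq (R : realType) : Type := seq R.
HB.instance Definition _ (R : realType) := Choice.on (finite_seq R).
HB.instance Definition _ (R : realType) :=
  isPointed.Build (finite_seq R) ([::] : seq R).

Definition seq_cylinders (R : realType) : set (set (finite_seq R)) :=
  [set C | (exists n : nat, C = [set s | size s = n]) \/
           (exists (i : nat) (U : set R),
              measurable U /\ C = [set s | U (nth 0%R s i)])].

Definition atom_seqs (R : realType) := g_sigma_algebraType (@seq_cylinders R).
HB.instance Definition _ (R : realType) := Measurable.on (atom_seqs R).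

(* the values ((X_i)_i, Lambda, D) of a reproduction scheme *)
Definition mark (R : realType) : Type := (atom_seqs R * R * R)%type.
HB.instance Definition _ (R : realType) := Measurable.on (mark R).

Section reproduction.
Context d (T : measurableType d) (R : realType).
Variable X : T -> mark R.

Definition atoms (t : T) : seq R := (X t).1.1.
Definition Lam (t : T) : R := (X t).1.2.
Definition Dx (t : T) : R := (X t).2.

Definition chi (t : T) : fin_counting R := point_masses (atoms t).

(* chi - delta_{X_i} *)
Definition chi_minus (i : nat) (t : T) : counting_measures R :=
  point_masses (take i (atoms t) ++ drop i.+1 (atoms t)).

Lemma chi_minusE i t (A : set R) : (i < size (atoms t))%N ->
  chi t A = \d_(nth 0%R (atoms t) i : R) A
            + (chi_minus i t : fin_counting R) A.
Proof.
move=> it.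
have sumE (s : seq R) : (point_masses s : fin_counting R) A
    = \sum_(x <- s) \d_(x : R) A.
  by rewrite /= /msum (big_nth 0%R) big_mkord.
rewrite /chi /chi_minus !sumE -{1}(cat_take_drop i (atoms t)) !big_cat/=.
rewrite (drop_nth 0%R it) big_cons addeA (addeC _ (\d_ _ A)) -addeA.
by [].
Qed.

Definition sup_chi (t : T) : \bar R :=
  ereal_sup [set x%:E | x in [set x | x \in atoms t]].

End reproduction.

Section assumptions.
Context d (T : measurableType d) (R : realType).
Variables (P : probability T R) (X : {RV P >-> mark R}) (sigma eta : R).

Record reproduction_scheme : Prop := {
  Lam_ge0 : forall t, (0 <= Lam X t)%R;
  Dx_ge0 : forall t, (0 <= Dx X t)%R;
  Lam_ge_sup : {ae P, forall t, sup_chi X t <= (Lam X t)%:E} }.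

Record assumptions : Prop := {
  mean_offspring : \int[P]_t chi X t setT = 1;
  mean_displacement : \int[P]_t \int[chi X t]_x x%:E = 0;
  sigma2_gt0 : (0 < sigma ^+ 2)%R;
  var_offspring : \int[P]_t (chi X t setT) ^+ 2 = (sigma ^+ 2 + 1)%:E;
  eta2_gt0 : (0 < eta ^+ 2)%R;
  var_displacement : \int[P]_t \int[chi X t]_x (x ^+ 2)%:E = (eta ^+ 2)%:E;
  tail_Lam : forall e : R, (0 < e)%R ->
    \forall r \near +oo%R, P [set t | (r < Lam X t)%R] <= (e * r ^- 4)%:E;
  mean_D : \int[P]_t (Dx X t)%:E = 1 }.

End assumptions.

Definition iid_copies d d' (T : measurableType d) (T' : measurableType d')
    (R : realType) (P : probability T R) (X : {RV P >-> mark R})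
    (P' : probability T' R) (c : seq nat -> {RV P' >-> mark R}) : Prop :=
  (forall u (B : set (mark R)), measurable B ->
     P' (c u @^-1` B) = P (X @^-1` B)) /\
  (forall (s : seq (seq nat)) (B : seq nat -> set (mark R)), uniq s ->
     (forall u, measurable (B u)) ->
     P' (\bigcap_(u in [set` s]) c u @^-1` B u)
     = \prod_(u <- s) P' (c u @^-1` B u)).

(* The vertex (u_1, ..., u_n) of the Ulam-Harris tree is the sequence
   [:: u_1; ...; u_n] : seq nat, with children numbered from 0. *)
Section branching_random_walk.
Context d (T : measurableType d) (R : realType) (P : probability T R).
Variable c : seq nat -> {RV P >-> mark R}.

Inductive tree (t : T) : seq nat -> Prop :=
| tree_root : tree t [::]
| tree_child u j : tree t u -> (j < size (atoms (c u) t))%N ->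
    tree t (rcons u j).

Definition position (u : seq nat) (t : T) : R :=
  (\sum_(k < size u) nth 0 (atoms (c (take k u)) t) (nth 0%N u k))%R.

Lemma position_root t : position [::] t = 0%R.
Proof. by rewrite /position big_ord0. Qed.

Lemma position_child u j t :
  position (rcons u j) t = (position u t + nth 0 (atoms (c u) t) j)%R.
Proof.
rewrite /position size_rcons big_ord_recr/= nth_rcons ltnn eqxx.
rewrite -cats1 take_size_cat//; congr (_ + _)%R; apply: eq_bigr => k _.
by rewrite nth_cat ltn_ord takel_cat// ltnW.
Qed.

Definition vertex_Lam (u : seq nat) (t : T) : R :=
  (position u t + Lam (c u) t)%R.

Definition sup_Lam (t : T) : \bar R :=
  ereal_sup [set (vertex_Lam u t)%:E | u in tree t].

(* 0^-1 = +oo in \bar R *)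
Definition w (r : R) : \bar R := (P [set t | sup_Lam t <= r%:E])^-1 - 1.

End branching_random_walk.

Section palm.
Context d (T : measurableType d) (R : realType) (P : probability T R).
Variables (X : {RV P >-> mark R}) (w : R -> \bar R).

Definition good_event (r rho delta : R) : set T :=
  [set t | chi X t setT <= delta%:E / w (r - rho)%R /\ (Lam X t <= rho)%R].

Definition good (r rho delta : R) (t : T) : bool :=
  t \in good_event r rho delta.

(* (Z, J r rho delta) is the pair (Z, I^(r,rho,delta)). The defining formula
   makes sense, and is imposed, for all parameters, since the processes below
   are indexed by all times and do leave the range 0 <= rho <= r. *)
Definition palm_variables dZ (TZ : measurableType dZ) (PZ : probability TZ R)
    (Z : {RV PZ >-> R})
    (J : R -> R -> R -> {RV PZ >-> bool}) : Prop :=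
  forall (r rho delta : R) (f : R * bool -> \bar R),
    measurable_fun setT f -> (forall p, 0 <= f p) ->
    \int[PZ]_z f (Z z, J r rho delta z)
    = \int[P]_t \int[chi X t]_x f (x, good r rho delta t).

(* ((r, rho, delta), (z, i)) *)
Definition palm_param : Type :=
  (R * R * R * (R * bool))%type.
HB.instance Definition _ := Measurable.on palm_param.

(* K ((r, rho, delta), (z, i)) is P^(r,rho,delta)_{z,i}; the versions are
   chosen jointly measurably in all the parameters. *)
Definition palm_kernel dZ (TZ : measurableType dZ) (PZ : probability TZ R)
    (Z : {RV PZ >-> R})
    (J : R -> R -> R -> {RV PZ >-> bool})
    (K : R.-pker palm_param ~> counting_measures R) : Prop :=
  forall (r rho delta : R), (0 <= rho <= r)%R -> (0 < delta)%R ->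
  forall g : R * bool * counting_measures R -> \bar R,
    measurable_fun setT g -> (forall p, 0 <= g p) ->
    \int[P]_t (\sum_(i < size (atoms X t))
        g (nth 0%R (atoms X t) i, good r rho delta t, chi_minus X i t))
    = \int[PZ]_z \int[K ((r, rho, delta), (Z z, J r rho delta z))]_phi
        g (Z z, J r rho delta z, phi).

(* M^(r,rho,delta)_z, that is A |-> \int phi A dK_{z,1}(phi) *)
Definition palm_mean (K : R.-pker palm_param ~> counting_measures R)
    (r rho delta z : R) : {measure set R -> \bar R} :=
  (K \; @evaluation _ palm_param R) ((r, rho, delta), (z, true)).

End palm.

(* C is a version of the conditional expectation of Y >= 0 given G. *)
Definition is_cond_exp d (T : measurableType d) (R : realType)
    (P : probability T R) (G : set (set T)) (Y C : T -> \bar R) : Prop :=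
  [/\ forall t, 0 <= C t,
      forall B, measurable B -> G (C @^-1` B) &
      forall A, G A -> \int[P]_(t in A) C t = \int[P]_(t in A) Y t].

(* min (inf {n | C n}, m), with inf of the empty set equal to infinity *)
Definition hit_before (C : nat -> Prop) (m : nat) : nat :=
  find (fun n => `[< C n >]) (iota 0 m).

Section processes.
Context d (T : measurableType d) (R : realType) (Q : probability T R).
Variables (S Rh dl : nat -> {RV Q >-> R}).
Variable I : nat -> {RV Q >-> bool}.

(* sigma (S_k, R_k, delta_k, I_k : k <= n), the I_k being indexed by k >= 1;
   I 0 is never used *)
Definition filtration (n : nat) : set (set T) :=
  <<s [set A | exists k, (k <= n)%N /\
     ((exists U : set R, measurable U /\
         (A = S k @^-1` U \/ A = Rh k @^-1` U \/ A = dl k @^-1` U)) \/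
      (exists b : bool, (0 < k)%N /\ A = I k @^-1` [set b]))] >>.

(* conditionally on filtration n, (S_{n+1} - S_n, I_{n+1}) has the law of
   (- Z, I^(S_n, R_n, delta_n)) *)
Definition step_law dZ (TZ : measurableType dZ) (PZ : probability TZ R)
    (Z : {RV PZ >-> R})
    (J : R -> R -> R -> {RV PZ >-> bool}) : Prop :=
  forall n (A : set T) (B : set (R * bool)),
    filtration n A -> measurable B ->
    Q (A `&` [set t | B ((S n.+1 t - S n t)%R, I n.+1 t)])
    = \int[Q]_(t in A)
        PZ [set z | B ((- Z z)%R, J (S n t) (Rh n t) (dl n t) z)].

Variables (w : R -> \bar R) (K : R.-pker palm_param R ~> counting_measures R).

(* Cnd k stands for E [I_{k+1} w(S_{k+1}) | filtration k] *)
Definition cond_exp_steps (Cnd : nat -> T -> \bar R) : Prop :=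
  forall k, is_cond_exp Q (filtration k)
    (fun t => (I k.+1 t)%:R%:E * w (S k.+1 t)) (Cnd k).

Variable Cnd : nat -> T -> \bar R.

Definition calW (n : nat) (t : T) : \bar R :=
  if [forall k : 'I_n, I k.+1 t] then
    expeR (- (\sum_(k < n) (w (S k.+1 t) - Cnd k t))
           - (2^-1)%:E * \sum_(k < n)
               \int[palm_mean K (S k t) (Rh k t) (dl k t)
                      (S k t - S k.+1 t)]_z w (S k t - z)%R)
  else 0.

Definition W (n : nat) (t : T) : \bar R := calW n t * w (S n t).

Definition tau_cond (x : R) (t : T) (n : nat) : Prop := (S n t <= x)%R.

Definition rho_cond (y cR : R) (t : T) (n : nat) : Prop :=
  (S n t - Rh n t < y)%R \/ (Rh n t < cR)%R.

Definition T_cond (rb delta0 a : R) (t : T) (n : nat) : Prop :=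
  [\/ (S n t < 2 * rb)%R,
      ~ (rb <= Rh n t <= S n t - rb)%R,
      ~ (0 < dl n t < delta0)%R |
      a%:E / sqrte (w (S n t)) < (Rh n t)%:E].

(* tau_x, T_a and rho are each truncated at m = floor (A / w x), which does
   not change the minimum of the four; m = 0 when w x = +oo. *)
Definition T' (x y cR rb delta0 a A : R) (t : T) : nat :=
  let m := Num.truncn (fine (A%:E / w x)) in
  minn (hit_before (tau_cond x t) m)
    (minn (hit_before (T_cond rb delta0 a t) m)
          (minn (hit_before (rho_cond y cR t) m) m)).

End processes.

(* Main.v *)
Require Import Defs.
From HB Require Import structures.
From mathcomp Require Import all_boot all_order all_algebra.
From mathcomp Require Import all_classical all_reals all_analysis.
From mathcomp Require Import measurable_realfun.
From mathcomp Require Import ring lra.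

(** Write [F r] for the probability that the supremum stays below [r],
    [u = 1 - F], and [w = 1 / F - 1 = u / (1 - u)]. The recursion of the
    branching random walk at its root ([supF_rec]) reads
    [F r = E [1_{Lambda <= r} \prod_i F (r - X_i)]]; criticality makes
    [F -> 1] ([F_to1]) and keeps [u (r + K)] comparable with [u r]
    ([F_shift]), so that [w] is positive, nonincreasing, finite and small at
    large [r].

    The heart of the matter is one step, started from a state [(r, rho)] and
    truncated to the event where [chi (R) <= delta / om] and
    [Lambda <= rho], with [om = w (r - rho)]. There every [w_i = w (r - X_i)]
    is at most [om], their sum [s] is at most [delta], and
    [\prod_i (1 + w_i)^-1 = 1 - s + (s ^ 2 + q) / 2 + O (s ^ 3)], where [q] is
    the sum of the [w_i ^ 2] ([prod_inv_bounds]). Taking expectations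
    expresses [u r] by the first and second order sums over the atoms, which
    the Palm formulas turn into the means under the law of [(Z, I)] of
    [w (r - Z)], of its square, and of its product with the integral [v] of
    [w] against the Palm mean measure. The tilt
    [exp (E [I w (r - Z)] - w (r - Z) - v / 2)], the factor of one step of the
    process, is the one whose second order expansion produces the same three
    means. Hence [w r] and the tilted mean of [w (r - Z)] differ by at most
    twice the probability of leaving the truncated event plus
    [O (om ^ 2 (om + delta))] ([step_mean]). Moreover the tilt has mean at most
    [1] ([step_one_le1]): its second order gain is at most [8 om] times the
    mean of [w (r - Z)], while [- v / 2] loses a fixed fraction of that mean,
    because with positive probability there are two atoms, the first of them
    not too far to the left.

    The cut-off [delta] must tend to [0] with [w y] while the probability that
    [chi (R) > delta / om] remains [o (w y ^ 2)]. Such a choice exists since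
    [chi (R)] has a finite second moment, whose tail decides how slowly
    [delta] decreases ([step_parameters]); [dominating_modulus] then rewrites
    the resulting error as an increasing function of [w y].

    The processes follow the law of [(Z, I)] given their past, so integrals
    over one jump can be replaced by integrals over that law ([one_jump]); in
    particular the conditional expectation in the weight is, almost surely and
    before the stopping time, the mean [E [I w (s - Z)]] of the current state
    ([cond_ae]), and the weight is the product of the one-step tilts
    ([W_density]). As the product of the tilts has mean at most [1]
    ([alive_density_mean]), replacing time [k] by time [k + 1] in the stopped
    weight changes its mean by at most the one-step error ([stopped_step]),
    and there are at most [A / w x] steps ([stopped_error]). *)

Set Implicit Arguments.
Unset Strict Implicit.
Unset Printing Implicit Defensive.

Import Order.TTheory GRing.Theory Num.Theory.
Import numFieldNormedType.Exports.

Local Open Scope classical_set_scope.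
Local Open Scope ring_scope.
Local Open Scope ereal_scope.

(** * Elementary inequalities *)

Section real_inequalities.
Context (R : realType).
Local Open Scope ring_scope.

(** By induction on [l]: multiplying by one more factor [(1 + a)^-1]
    preserves each bound, the cubic term absorbing what the second order
    expansion neglects. *)
Lemma prod_inv_bounds (l : seq R) : (forall x, x \in l -> 0 <= x) ->
  let s := \sum_(x <- l) x in let q := \sum_(x <- l) x ^+ 2 in
  [/\ 0 <= q <= s ^+ 2, 0 <= s,
   1 - s + (s ^+ 2 + q) / 2 - s ^+ 3 <= \prod_(x <- l) (1 + x)^-1,
   \prod_(x <- l) (1 + x)^-1 <= 1 - s + (s ^+ 2 + q) / 2 &
   \prod_(x <- l) (1 + x)^-1 * (1 + s) <= 1].
Proof.
elim: l => [|a l IH] l0 /=.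
  rewrite !big_nil; split; lra.
have a0 : 0 <= a by apply: l0; rewrite inE eqxx.
have l0' x : x \in l -> 0 <= x by move=> xl; apply: l0; rewrite inE xl orbT.
have /= [] := IH l0'.
rewrite !big_cons; set s := \sum_(x <- l) x; set q := \sum_(x <- l) x ^+ 2.
set p := \prod_(x <- l) _ => /andP[q0 qs] s0 lo up hi.
have p0 : 0 <= p.
  rewrite /p big_seq; apply: prodr_ge0 => x xl; rewrite invr_ge0.
  by have := l0' x xl; lra.
have a1 : 0 < 1 + a by lra.
have as0 : 0 <= a * s by exact: mulr_ge0.
have aq0 : 0 <= a * q by exact: mulr_ge0.
have aas0 : 0 <= a * (a * s) by exact: mulr_ge0.
have ass0 : 0 <= a * (s * s) by rewrite mulr_ge0 ?mulr_ge0.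
have aqs : a * q <= a * s ^+ 2 by exact: ler_wpM2l.
have s3 : 0 <= s ^+ 3 by exact: exprn_ge0.
have a3 : 0 <= a ^+ 3 by exact: exprn_ge0.
have as3 : 0 <= a * (s + a) ^+ 3 by rewrite mulr_ge0 ?exprn_ge0 ?addr_ge0.
split; [|lra| | |].
- by apply/andP; split; nra.
- by rewrite ler_pdivlMl//; nra.
- by rewrite ler_pdivrMl//; nra.
- rewrite -mulrA ler_pdivrMl// mulr1.
  have : p * s <= 1 - p by nra.
  have : p <= 1 by nra.
  nra.
Qed.

(** From [expR (- t) >= 1 - t] one gets [expR t <= 1 / (1 - t)], and the
    right hand side is at most [1 + t + 2 t ^ 2] up to [t = 1/2]. *)
Lemma expR_le_quad (t : R) : t <= 2^-1 -> expR t <= 1 + t + 2 * t ^+ 2.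
Proof.
move=> t2; have t1 : 0 < 1 - t by lra.
have : expR (- t) >= 1 - t by have := expR_ge1Dx (- t).
rewrite expRN -[X in X <= _]invrK lef_pV2 ?posrE ?invr_gt0 ?expR_gt0// => h.
apply: (le_trans h); rewrite -[leLHS]mul1r ler_pdivrMr//.
have := sqr_ge0 t; nra.
Qed.

Lemma bernoulli (q : R) n : 0 <= q <= 1 -> 1 + (q - 1) *+ n <= q ^+ n.
Proof.
move=> /andP[q0 q1]; elim: n => [|n IH]; first by rewrite mulr0n expr0 addr0.
rewrite exprS mulrSr.
have : q * (1 + (q - 1) *+ n) <= q * q ^+ n by exact: ler_wpM2l.
have : (q - 1) *+ n <= 0 by rewrite mulrn_wle0// subr_le0.
nra.
Qed.

(** The strict form is what excludes fixed points below [1] of the offspring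
    generating function: it applies on the event of positive probability
    where there are two children. *)
Lemma bernoulli_lt (q : R) n : 0 <= q < 1 -> (2 <= n)%N ->
  1 + (q - 1) *+ n < q ^+ n.
Proof.
move=> /andP[q0 q1]; case: n => // -[//|n] _.
have /(_ n.+1) := @bernoulli q; rewrite q0 (ltW q1) => /(_ isT) h.
rewrite exprS mulrSr.
have : q * (1 + (q - 1) *+ n.+1) <= q * q ^+ n.+1 by exact: ler_wpM2l.
have : (q - 1) *+ n.+1 < 0 by rewrite pmulrn_llt0// subr_lt0.
nra.
Qed.

End real_inequalities.

(** * Measurable functions of the atoms *)

Section atom_sequences.
Context (R : realType).

Lemma measurable_size :
  measurable_fun setT (fun s : atom_seqs R => size (s : seq R)).
Proof.
move=> _ B _; rewrite setTI.
rewrite [X in measurable X](_ : _ =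
    \bigcup_(n in B) [set s : atom_seqs R | size (s : seq R) = n]).
  apply: bigcup_measurable => n _; apply: sub_sigma_algebra.
  by left; exists n.
by apply/seteqP; split=> [s Bs|s [n Bn /= sn]]; [exists (size s)|rewrite /= sn].
Qed.

Lemma measurable_nth i :
  measurable_fun setT (fun s : atom_seqs R => nth 0%R (s : seq R) i).
Proof.
move=> _ B mB; rewrite setTI; apply: sub_sigma_algebra.
by right; exists i, B.
Qed.

Section by_size.
Context d (Y : measurableType d) (a : Y -> atom_seqs R).
Hypothesis ma : measurable_fun setT a.

Lemma measurable_size_set (B : set nat) :
  measurable [set y | B (size (a y : seq R))].
Proof.
have := measurableT_comp measurable_size ma.
by move=> /(_ measurableT B I); rewrite setTI.
Qed.

(** The space of finite sequences is the countable disjoint union of its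
    layers of constant length, on which sums and products over the atoms have
    a fixed number of terms. *)
Lemma measurable_by_size d' (Z : measurableType d') (f : Y -> Z) :
  (forall n, measurable_fun [set y | size (a y : seq R) = n] f) ->
  measurable_fun setT f.
Proof.
move=> mf.
rewrite [X in measurable_fun X _](_ : _ =
    \bigcup_n [set y | size (a y : seq R) = n]).
  apply/measurable_fun_bigcup => n; last exact: mf.
  exact: (measurable_size_set [set n]).
by apply/seteqP; split => // y _; exists (size (a y : seq R)).
Qed.

Lemma measurable_atom i : measurable_fun setT (fun y => nth 0%R (a y : seq R) i).
Proof. exact: (measurableT_comp (measurable_nth i) ma). Qed.

Lemma measurable_sum_atoms (f : Y * R -> \bar R) : measurable_fun setT f ->
  measurable_fun setT (fun y => \sum_(x <- (a y : seq R)) f (y, x)).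
Proof.
move=> mf; apply: measurable_by_size => n.
apply: (@eq_measurable_fun _ _ _ _ _
    (fun y => \sum_(i < n) f (y, nth 0%R (a y : seq R) i))).
  by move=> y; rewrite inE /= => <-; rewrite (big_nth 0%R) big_mkord.
apply: measurable_funTS; apply: emeasurable_sum => i.
apply: (measurableT_comp mf); apply: measurable_fun_pair => //.
exact: measurable_atom.
Qed.

Lemma measurable_prod_atoms (f : Y * R -> R) : measurable_fun setT f ->
  measurable_fun setT (fun y => \prod_(x <- (a y : seq R)) f (y, x))%R.
Proof.
move=> mf; apply: measurable_by_size => n.
apply: (@eq_measurable_fun _ _ _ _ _
    (fun y => \prod_(i < n) f (y, nth 0%R (a y : seq R) i))%R).
  by move=> y; rewrite inE /= => <-; rewrite (big_nth 0%R) big_mkord.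
apply: measurable_funTS.
elim: n => [|n IH].
  by apply: (@eq_measurable_fun _ _ _ _ _ (fun=> 1%R : R)) => // y _; rewrite big_ord0.
apply: (@eq_measurable_fun _ _ _ _ _ (fun y => \prod_(i < n) f (y, nth 0%R (a y : seq R) i)
   * f (y, nth 0%R (a y : seq R) n))%R).
  by move=> y _; rewrite big_ord_recr.
apply: measurable_funM => //.
apply: (measurableT_comp mf); apply: measurable_fun_pair => //.
exact: measurable_atom.
Qed.

End by_size.

Lemma integral_point_masses (s : seq R) (f : R -> \bar R) :
  measurable_fun setT f -> (forall x, 0 <= f x) ->
  \int[point_masses s]_x f x = \sum_(x <- s) f x.
Proof.
move=> mf f0; rewrite ge0_integral_measure_sum// (big_nth 0%R) big_mkord.
by apply: eq_bigr => i _; rewrite integral_dirac// diracT mul1e.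
Qed.

Lemma point_massesT (s : seq R) : (point_masses s : fin_counting R) setT = (size s)%:R%:E.
Proof.
transitivity (\sum_(i < size s) 1%:E : \bar R).
  by apply: eq_bigr => i _; exact: diracT.
by rewrite sumEFin sumr_const card_ord.
Qed.

End atom_sequences.

Section marks.
Context d (T : measurableType d) (R : realType) (X : T -> mark R).
Hypothesis mX : measurable_fun setT X.

Lemma measurable_atoms : measurable_fun setT (fun t => atoms X t : atom_seqs R).
Proof.
apply: (measurableT_comp measurable_fst).
exact: (measurableT_comp measurable_fst).
Qed.

Lemma measurable_Lam : measurable_fun setT (Lam X).
Proof.
apply: (measurableT_comp measurable_snd).
exact: (measurableT_comp measurable_fst).
Qed.

End marks.

(** * Independence of the marks of disjoint sets of vertices *)

Section transport.
Context d (T : measurableType d) d' (T' : measurableType d') (R : realType).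

Lemma eq_law_integral (mu : {measure set T -> \bar R})
    (nu : {measure set T' -> \bar R}) d2 (E : measurableType d2)
    (f : T -> E) (g : T' -> E) (h : E -> \bar R) :
  measurable_fun setT f -> measurable_fun setT g ->
  (forall B, measurable B -> mu (f @^-1` B) = nu (g @^-1` B)) ->
  measurable_fun setT h -> (forall x, 0 <= h x) ->
  \int[mu]_t h (f t) = \int[nu]_t h (g t).
Proof.
move=> mf mg fg mh h0.
transitivity (\int[pushforward mu f]_x h x).
  by rewrite ge0_integral_pushforward.
transitivity (\int[pushforward nu g]_x h x); last first.
  by rewrite ge0_integral_pushforward.
by apply: eq_measure_integral => A mA _; exact: fg.
Qed.

End transport.

Section independence.
Context d (T : measurableType d) (R : realType) (P : probability T R).

Definition independent_maps d1 d2 (E : measurableType d1) (F : measurableType d2)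
    (f : T -> E) (g : T -> F) :=
  forall A B, measurable A -> measurable B ->
    P (f @^-1` A `&` g @^-1` B) = P (f @^-1` A) * P (g @^-1` B).

(** Independence says that the law of the pair is the product of the two
    laws; the integral is then computed by the Fubini-Tonelli theorem. *)
Lemma independent_fubini d1 d2 (E : measurableType d1) (F : measurableType d2)
    (f : T -> E) (g : T -> F) (h : E * F -> \bar R) :
  measurable_fun setT f -> measurable_fun setT g -> independent_maps f g ->
  measurable_fun setT h -> (forall x, 0 <= h x) ->
  \int[P]_t h (f t, g t) = \int[P]_t \int[P]_s h (f t, g s).
Proof.
move=> mf mg fg mh h0.
pose f' : {mfun T >-> E} := HB.pack f (isMeasurableFun.Build _ _ _ _ _ mf).
pose g' : {mfun T >-> F} := HB.pack g (isMeasurableFun.Build _ _ _ _ _ mg).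
have mfg : measurable_fun setT (fun t => (f t, g t)).
  exact: measurable_fun_pair.
transitivity (\int[pushforward P (fun t => (f t, g t))]_x h x).
  by rewrite ge0_integral_pushforward.
transitivity (\int[distribution P f' \x distribution P g']_x h x).
  apply: eq_measure_integral => A mA _; apply/esym.
  by apply: product_measure_unique => // B C mB mC; exact: fg.
rewrite fubini_tonelli1//= /fubini_F ge0_integral_pushforward//=.
- apply: eq_integral => t _; rewrite ge0_integral_pushforward//=.
  exact: (measurableT_comp mh).
- exact: measurable_fun_fubini_tonelli_F.
- by move=> x _; exact: integral_ge0.
Qed.

(** The set functions [B |-> P (A & B)] and [P A * P] are finite measures
    that agree on the pi-system [G], hence on the sigma-algebra that it
    generates. *)
Lemma independent_generated (G : set (set T)) (A : set T) :
  G `<=` measurable -> setI_closed G -> G setT -> measurable A ->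
  (forall B, G B -> P (A `&` B) = P A * P B) ->
  forall B, <<s G >> B -> P (A `&` B) = P A * P B.
Proof.
move=> Gm GI GT mA AG B GB.
have PA0 : (0 <= fine (P A))%R by exact: fine_ge0.
have PAE : P A = (fine (P A))%:E by rewrite fineK// fin_num_measure.
rewrite setIC PAE.
have := @g_sigma_algebra_measure_unique _ R T G Gm (fun=> setT) (fun=> GT) _
  (mrestr P mA) (mscale (NngNum PA0) P) GI _ _ B GB.
apply.
- by apply/seteqP; split => // t _; exists 0%N.
- move=> C GC; transitivity (P (C `&` A)) => //.
  by rewrite setIC AG// [in LHS]PAE.
- move=> _; apply: (@le_lt_trans _ _ (P A)); last first.
    by rewrite (le_lt_trans (probability_le1 P mA))// ltry.
  by apply: le_measure; rewrite ?inE//=; exact: measurableI.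
Qed.

End independence.

Section iid_family.
Context d (T : measurableType d) (R : realType) (P : probability T R).
Variable c : seq nat -> {RV P >-> mark R}.
Hypothesis ind : forall (s : seq (seq nat)) (B : seq nat -> set (mark R)),
  uniq s -> (forall u, measurable (B u)) ->
  P (\bigcap_(u in [set` s]) c u @^-1` B u) = \prod_(u <- s) P (c u @^-1` B u).

Definition marks_events (V : set (seq nat)) : set (set T) :=
  [set A | exists u (B : set (mark R)),
     [/\ V u, measurable B & A = c u @^-1` B]].

(** Closed under intersection, unlike the events that bear on a single
    vertex, and generating the same sigma-algebra: this is the pi-system to
    which the product rule is applied. *)
Definition cylinders (V : set (seq nat)) : set (set T) :=
  [set A | exists (s : seq (seq nat)) (B : seq nat -> set (mark R)),
     [/\ uniq s, forall u, u \in s -> V u, forall u, measurable (B u) &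
         A = \bigcap_(u in [set` s]) c u @^-1` B u]].

Lemma cylinders_measurable V : cylinders V `<=` measurable.
Proof.
move=> _ [s [B [us sV mB ->]]]; rewrite bigcap_seq.
apply: bigsetI_measurable => u _.
exact: measurable_funPTI.
Qed.

Lemma cylindersT V : cylinders V setT.
Proof.
exists [::], (fun=> setT); split => //.
by apply/seteqP; split => // t _ u.
Qed.

Lemma cylindersI V : setI_closed (cylinders V).
Proof.
move=> _ _ [s1 [B1 [u1 V1 m1 ->]]] [s2 [B2 [u2 V2 m2 ->]]].
exists (undup (s1 ++ s2)), (fun u =>
  (if u \in s1 then B1 u else setT) `&` (if u \in s2 then B2 u else setT)).
split.
- exact: undup_uniq.
- by move=> u; rewrite mem_undup mem_cat => /orP[/V1|/V2].
- by move=> u; apply: measurableI; case: ifP.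
- apply/seteqP; split => t.
    by move=> [h1 h2] u _; split; case: ifP => // us; [exact: h1|exact: h2].
  move=> h; split => u /= us; have /= := h u.
    by rewrite mem_undup mem_cat us => /(_ isT)[].
  by rewrite mem_undup mem_cat us orbT => /(_ isT)[].
Qed.

Lemma marks_events_cylinders V : <<s marks_events V >> `<=` <<s cylinders V >>.
Proof.
apply: sub_sigma_algebra2 => _ [u [B [Vu mB ->]]].
exists [:: u], (fun=> B); split => //; first by move=> v; rewrite inE => /eqP ->.
apply/seteqP; split => [t Bt v /=|t]; first by rewrite inE => /eqP ->.
by apply; rewrite /= inE.
Qed.

(** The product rule for finite families gives the identity on cylinders; it
    is extended to the generated sigma-algebras one side at a time. *)
Lemma marks_events_independent V1 V2 : V1 `&` V2 = set0 ->
  forall A B, <<s marks_events V1 >> A -> <<s marks_events V2 >> B ->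
    P (A `&` B) = P A * P B.
Proof.
move=> V12 A B /marks_events_cylinders A1 /marks_events_cylinders B2.
have sm V : <<s cylinders V >> `<=` measurable.
  by apply: smallest_sub; [exact: sigma_algebra_measurable|exact: cylinders_measurable].
have h C : cylinders V1 C -> P (C `&` B) = P C * P B.
  move=> C1; apply: (independent_generated (G := cylinders V2)) B2.
  - exact: cylinders_measurable.
  - exact: cylindersI.
  - exact: cylindersT.
  - exact: (cylinders_measurable C1).
  case: C1 => s1 [B1 [u1 sV1 m1 ->]] _ [s2 [B2 [u2 sV2 m2 ->]]].
  have s12 u : u \in s2 -> u \notin s1.
    move=> us2; apply/negP => us1.
    by have : (V1 `&` V2) u by [split; [exact: sV1|exact: sV2]]; rewrite V12.
  pose B' u := if u \in s1 then B1 u else B2 u.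
  rewrite (_ : _ `&` _ = \bigcap_(u in [set` s1 ++ s2]) c u @^-1` B' u); last first.
    apply/seteqP; split => t.
      move=> [h1 h2] u /=; rewrite mem_cat /B' => us; case: ifPn => us1; first exact: h1.
      by apply: h2; move: us; rewrite (negbTE us1).
    move=> h; split => u /= us; have := h u; rewrite /= mem_cat us ?orbT /B' => /(_ isT).
      by rewrite us.
    by rewrite (negbTE (s12 _ us)).
  rewrite ind; last 2 first.
  - by rewrite cat_uniq u1 u2 andbT; apply/hasPn => u /s12.
  - by move=> u; rewrite /B'; case: ifP.
  rewrite big_cat/= !ind//; congr (_ * _); apply: eq_big_seq => u us.
    by rewrite /B' us.
  by rewrite /B' (negbTE (s12 _ us)).
rewrite setIC muleC; apply: (independent_generated (G := cylinders V1)) A1.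
- exact: cylinders_measurable.
- exact: cylindersI.
- exact: cylindersT.
- exact: (sm _ _ B2).
- by move=> C /h; rewrite setIC muleC.
Qed.

(** The same underlying type [T], with the sigma-algebra of the marks carried
    by the vertices of [V]: measurability from this space says that a
    quantity depends on those marks only. *)
Definition marks_space V := g_sigma_algebraType (marks_events V).

Lemma measurable_mark V u : V u ->
  measurable_fun setT (c u : marks_space V -> mark R).
Proof.
move=> Vu _ B mB; rewrite setTI; apply: sub_sigma_algebra.
by exists u, B.
Qed.

Lemma marks_space_measurable V d' (E : measurableType d') (f : T -> E) :
  measurable_fun setT (f : marks_space V -> E) -> measurable_fun setT f.
Proof.
move=> mf _ B mB; have := mf measurableT B mB; rewrite !setTI.
apply: smallest_sub => //; first exact: sigma_algebra_measurable.
move=> _ [u [C [Vu mC ->]]].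
exact: measurable_funPTI.
Qed.

Lemma marks_space_independent V1 V2 d1 d2 (E : measurableType d1)
    (F : measurableType d2) (f : T -> E) (g : T -> F) : V1 `&` V2 = set0 ->
  measurable_fun setT (f : marks_space V1 -> E) ->
  measurable_fun setT (g : marks_space V2 -> F) ->
  independent_maps P f g.
Proof.
move=> V12 mf mg A B mA mB; apply: (marks_events_independent V12).
  by have := mf measurableT A mA; rewrite setTI.
by have := mg measurableT B mB; rewrite setTI.
Qed.

End iid_family.

(** * The root recursion for truncated trees *)

Lemma measurable_fun_lee_bool d (T : measurableType d) (R : realType)
    (f g : T -> \bar R) : measurable_fun setT f -> measurable_fun setT g ->
  measurable_fun setT (fun t => f t <= g t).
Proof.
move=> mf mg; apply: (@measurable_fun_bool _ _ _ _ true).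
exact: (measurable_lee measurableT mf mg).
Qed.

Section truncated_suprema.
Context (R : realType).

(** The supremum of the Lambda_v truncated at generation [n], by recursion on
    the children of the root. It reads all marks of the Ulam-Harris tree, so
    that the recursion can use independence of subtrees before knowing which
    of them are present. *)
Fixpoint sup_upto (n : nat) (M : seq nat -> mark R) : \bar R :=
  if n is n'.+1 then
    maxe (M [::]).1.2%:E
      (\big[maxe/-oo]_(i < size ((M [::]).1.1 : seq R))
         ((nth 0%R ((M [::]).1.1 : seq R) i)%:E
          + sup_upto n' (fun u => M (nat_of_ord i :: u))))
  else -oo.

Lemma sup_upto_le n M (r : R) : sup_upto n.+1 M <= r%:E <->
  ((M [::]).1.2 <= r)%R /\
  forall i, (i < size ((M [::]).1.1 : seq R))%N ->
    sup_upto n (fun u => M (i :: u))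
    <= (r - nth 0%R ((M [::]).1.1 : seq R) i)%:E.
Proof.
rewrite /= ge_max lee_fin; split.
  move=> /andP[-> /bigmax_leP[_ h]]; split => // i im.
  by have := h (Ordinal im) isT; rewrite /= EFinB leeBrDl.
move=> [-> h]; apply/bigmax_leP; split; first exact: leNye.
by move=> i _; have := h i (ltn_ord i); rewrite EFinB leeBrDl.
Qed.

Lemma measurable_sup_upto n d (Y : measurableType d)
    (C : seq nat -> Y -> mark R) : (forall u, measurable_fun setT (C u)) ->
  measurable_fun setT (fun y => sup_upto n (fun u => C u y)).
Proof.
elim: n C => [C _|n IH C mC] /=; first exact: measurable_cst.
apply: measurable_maxe.
  apply: measurableT_comp => //.
  exact: (measurable_Lam (mC [::])).
have ma := measurable_atoms (mC [::]).
apply: (measurable_by_size ma) => m.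
apply: (@eq_measurable_fun _ _ _ _ _ (fun y => \big[maxe/-oo]_(i < m)
    ((nth 0%R (atoms (C [::]) y) i)%:E
     + sup_upto n (fun u => C (nat_of_ord i :: u) y)))).
  by move=> y; rewrite inE /= => <-.
apply: measurable_funTS.
elim: m => [|m IHm].
  by apply: (@eq_measurable_fun _ _ _ _ _ (fun=> -oo)) => // y _; rewrite big_ord0.
apply: (@eq_measurable_fun _ _ _ _ _ (fun y => maxe
    (\big[maxe/-oo]_(i < m) ((nth 0%R (atoms (C [::]) y) i)%:E
     + sup_upto n (fun u => C (nat_of_ord i :: u) y)))
    ((nth 0%R (atoms (C [::]) y) m)%:E
     + sup_upto n (fun u => C (m :: u) y)))).
  by move=> y _; rewrite big_ord_recr.
apply: measurable_maxe => //; apply: emeasurable_funD.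
  apply: measurableT_comp => //; exact: (measurable_atom ma).
exact: (IH (fun u => C (m :: u))).
Qed.

End truncated_suprema.

Section tree_recursion.
Context d (T : measurableType d) (R : realType) (P : probability T R).

Lemma tree_cons (c : seq nat -> {RV P >-> mark R}) t i u :
  tree c t (i :: u) <->
  (i < size (atoms (c [::]) t))%N /\ tree (fun v => c (i :: v)) t u.
Proof.
split.
  move=> h; have [v vE] : exists v, v = i :: u by exists (i :: u).
  rewrite -vE in h; elim: h i u vE => // v' j h IH jv i u.
  case: v' h IH jv => [|k v'] h IH jv /= [<- <-].
    by split => //; exact: tree_root.
  have [ks tv'] := IH _ _ erefl; split => //.
  exact: tree_child.
move=> [iu]; elim => [|v j tv IH jv].
  by rewrite -[[:: i]]/(rcons [::] i); apply: tree_child => //; exact: tree_root.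
by rewrite -rcons_cons; exact: tree_child.
Qed.

Lemma vertex_Lam_cons (c : seq nat -> {RV P >-> mark R}) t i u :
  vertex_Lam c (i :: u) t =
  (nth 0 (atoms (c [::]) t) i + vertex_Lam (fun v => c (i :: v)) u t)%R.
Proof. by rewrite /vertex_Lam /position big_ord_recl /= -addrA. Qed.

Lemma sup_upto_leP n (c : seq nat -> {RV P >-> mark R}) t (r : R) :
  sup_upto n (fun u => c u t) <= r%:E <->
  forall u, tree c t u -> (size u < n)%N -> (vertex_Lam c u t <= r)%R.
Proof.
elim: n c r => [|n IH] c r; first by split => // _; rewrite leNye.
rewrite sup_upto_le; split.
  move=> [h0 h] [|i u].
    by move=> _ _; rewrite /vertex_Lam position_root add0r.
  move=> /tree_cons[iu tu] su; rewrite vertex_Lam_cons -lerBrDl.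
  exact: (proj1 (IH (fun v => c (i :: v)) _) (h i iu)).
move=> h; split.
  have := h [::] (tree_root _ _) isT.
  by rewrite /vertex_Lam position_root add0r.
move=> i iu; apply/(IH (fun v => c (i :: v))) => u tu su.
by rewrite lerBrDl -vertex_Lam_cons; apply: h => //; apply/tree_cons.
Qed.

(** Every vertex lies in some generation, so the supremum is controlled by
    its truncations. *)
Lemma sup_Lam_leP (c : seq nat -> {RV P >-> mark R}) t (r : R) :
  sup_Lam c t <= r%:E <-> forall n, sup_upto n (fun u => c u t) <= r%:E.
Proof.
split=> [h n|h].
  apply/sup_upto_leP => u tu _; rewrite -lee_fin; apply: le_trans h.
  by apply: ereal_sup_ubound; exists u.
apply: ge_ereal_sup => _ [u tu <-]; rewrite lee_fin.
by apply: (proj1 (sup_upto_leP (size u).+1 c t r)) => //; exact: h.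
Qed.

Lemma measurable_sup_Lam_le (c : seq nat -> {RV P >-> mark R}) (r : R) :
  measurable [set t | sup_Lam c t <= r%:E].
Proof.
rewrite (_ : [set _ | _] =
    \bigcap_n [set t | sup_upto n (fun u => c u t) <= r%:E]).
  apply: bigcapT_measurable => n; rewrite -[X in measurable X]setTI.
  by apply: emeasurable_fun_infty_c => //; exact: measurable_sup_upto.
apply/seteqP; split => [t /= /sup_Lam_leP h n _ //=|t h].
by apply/sup_Lam_leP => n; exact: h.
Qed.

End tree_recursion.

Section recursion.
Context d0 (T0 : measurableType d0) (R : realType) (P0 : probability T0 R)
  (X : {RV P0 >-> mark R}).
Context d (T : measurableType d) (P : probability T R).

(** The recursion operator of the branching random walk: the probability that
    the root and the subtrees of its children stay below [r], if a subtree
    started from [0] stays below [x] with probability [F x]. *)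
Definition one_generation (F : R -> R) (r : R) : \bar R :=
  \int[P0]_t (if (Lam X t <= r)%R then \prod_(x <- atoms X t) F (r - x) else 0)%R%:E.

(** Finite families of vertices below [i] are finite families of vertices. *)
Lemma iid_copies_child (c : seq nat -> {RV P >-> mark R}) i :
  iid_copies X c -> iid_copies X (fun u => c (i :: u)).
Proof.
move=> [law ind]; split => [u B mB|s B us mB]; first exact: law.
have := ind (map (cons i) s) (fun v => B (behead v)) _ (fun v => mB _).
rewrite map_inj_uniq; last by move=> a b [].
move=> /(_ us); rewrite big_map /= => <-; congr (P _).
apply/seteqP; split => t h u /=.
  by move=> /mapP[v vs ->] /=; exact: h.
by move=> us'; have := h (i :: u); apply; apply/mapP; exists u.
Qed.

Section one_step.
Variables (c : seq nat -> {RV P >-> mark R}) (n : nat) (F : R -> R) (r : R).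
Hypothesis hc : iid_copies X c.
Hypothesis mF : measurable_fun setT F.
Hypothesis F0 : forall x, (0 <= F x)%R.
Hypothesis PF : forall i x,
  P [set t | sup_upto n (fun u => c (i :: u) t) <= x%:E] = (F x)%:E.

Let child i t := sup_upto n (fun u => c (i :: u) t).
Let x_ i (m : mark R) := nth 0%R (m.1.1 : seq R) i.
Let below k t := all (fun i => child i t <= (r - x_ i (c [::] t))%:E) (iota 0 k).

Let mx i : measurable_fun setT (x_ i).
Proof.
apply: (measurableT_comp (measurable_nth i)).
exact: (measurableT_comp measurable_fst measurable_fst).
Qed.

Let V k : set (seq nat) := [set u | u = [::] \/ exists i v, (i < k)%N /\ u = i :: v].

Let mchild i k : (i < k)%N ->
  measurable_fun setT (child i : marks_space c (V k) -> \bar R).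
Proof.
move=> ik; apply: (@measurable_sup_upto R n _ (marks_space c (V k))
  (fun u => c (i :: u) : T -> mark R)) => u.
by apply: measurable_mark; right; exists i, u.
Qed.

Let mbelow k : measurable_fun setT (below k : marks_space c (V k) -> bool).
Proof.
rewrite /below; have : {subset iota 0 k <= gtn k}.
  by move=> i; rewrite mem_iota add0n.
elim: (iota 0 k) => [_|i s IH is_k]; first exact: measurable_cst.
apply: measurable_and; last first.
  by apply: IH => j js; apply: is_k; rewrite inE js orbT.
apply: measurable_fun_lee_bool.
- by apply: mchild; apply: is_k; rewrite inE eqxx.
- apply: measurableT_comp => //; apply: measurable_funB => //.
  apply: (measurableT_comp (mx i)); apply: measurable_mark; by left.
Qed.

Let children k (h : mark R -> \bar R) :
  measurable_fun setT h -> (forall m, 0 <= h m) ->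
  \int[P]_t (h (c [::] t) * (below k t)%:R%:E)
  = \int[P]_t (h (c [::] t) * (\prod_(i < k) F (r - x_ i (c [::] t)))%:E).
Proof.
elim: k h => [|k IH] h mh h0.
  by apply: eq_integral => t _; rewrite big_ord0.
transitivity (\int[P]_t (h (c [::] t) * (F (r - x_ k (c [::] t)))%:E
    * (below k t)%:R%:E)); last first.
  rewrite (IH (fun m => h m * (F (r - x_ k m))%:E)).
  - apply: eq_integral => t _.
    by rewrite big_ord_recr /= [X in _ = h _ * X]EFinM muleA muleAC.
  - apply: emeasurable_funM => //; apply: measurableT_comp => //.
    by apply: measurableT_comp => //; exact: measurable_funB.
  - by move=> m; rewrite mule_ge0// lee_fin.
pose H (p : mark R * bool * \bar R) : \bar R :=
  h p.1.1 * (p.1.2 && (p.2 <= (r - x_ k p.1.1)%:E)%E)%:R%:E.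
have mH : measurable_fun setT H.
  apply: emeasurable_funM.
    exact: (measurableT_comp mh (measurableT_comp measurable_fst measurable_fst)).
  apply: measurableT_comp => //.
  apply: (@measurableT_comp _ _ _ _ _ _ (fun b : bool => b%:R : R)) => //.
  apply: measurable_and.
    exact: (measurableT_comp measurable_snd measurable_fst).
  apply: measurable_fun_lee_bool => //.
  apply: measurableT_comp => //; apply: measurable_funB => //.
  exact: (measurableT_comp (mx k) (measurableT_comp measurable_fst measurable_fst)).
have H0 p : 0 <= H p by rewrite mule_ge0// lee_fin.
pose f t := (c [::] t, below k t).
have mf : measurable_fun setT (f : marks_space c (V k) -> (mark R * bool)%type).
  by apply: measurable_fun_pair => //; apply: measurable_mark; left.
pose Vk := [set u : seq nat | exists v, u = k :: v].
have mg : measurable_fun setT (child k : marks_space c Vk -> \bar R).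
  apply: (@measurable_sup_upto R n _ (marks_space c Vk)
    (fun u => c (k :: u) : T -> mark R)) => u.
  by apply: measurable_mark; exists u.
have VVk : V k `&` Vk = set0.
  apply/seteqP; split => // u [[->|[i [v [ik ->]]]] [v']] // [ik' _].
  by move: ik; rewrite ik' ltnn.
have fg := marks_space_independent hc.2 VVk mf mg.
transitivity (\int[P]_t H (f t, child k t)).
  apply: eq_integral => t _; rewrite /H /f /=; congr (_ * (nat_of_bool _)%:R%:E).
  by rewrite /below -addn1 iotaD all_cat /= andbT add0n.
rewrite (independent_fubini _ _ fg mH H0); last 2 first.
- exact: (marks_space_measurable mf).
- exact: (marks_space_measurable mg).
apply: eq_integral => t _; rewrite /H /f /=.
have mC x : measurable [set s | child k s <= x%:E].
  rewrite -[X in measurable X]setTI; apply: emeasurable_fun_infty_c => //.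
  exact: (marks_space_measurable mg).
transitivity (\int[P]_s ((h (c [::] t) * (below k t)%:R%:E) *
    (\1_([set s | (child k s <= (r - x_ k (c [::] t))%:E)%E]) s)%:E)).
  apply: eq_integral => s _; rewrite -muleA -EFinM indicE; congr (_ * _%:E).
  case: (below k t); rewrite ?mul1r ?mul0r//=.
  by congr (nat_of_bool _)%:R; apply/idP/idP; rewrite inE.
rewrite ge0_integralZl//; last 2 first.
- by apply/measurable_EFinP; exact: measurable_indic.
- by rewrite mule_ge0// lee_fin.
rewrite integral_indic// setIT.
rewrite [X in _ * X](_ : _ = (F (r - x_ k (c [::] t)))%:E); last exact: PF.
by rewrite muleAC.
Qed.

(** Decompose according to the number [k] of children. For fixed [k], the
    events that the subtrees of the first [k] children stay below their
    levels are removed one at a time: given the mark of the root, the [k]-th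
    subtree is independent of the root and of the previous subtrees, since
    they use disjoint sets of marks. *)
Lemma sup_upto_step :
  P [set t | sup_upto n.+1 (fun u => c u t) <= r%:E] = one_generation F r.
Proof.
have ma : measurable_fun setT (fun t => atoms (c [::]) t : atom_seqs R).
  exact: measurable_atoms.
pose g (m : mark R) : R :=
  (if (m.1.2 <= r)%R then \prod_(x <- (m.1.1 : seq R)) F (r - x) else 0)%R.
have mg : measurable_fun setT g.
  apply: measurable_fun_ifT => //.
    apply: measurable_fun_ler => //.
    exact: (measurableT_comp measurable_snd measurable_fst).
  have ma1 : measurable_fun setT (fun m : mark R => m.1.1 : atom_seqs R).
    exact: (measurableT_comp measurable_fst measurable_fst).
  apply: (measurable_prod_atoms ma1 (f := fun p => F (r - p.2))).
  by apply: measurableT_comp => //; exact: measurable_funB.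
have g0 m : (0 <= g m)%R by rewrite /g; case: ifP => // _; exact: prodr_ge0.
transitivity (\int[P]_t (g (c [::] t))%:E); last first.
  apply: (eq_law_integral (h := fun m => (g m)%:E)).
  - exact: measurable_funPT.
  - exact: measurable_funPT.
  - by move=> B mB; exact: hc.1.
  - exact/measurable_EFinP.
  - by move=> x; rewrite lee_fin.
pose E := [set t | sup_upto n.+1 (fun u => c u t) <= r%:E].
have mE : measurable E.
  rewrite -[X in measurable X]setTI; apply: emeasurable_fun_infty_c => //.
  by apply: measurable_sup_upto => u; exact: measurable_funPT.
transitivity (\int[P]_t (\1_E t)%:E); first by rewrite integral_indic// setIT.
(* sorting by the number of children makes the number of subtrees constant *)
pose D k := [set t | size (atoms (c [::]) t) = k].
have mD k : measurable (D k) by exact: (measurable_size_set ma [set k]).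
have tD : trivIset setT D.
  by move=> i j _ _ [t [<- <-]].
have UD : \bigcup_k D k = setT.
  by apply/seteqP; split => // t _; exists (size (atoms (c [::]) t)).
have split_int f : measurable_fun setT f -> (forall t, 0 <= f t) ->
    \int[P]_t f t = \sum_(0 <= k <oo) \int[P]_(t in D k) f t.
  move=> mf f0; rewrite -UD ge0_integral_bigcup//.
  by rewrite UD.
rewrite (split_int (fun t => (\1_E t)%:E)); last 2 first.
- by apply/measurable_EFinP; exact: measurable_indic.
- by move=> t; rewrite lee_fin.
rewrite (split_int (fun t => (g (c [::] t))%:E)); last 2 first.
- by apply/measurable_EFinP; apply: (measurableT_comp mg); exact: measurable_funPT.
- by move=> t; rewrite lee_fin.
apply: eq_eseriesr => k _.
pose h (m : mark R) : \bar R :=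
  ((size (m.1.1 : seq R) == k) && (m.1.2 <= r)%R)%:R%:E.
have mh : measurable_fun setT h.
  apply: measurableT_comp => //.
  apply: (@measurableT_comp _ _ _ _ _ _ (fun b : bool => b%:R : R)) => //.
  apply: measurable_and; last first.
    apply: measurable_fun_ler => //.
    exact: (measurableT_comp measurable_snd measurable_fst).
  apply: measurable_fun_eqn => //.
  apply: (measurableT_comp (@measurable_size R)).
  exact: (measurableT_comp measurable_fst measurable_fst).
have h0 m : 0 <= h m by rewrite lee_fin.
have inD t : (t \in D k) = (size (atoms (c [::]) t) == k).
  by apply/idP/eqP; rewrite inE.
rewrite integral_mkcond [RHS]integral_mkcond.
transitivity (\int[P]_t (h (c [::] t) * (below k t)%:R%:E)).
  apply: eq_integral => t _; rewrite patchE inD /h /= indicE /below.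
  rewrite -EFinM -natrM mulnb; case: eqP => //= sk; congr (nat_of_bool _)%:R%:E.
  apply/idP/andP; rewrite inE /E /=.
    move=> /(proj1 (sup_upto_le n (fun u => c u t) r))[-> hi].
    split => //; apply/allP => i.
    by rewrite mem_iota add0n -sk => /hi.
  move=> [h1 /allP h2]; apply: (proj2 (sup_upto_le n (fun u => c u t) r)).
  split => // i ik.
  by apply: h2; rewrite mem_iota add0n -sk.
rewrite children//; apply: eq_integral => t _.
rewrite patchE inD /h /g /=; case: eqP => /= sk; last by rewrite mul0e.
case: ifP => _ /=; last by rewrite mul0e.
by rewrite mul1e (big_nth 0%R) big_mkord -sk.
Qed.

End one_step.

(** The law of the truncated supremum depends on the i.i.d. family only
    through the law of the reproduction scheme; it is needed because the
    subtree of a child is driven by another family. *)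
Lemma sup_upto_law n (c c' : seq nat -> {RV P >-> mark R}) (r : R) :
  iid_copies X c -> iid_copies X c' ->
  P [set t | sup_upto n (fun u => c u t) <= r%:E] =
  P [set t | sup_upto n (fun u => c' u t) <= r%:E].
Proof.
elim: n c c' r => [|n IH] c c' r hc hc' //.
pose F x := fine (P [set t | sup_upto n (fun u => c u t) <= x%:E]).
have mY (e : seq nat -> {RV P >-> mark R}) x :
    measurable [set t | sup_upto n (fun u => e u t) <= x%:E].
  rewrite -[X in measurable X]setTI; apply: emeasurable_fun_infty_c => //.
  by apply: measurable_sup_upto => u; exact: measurable_funPT.
have F0 x : (0 <= F x)%R by exact: fine_ge0.
have mF : measurable_fun setT F.
  apply: nondecreasing_measurable => // x y xy.
  apply: fine_le; rewrite ?fin_num_measure//.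
  apply: le_measure; rewrite ?inE// => t /= /le_trans; apply.
  by rewrite lee_fin.
have PF (e : seq nat -> {RV P >-> mark R}) : iid_copies X e -> forall i x,
    P [set t | sup_upto n (fun u => e (i :: u) t) <= x%:E] = (F x)%:E.
  move=> he i x; rewrite (IH _ c)//; last exact: iid_copies_child.
  by rewrite /F fineK// fin_num_measure.
by rewrite (sup_upto_step r hc mF F0 (PF _ hc)) (sup_upto_step r hc' mF F0 (PF _ hc')).
Qed.

End recursion.

(** * The law of the supremum *)

Section probability_integrals.
Context d (T : measurableType d) (R : realType) (P : probability T R).

Lemma bounded_cvg (f_ : nat -> T -> R) (f : T -> R) :
  (forall n, measurable_fun setT (f_ n)) -> measurable_fun setT f ->
  (forall n t, 0 <= f_ n t <= 1)%R -> (forall t, (f_ ^~ t) @ \oo --> f t) ->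
  (fun n => \int[P]_t (f_ n t)%:E) @ \oo --> \int[P]_t (f t)%:E.
Proof.
move=> mf_ mf f01 ff.
have [|||||_ _] := @dominated_convergence _ _ _ P setT measurableT
  (fun n t => (f_ n t)%:E) (fun t => (f t)%:E) (cst 1); last by [].
- by move=> n; exact/measurable_EFinP.
- exact/measurable_EFinP.
- by apply: aeW => t _; apply: cvg_EFin; [exact: nearW|exact: ff].
- exact: finite_measure_integrable_cst.
- apply: aeW => t n _; rewrite lee_fin ger0_norm; by case/andP: (f01 n t).
Qed.

Lemma integral_ge0_eq0 (f : T -> \bar R) : measurable_fun setT f ->
  (forall t, 0 <= f t) -> \int[P]_t f t = 0 -> {ae P, forall t, f t = 0}.
Proof.
move=> mf f0 If; have : \int[P]_t `|f t| = 0.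
  by rewrite -[RHS]If; apply: eq_integral => t _; rewrite gee0_abs.
move=> /(ae_eq_integral_abs P measurableT mf).
by apply: filterS => t /(_ I).
Qed.

End probability_integrals.

Section generation_operator.
Context d (T : measurableType d) (R : realType) (P : probability T R)
  (X : {RV P >-> mark R}).

Definition gen_integrand (F : R -> R) (r : R) (t : T) : R :=
  (if Lam X t <= r then \prod_(x <- atoms X t) F (r - x) else 0)%R.

Let mX : measurable_fun setT X. Proof. exact: measurable_funPT. Qed.

Lemma measurable_gen_integrand F r :
  measurable_fun setT F -> measurable_fun setT (gen_integrand F r).
Proof.
move=> mF; apply: measurable_fun_ifT => //.
  by apply: measurable_fun_ler => //; exact: measurable_Lam.
apply: (measurable_prod_atoms (measurable_atoms mX) (f := fun p => F (r - p.2)%R)).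
by apply: measurableT_comp => //; exact: measurable_funB.
Qed.

Lemma gen_integrand01 F r t : (forall x, 0 <= F x <= 1)%R ->
  (0 <= gen_integrand F r t <= 1)%R.
Proof.
move=> F01; rewrite /gen_integrand; case: ifP => _; last by rewrite lexx ler01.
rewrite prodr_ge0 /=; last by move=> x _; case/andP: (F01 (r - x)%R).
by apply: prodr_ile1 => x _; exact: F01.
Qed.

Lemma cvg_prod_seq (I : Type) (s : seq I) (f_ : nat -> I -> R) (f : I -> R) :
  (forall i, f_ ^~ i @ \oo --> f i) ->
  (fun n => \prod_(i <- s) f_ n i)%R @ \oo --> (\prod_(i <- s) f i)%R.
Proof.
move=> ff; elim: s => [|i s IH].
  rewrite big_nil; under eq_fun do rewrite big_nil; exact: cvg_cst.
by rewrite big_cons; under eq_fun do rewrite big_cons; apply: cvgM.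
Qed.

End generation_operator.

Section supremum_law.
Context d0 (T0 : measurableType d0) (R : realType) (P0 : probability T0 R)
  (X : {RV P0 >-> mark R}).
Context d (T : measurableType d) (P : probability T R)
  (c : seq nat -> {RV P >-> mark R}).
Hypothesis hc : iid_copies X c.

Definition supF (r : R) : R := fine (P [set t | sup_Lam c t <= r%:E]).

Lemma supFE r : P [set t | sup_Lam c t <= r%:E] = (supF r)%:E.
Proof. by rewrite /supF fineK// fin_num_measure//; exact: measurable_sup_Lam_le. Qed.

Lemma supF01 r : (0 <= supF r <= 1)%R.
Proof.
by rewrite -!lee_fin -supFE measure_ge0 probability_le1//; exact: measurable_sup_Lam_le.
Qed.

Lemma supF_nd r r' : (r <= r')%R -> (supF r <= supF r')%R.
Proof.
move=> rr'; rewrite -lee_fin -!supFE; apply: le_measure.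
- by rewrite inE; exact: measurable_sup_Lam_le.
- by rewrite inE; exact: measurable_sup_Lam_le.
- by move=> t /= /le_trans; apply; rewrite lee_fin.
Qed.

Lemma measurable_supF : measurable_fun setT supF.
Proof. by apply: nondecreasing_measurable => // *; exact: supF_nd. Qed.

Let Fn n (r : R) : R := fine (P [set t | sup_upto n (fun u => c u t) <= r%:E]).

Let mFn_set n (e : seq nat -> {RV P >-> mark R}) (r : R) :
  measurable [set t | sup_upto n (fun u => e u t) <= r%:E].
Proof.
rewrite -[X in measurable X]setTI; apply: emeasurable_fun_infty_c => //.
by apply: measurable_sup_upto => u; exact: measurable_funPT.
Qed.

Let FnE n r : P [set t | sup_upto n (fun u => c u t) <= r%:E] = (Fn n r)%:E.
Proof. by rewrite /Fn fineK// fin_num_measure. Qed.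

Let Fn01 n r : (0 <= Fn n r <= 1)%R.
Proof. by rewrite -!lee_fin -FnE measure_ge0 probability_le1. Qed.

Let mFn n : measurable_fun setT (Fn n).
Proof.
apply: nondecreasing_measurable => // x y xy.
rewrite -lee_fin -!FnE; apply: le_measure; rewrite ?inE// => t /= /le_trans; apply.
by rewrite lee_fin.
Qed.

Let Fn_rec n r : (Fn n.+1 r)%:E = one_generation X (Fn n) r.
Proof.
rewrite -FnE; apply: sup_upto_step => //; first by move=> x; case/andP: (Fn01 n x).
move=> i x; rewrite -FnE; apply: (@sup_upto_law _ _ _ _ X) => //.
exact: (iid_copies_child i hc).
Qed.

Let Fn_cvg r : Fn ^~ r @ \oo --> supF r.
Proof.
suff : (fun n => P [set t | sup_upto n (fun u => c u t) <= r%:E]) @ \oo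
    --> (supF r)%:E by exact: fine_cvg.
rewrite -supFE.
have E : [set t | sup_Lam c t <= r%:E] =
    \bigcap_n [set t | sup_upto n (fun u => c u t) <= r%:E].
  apply/seteqP; split => [t /= /sup_Lam_leP h n _ //=|t h].
  by apply/sup_Lam_leP => n; exact: h.
rewrite E; apply: (@nonincreasing_cvg_mu _ _ _ P).
- by rewrite (le_lt_trans (probability_le1 _ _))// ltry.
- by [].
- exact: bigcapT_measurable.
- move=> n m nm; apply/subsetPset => t /=.
  move=> /(proj1 (sup_upto_leP m c t r)) h.
  by apply/sup_upto_leP => u tu un; apply: h => //; exact: leq_trans un nm.
Qed.

(** Both sides are limits of the recursion between truncated trees, by
    continuity from above on the left and dominated convergence on the right. *)
Lemma supF_rec r : (supF r)%:E = one_generation X supF r.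
Proof.
have h1 : (fun n => (Fn n.+1 r)%:E) @ \oo --> (supF r)%:E.
  apply: cvg_EFin; first exact: nearW.
  by have := @Fn_cvg r; rewrite -cvg_shiftS.
have h2 : (fun n => (Fn n.+1 r)%:E) @ \oo --> one_generation X supF r.
  rewrite (_ : (fun n => _) = fun n => \int[P0]_t (gen_integrand X (Fn n) r t)%:E).
    apply: (@bounded_cvg _ _ _ P0) => [n||n t|t].
    - exact: measurable_gen_integrand.
    - exact: (measurable_gen_integrand X r measurable_supF).
    - exact: gen_integrand01.
    - rewrite /gen_integrand; case: ifP => _; last exact: cvg_cst.
      by apply: cvg_prod_seq => x; exact: Fn_cvg.
  by apply/funext => n; exact: Fn_rec.
by rewrite -(cvg_lim _ h1)// (cvg_lim _ h2).
Qed.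

Lemma wE r : w c r = (supF r)%:E^-1 - 1.
Proof. by rewrite /w supFE. Qed.

End supremum_law.

(** * Consequences of criticality *)

Section critical_offspring.
Context d0 (T0 : measurableType d0) (R : realType) (P0 : probability T0 R)
  (X : {RV P0 >-> mark R}) (sigma eta : R).
Hypothesis hA : assumptions X sigma eta.

Definition offspring (t : T0) : R := (size (atoms X t))%:R.

Let mX : measurable_fun setT X. Proof. exact: measurable_funPT. Qed.
Let ma := measurable_atoms mX.

Lemma measurable_offspring : measurable_fun setT offspring.
Proof.
apply: (measurable_by_size ma) => n.
by apply: (@eq_measurable_fun _ _ _ _ _ (fun=> n%:R : R)) => // t; rewrite inE /= => <-.
Qed.

Lemma offspring_ge0 t : (0 <= offspring t)%R. Proof. exact: ler0n. Qed.

Lemma chiTE t : chi X t setT = (offspring t)%:E.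
Proof. exact: point_massesT. Qed.

Lemma offspring_mean : \int[P0]_t (offspring t)%:E = 1.
Proof. by rewrite -(mean_offspring hA); apply: eq_integral => t _; rewrite chiTE. Qed.

Lemma offspring_sq : \int[P0]_t (offspring t ^+ 2)%:E = (sigma ^+ 2 + 1)%:E.
Proof.
rewrite -(var_offspring hA); apply: eq_integral => t _.
by rewrite chiTE EFin_expe.
Qed.

Lemma measurable_offspring_ge n : measurable [set t | (n <= size (atoms X t))%N].
Proof. exact: (measurable_size_set ma [set k | (n <= k)%N]). Qed.

(** Otherwise the offspring number would be at most [1], hence equal to its
    square, and the variance [sigma ^ 2] would vanish. *)
Lemma branching_pos : 0 < P0 [set t | (2 <= size (atoms X t))%N].
Proof.
rewrite lt_neqAle measure_ge0 andbT eq_sym; apply/eqP => h.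
have : \int[P0]_t (offspring t ^+ 2)%:E = \int[P0]_t (offspring t)%:E.
  apply: ae_eq_integral => //.
  - apply/measurable_EFinP; apply: measurable_funX; exact: measurable_offspring.
  - by apply/measurable_EFinP; exact: measurable_offspring.
  - exists [set t | (2 <= size (atoms X t))%N]; split => //.
      exact: measurable_offspring_ge.
    move=> t /= ht; rewrite leqNgt; apply/negP => h2; apply: ht => _.
    by rewrite /offspring; case: size h2 => [|[|]]// _; rewrite ?expr0n ?expr1n.
rewrite offspring_sq offspring_mean => -[]; have := sigma2_gt0 hA; lra.
Qed.

Lemma measurable_has (p : R -> bool) : measurable [set x | p x] ->
  measurable [set t | has p (atoms X t)].
Proof.
move=> mp; rewrite [X in measurable X](_ : _ = \bigcup_i
   ([set t | (i < size (atoms X t))%N] `&` [set t | p (nth 0%R (atoms X t) i)])).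
  apply: bigcupT_measurable => i; apply: measurableI.
    exact: (measurable_offspring_ge i.+1).
  by have := measurable_atom ma i measurableT mp; rewrite setTI.
apply/seteqP; split => [t /= /(has_nthP 0%R)[i im px]|t [i _ [/= h1 h2]]].
  by exists i.
by apply/(has_nthP 0%R); exists i.
Qed.

Lemma measurable_up (e : R) : measurable [set t | has (fun x => e <= x)%R (atoms X t)].
Proof.
apply: measurable_has; rewrite (_ : [set _ | _] = `[e, +oo[%classic)//.
by apply/seteqP; split => x; rewrite /= in_itv /= andbT.
Qed.

Let sumfin (s : seq R) : \sum_(x <- s) x%:E = (\sum_(x <- s) x)%R%:E.
Proof. by rewrite sumEFin. Qed.

Lemma integral_point_masses_id (s : seq R) :
  \int[point_masses s]_x x%:E = (\sum_(x <- s) x)%R%:E.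
Proof.
have mE : measurable_fun setT (fun x : R => x%:E) by exact: EFin_measurable.
rewrite integralE integral_point_masses//; last exact: measurable_funepos.
rewrite integral_point_masses//; last exact: measurable_funeneg.
elim: s => [|x s IH]; first by rewrite !big_nil sube0.
rewrite !big_cons.
have fin (f : R -> \bar R) (l : seq R) : (forall x, f x \is a fin_num) ->
    \sum_(x <- l) f x \is a fin_num.
  by move=> ff; elim: l => [|a l IHl]; rewrite ?big_nil// big_cons fin_numD ff.
have fp x' : (fun x : R => x%:E)^\+ x' \is a fin_num.
  by rewrite funeposE /=; case: (leP x'%:E 0).
have fn x' : (fun x : R => x%:E)^\- x' \is a fin_num.
  by rewrite funenegE /maxe; case: ifP.
rewrite fin_num_oppeD; last by [exact: fn|exact: fin].
apply: etrans; first exact: addeACA.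
rewrite EFinD -IH; congr (_ + _).
exact/esym/(congr1 (fun g => g x) (funeposneg (fun x : R => x%:E))).
Qed.

(** If no atom were positive, the mean displacement being zero would make all
    atoms vanish almost surely, against the positive variance [eta ^ 2]. *)
Lemma upward_jump : exists e : R, (0 < e)%R /\
  0 < P0 [set t | has (fun x => e <= x)%R (atoms X t)].
Proof.
apply: contrapT => noup.
have up0 k : P0 [set t | has (fun x => k.+1%:R^-1 <= x)%R (atoms X t)] = 0.
  apply/eqP; rewrite eq_le measure_ge0 andbT leNgt; apply/negP => h.
  by apply: noup; exists k.+1%:R^-1%R; split => //; rewrite invr_gt0.
have neg : {ae P0, forall t, forall x, x \in atoms X t -> (x <= 0)%R}.
  exists (\bigcup_k [set t | has (fun x => k.+1%:R^-1 <= x)%R (atoms X t)]); split.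
  - by apply: bigcupT_measurable => k; exact: measurable_up.
  - apply: measure_negligible.
      by apply: bigcupT_measurable => k; exact: measurable_up.
    apply: negligible_bigcup => k; apply/negligibleP; first exact: measurable_up.
    exact: up0.
  - move=> t /= ht; apply: contrapT => hb; apply: ht => x xt.
    rewrite leNgt; apply/negP => x0; apply: hb.
    have [k kx] := ltr_add_invr x0; exists k => //=.
    by apply/hasP; exists x => //; apply/ltW; move: kx; rewrite add0r.
pose G t := (\sum_(x <- atoms X t) x)%R.
have mG : measurable_fun setT G.
  apply/measurable_EFinP.
  apply: (@eq_measurable_fun _ _ _ _ _ (fun t => \sum_(x <- atoms X t) x%:E)).
    by move=> t _; rewrite /= sumfin.
  have h := measurable_sum_atoms ma (f := fun p => p.2%:E).
  apply: h.
  exact: (measurableT_comp (@EFin_measurable R setT) measurable_snd).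
have IG : \int[P0]_t (G t)%:E = 0.
  rewrite -(mean_displacement hA); apply: eq_integral => t _.
  by rewrite integral_point_masses_id.
(* a.s. equal to [- G] but everywhere nonnegative, so that its zero mean makes
   it vanish *)
pose G' t := Num.max (- G t)%R 0%R.
have mG' : measurable_fun setT G'.
  by apply: measurable_maxr => //; exact: measurable_funN.
have IG' : \int[P0]_t (G' t)%:E = 0.
  apply/eqP; rewrite -oppe_eq0 -integral_ge0N; last first.
    by move=> t _; rewrite lee_fin le_max lexx orbT.
  rewrite -IG; apply/eqP; apply: ae_eq_integral => //.
  - by apply/measurable_EFinP; exact: measurable_funN.
  - exact/measurable_EFinP.
  - apply: filterS neg => t ht _; rewrite -EFinN; congr _%:E.
    rewrite /G' max_l ?opprK// oppr_ge0 /G big_seq; exact: sumr_le0.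
have G'0 : {ae P0, forall t, (G' t)%:E = 0}.
  apply: integral_ge0_eq0 IG'; first exact/measurable_EFinP.
  by move=> t; rewrite lee_fin le_max lexx orbT.
have sq0 : {ae P0, forall t, (\sum_(x <- atoms X t) x ^+ 2)%R%:E = 0 :> \bar R}.
  apply: filterS2 neg G'0 => t ht [h0]; congr _%:E.
  have S0 : (\sum_(x <- atoms X t) - x = 0)%R.
    have h1 : (- G t <= 0)%R by rewrite -[leRHS]h0 /G' le_max lexx.
    apply/eqP; rewrite sumrN eq_le h1 /= oppr_ge0 big_seq; exact: sumr_le0.
  rewrite big_seq big1// => x xt.
  suff -> : x = 0%R by rewrite expr0n.
  apply/eqP; rewrite -oppr_eq0; apply/eqP.
  move: S0; rewrite big_seq => /eqP; rewrite psumr_eq0; last first.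
    by move=> y yt; rewrite oppr_ge0 ht.
  by move=> /allP /(_ _ xt); rewrite xt /= => /eqP.
have := var_displacement hA; rewrite (_ : \int[P0]_t _ = 0).
  by move=> -[/eqP]; rewrite lt_eqF// (eta2_gt0 hA).
rewrite -(integral0 P0 setT); apply: ae_eq_integral => //.
  apply: (eq_measurable_fun (fun t => \sum_(x <- atoms X t) (x ^+ 2)%:E)).
    move=> t _; rewrite integral_point_masses//.
      by apply/measurable_EFinP; apply: measurable_funX.
    by move=> x; rewrite lee_fin sqr_ge0.
  apply: (measurable_sum_atoms ma (f := fun p => (p.2 ^+ 2)%:E)).
  apply/measurable_EFinP; apply: measurable_funX; exact: measurable_snd.
apply: filterS sq0 => t ht _; rewrite integral_point_masses/=.
- by rewrite sumEFin ht.
- by apply/measurable_EFinP; apply: measurable_funX.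
- by move=> x; rewrite lee_fin sqr_ge0.
Qed.

Section survival.
Variable F : R -> R.
Hypothesis F01 : forall r, (0 <= F r <= 1)%R.
Hypothesis F_nd : forall r r', (r <= r')%R -> (F r <= F r')%R.
Hypothesis F_rec : forall r, (F r)%:E = one_generation X F r.

Let mF : measurable_fun setT F.
Proof. by apply: nondecreasing_measurable => // *; exact: F_nd. Qed.

(** The limit [q] of [F] is a fixed point of the generating function,
    [q = E [q ^ N]]. As [E N = 1], the nonnegative variable
    [q ^ N + (1 - q) N - 1] has mean [0]; by the strict Bernoulli inequality
    it is positive when [N >= 2] and [q < 1]. *)
Lemma F_to1 (e : R) : (0 < e)%R -> exists r0, forall r, (r0 <= r)%R -> (1 - e < F r)%R.
Proof.
move=> e0; pose q := sup (range F).
have supF' : has_sup (range F).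
  split; first by exists (F 0%R), 0%R.
  by exists 1%R => _ [r _ <-]; case/andP: (F01 r).
have Fq r : (F r <= q)%R by apply: ub_le_sup; [exact: supF'.2|exists r].
have Fclose a : (0 < a)%R -> exists r0, forall r, (r0 <= r)%R -> (q - a < F r)%R.
  move=> a0; have [_ [r0 _ <-] h] := sup_adherent a0 supF'.
  by exists r0 => r r0r; apply: (lt_le_trans h); exact: F_nd.
suff -> : (1 = q)%R by exact: Fclose.
have q0 : (0 <= q)%R by apply: le_trans (Fq 0%R); case/andP: (F01 0%R).
have q1 : (q <= 1)%R.
  by apply: ge_sup; [exact: supF'.1|move=> _ [r _ <-]; case/andP: (F01 r)].
have Fcvg x : (fun n => F (n%:R - x)%R) @ \oo --> q.
  apply/cvgrPdist_lt => a a0; have [r0 hr0] := Fclose _ a0.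
  near=> n.
  have : (r0 <= n%:R - x)%R by rewrite lerBrDr; near: n; exact: nbhs_infty_ger.
  move=> /hr0 h; have hq := Fq (n%:R - x)%R.
  by rewrite ger0_norm ?subr_ge0// ltrBlDr -ltrBlDl.
(* the fixed point equation is the limit of the recursion along the integers *)
have qE : (\int[P0]_t (q ^+ size (atoms X t))%:E = q%:E).
  have mq : measurable_fun setT (fun t => q ^+ size (atoms X t))%R.
    apply: (measurable_by_size ma) => n.
    by apply: (@eq_measurable_fun _ _ _ _ _ (fun=> (q ^+ n)%R : R)) => // t; rewrite inE /= => <-.
  have h1 : (fun n => (F n%:R)%:E) @ \oo --> q%:E.
    apply: cvg_EFin; first exact: nearW.
    by have := @Fcvg 0%R; under eq_fun do rewrite subr0.
  have h2 : (fun n => (F n%:R)%:E) @ \oo --> \int[P0]_t (q ^+ size (atoms X t))%:E.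
    under eq_fun do rewrite F_rec.
    apply: (@bounded_cvg _ _ _ P0) => [n||n t|t].
    - exact: (measurable_gen_integrand X n%:R mF).
    - exact: mq.
    - exact: gen_integrand01.
    - have h : (fun n => \prod_(x <- atoms X t) F (n%:R - x))%R @ \oo -->
          (\prod_(x <- atoms X t) q)%R by apply: cvg_prod_seq => x; exact: Fcvg.
      move: h; rewrite big_const_seq count_predT iter_mulr_1 => h.
      apply: cvg_trans h; apply: near_eq_cvg; near=> n.
      rewrite /gen_integrand ifT//; near: n; exact: nbhs_infty_ger.
  by rewrite -(cvg_lim _ h1)// (cvg_lim _ h2).
apply/esym/eqP; rewrite eq_le q1 /= leNgt; apply/negP => q1'.
pose f t := (q ^+ size (atoms X t) + (1 - q) * offspring t - 1)%R.
have f0 t : (0 <= f t)%R.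
  have := @bernoulli _ q (size (atoms X t)); rewrite q0 q1 => /(_ isT).
  by rewrite /f /offspring -mulr_natr; lra.
have mq : measurable_fun setT (fun t => q ^+ size (atoms X t))%R.
  apply: (measurable_by_size ma) => n.
  by apply: (@eq_measurable_fun _ _ _ _ _ (fun=> (q ^+ n)%R : R)) => // t; rewrite inE /= => <-.
have mN : measurable_fun setT (fun t => (1 - q) * offspring t)%R.
  by apply: measurable_funM => //; exact: measurable_offspring.
have mf : measurable_fun setT f.
  by apply: measurable_funB => //; exact: measurable_funD.
have If : \int[P0]_t (f t)%:E = 0.
  have : \int[P0]_t (f t + 1)%:E = 1.
    under eq_integral do rewrite /f subrK EFinD.
    rewrite ge0_integralD//=.
    - rewrite qE; under [X in _ + X]eq_integral do rewrite EFinM.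
      rewrite ge0_integralZl//.
      + by rewrite offspring_mean mule1 -EFinD addrC subrK.
      + by apply/measurable_EFinP; exact: measurable_offspring.
      + by move=> t _; rewrite lee_fin offspring_ge0.
      + by rewrite lee_fin; lra.
    - by move=> t _; rewrite lee_fin exprn_ge0.
    - exact/measurable_EFinP.
    - by move=> t _; rewrite lee_fin mulr_ge0 ?offspring_ge0//; lra.
    - exact/measurable_EFinP.
  under eq_integral do rewrite EFinD.
  rewrite ge0_integralD//=.
  - rewrite integral_cst//= probability_setT mule1.
    by move=> /(congr1 (fun z => z - 1)); rewrite addeK// subee.
  - by move=> t _; rewrite lee_fin.
  - exact/measurable_EFinP.
have [N [mN' N0 hN]] : {ae P0, forall t, (f t)%:E = 0}.
  by apply: integral_ge0_eq0 If; [exact/measurable_EFinP|move=> t; rewrite lee_fin].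
have := branching_pos; rewrite ltNge => /negP; apply.
rewrite -N0; apply: le_measure; rewrite ?inE//; first exact: measurable_offspring_ge.
move=> t /= t2; apply: hN => /= -[].
have := @bernoulli_lt _ q (size (atoms X t)); rewrite q0 q1' => /(_ isT t2).
by rewrite /f /offspring -mulr_natr; lra.
Unshelve. all: by end_near. Qed.

(** With probability [p > 0] the root has a child at distance at least [e] to
    the right, and then the tree exceeds [r + e] as soon as the subtree of
    that child exceeds [r]; this gives the shift by [e], and iterating it any
    shift. *)
Lemma F_shift (K : R) : exists c : R, (0 < c)%R /\
  forall r, (c * (1 - F r) <= 1 - F (r + K))%R.
Proof.
have [e [e0 pe]] := upward_jump.
set H := [set t | _] in pe; have mH : measurable H by exact: measurable_up.
pose p := fine (P0 H).
have pE : P0 H = p%:E by rewrite /p fineK// fin_num_measure.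
have p0 : (0 < p)%R by rewrite -lte_fin -pE.
have step r : (p * (1 - F r) <= 1 - F (r + e))%R.
  suff : (F (r + e) + (1 - F r) * p)%:E <= 1 by rewrite lee_fin; lra.
  have /andP[_ Fr1] := F01 r.
  rewrite EFinD F_rec EFinM -pE.
  have -> : (1 - F r)%:E * P0 H = \int[P0]_t ((1 - F r)%:E * (\1_H t)%:E).
    rewrite ge0_integralZl//; last 2 first.
    - by apply/measurable_EFinP; exact: measurable_indic.
    - by rewrite lee_fin; lra.
    by rewrite integral_indic// setIT.
  rewrite -ge0_integralD//=; last 4 first.
  - by move=> t _; rewrite lee_fin; case/andP: (gen_integrand01 X (r + e) t F01).
  - by apply/measurable_EFinP; exact: measurable_gen_integrand.
  - by move=> t _; rewrite mule_ge0 ?lee_fin//; lra.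
  - apply: emeasurable_funM => //; apply/measurable_EFinP; exact: measurable_indic.
  apply: (@le_trans _ _ (\int[P0]_t 1)); last first.
    by rewrite integral_cst//= probability_setT mule1.
  apply: ge0_le_integral => //.
  - move=> t _; apply: adde_ge0.
      by rewrite lee_fin; case/andP: (gen_integrand01 X (r + e) t F01).
    by rewrite mule_ge0 ?lee_fin//; lra.
  - apply: emeasurable_funD; first by apply/measurable_EFinP; exact: measurable_gen_integrand.
    apply: emeasurable_funM => //; apply/measurable_EFinP; exact: measurable_indic.
  - move=> t _; rewrite -EFinM -EFinD lee_fin indicE.
    have [/set_mem tH|_] := boolP (t \in H); last first.
      by rewrite mulr0 addr0; case/andP: (gen_integrand01 X (r + e) t F01).
    rewrite mulr1 -lerBrDr (_ : (1 - (1 - F r) = F r)%R); last by ring.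
    rewrite -/(gen_integrand X F (r + e) t) /gen_integrand.
    case: ifP => _; last by case/andP: (F01 r).
    move: tH => /= /hasP[x xt ex].
    rewrite (big_rem _ xt) /=; apply: (@le_trans _ _ (F (r + e - x))%R).
      rewrite ler_piMr//; first by case/andP: (F01 (r + e - x)%R).
      by apply: prodr_ile1 => y _; exact: F01.
    apply: F_nd; lra.
(* the number of steps of length [e] needed to cover [K] *)
exists (p ^+ (Num.truncn (K / e)).+1)%R; split; first exact: exprn_gt0.
move=> r; have [_ Ke] : (0 <= K / e \/ True)%R /\ (K <= (Num.truncn (K / e)).+1%:R * e)%R.
  split; first by right.
  by rewrite -ler_pdivrMr// ltW// truncnS_gt.
apply: (@le_trans _ _ (1 - F (r + (Num.truncn (K / e)).+1%:R * e))%R); last first.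
  by rewrite lerB// F_nd// lerD2l.
elim: (Num.truncn (K / e)).+1 => [|n IH]; first by rewrite mul0r addr0 expr0 mul1r.
rewrite exprS -mulrA; apply: (@le_trans _ _ (p * (1 - F (r + n%:R * e)))%R).
  by rewrite ler_pM2l.
by rewrite -[in X in (_ <= X)%R]addn1 natrD mulrDl mul1r addrA.
Qed.

(** The level [-1] is always exceeded since Lambda is nonnegative, and the
    shift estimate propagates this to every level. *)
Lemma F_lt1 r : (forall t, (0 <= Lam X t)%R) -> (F r < 1)%R.
Proof.
move=> L0; have F1 : F (-1)%R = 0%R.
  have := F_rec (-1)%R; rewrite /one_generation integral0_eq; first by case.
  by move=> t _; rewrite ifF//; apply/negbTE; rewrite -ltNge; have := L0 t; lra.
have [k [k0 /(_ (-1)%R)]] := F_shift (r + 1)%R.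
rewrite F1 (_ : -1 + (r + 1) = r)%R; last by ring.
by move: k0; lra.
Qed.

End survival.
End critical_offspring.

(** * The odds function, error moduli, tails of the offspring number *)

Section monotone_measurable.
Context (R : realType).

Lemma nondecreasing_emeasurable (f : R -> \bar R) :
  (forall x y, (x <= y)%R -> f x <= f y) -> measurable_fun setT f.
Proof.
move=> fnd mD; apply: (measurability _ (ErealGenCInfty.measurableE R)) => //.
move=> _ [_ [x ->] <-]; rewrite setTI; apply: is_interval_measurable => s t/=.
rewrite !in_itv/= !andbT => fs ft u /andP[su ut].
by rewrite in_itv/= andbT (le_trans fs)// fnd.
Qed.

Lemma nonincreasing_emeasurable (f : R -> \bar R) :
  (forall x y, (x <= y)%R -> f y <= f x) -> measurable_fun setT f.
Proof.
move=> fni; rewrite (_ : f = \- (fun x => - f x)); last first.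
  by apply/funext => x; rewrite oppeK.
apply: measurableT_comp => //.
by apply: nondecreasing_emeasurable => x y xy; rewrite leeN2 fni.
Qed.

End monotone_measurable.

Section odds.
Context (R : realType) (F : R -> R) (w : R -> \bar R).
Hypothesis F01 : forall r, (0 <= F r <= 1)%R.
Hypothesis F_nd : forall r r', (r <= r')%R -> (F r <= F r')%R.
Hypothesis wE : forall r, w r = (F r)%:E^-1 - 1.

Lemma w_ge0 r : 0 <= w r.
Proof.
have /andP[F0 F1] := F01 r.
by rewrite wE leeBrDr// add0e inve_ge1// lee_fin.
Qed.

Lemma w_ni r r' : (r <= r')%R -> w r' <= w r.
Proof.
move=> rr'; have [/andP[Fr _] /andP[Fr' _]] := (F01 r, F01 r').
by rewrite !wE leeB// lee_pV2 ?inE ?lee_fin// F_nd.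
Qed.

Lemma measurable_w : measurable_fun setT w.
Proof. by apply: nonincreasing_emeasurable => *; exact: w_ni. Qed.

Lemma w_fin r : (0 < F r)%R -> w r = ((F r)^-1 - 1)%:E.
Proof. by move=> F0; rewrite wE inver gt_eqF. Qed.

Lemma w_lty r : w r < +oo -> (0 < F r)%R.
Proof.
move=> h; have /andP[F0 F1] := F01 r; rewrite lt_neqAle F0 andbT eq_sym.
by apply/eqP => F0'; move: h; rewrite wE F0' inve0.
Qed.

Lemma wfE r : w r < +oo -> w r = (fine (w r))%:E.
Proof. by move=> h; rewrite fineK// ge0_fin_numE// w_ge0. Qed.

Lemma wf_ge0 r : (0 <= fine (w r))%R.
Proof. by rewrite fine_ge0 ?w_ge0. Qed.

Lemma F_wf r : w r < +oo -> F r = (1 + fine (w r))^-1%R.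
Proof.
move=> h; have F0 := w_lty h.
by rewrite w_fin//= addrC subrK invrK.
Qed.

Lemma w_lty_ni r r' : (r <= r')%R -> w r < +oo -> w r' < +oo.
Proof. by move=> rr'; apply: le_lt_trans; exact: w_ni. Qed.

Lemma wf_ni r r' : (r <= r')%R -> w r < +oo -> (fine (w r') <= fine (w r))%R.
Proof.
move=> rr' h; rewrite -lee_fin -!wfE//; first exact: w_ni.
exact: w_lty_ni h.
Qed.

Lemma wf_u r : w r < +oo -> (fine (w r) = (1 - F r) * (1 + fine (w r)))%R.
Proof.
move=> h; rewrite F_wf//; have := wf_ge0 r; move: (fine (w r)) => x x0 {h}.
by field; lra.
Qed.

End odds.

(** Take the supremum of [err] over the points where [w] is at most the given
    value; it tends to [0] because [w] is positive, so that small values of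
    [w] are only reached far away. Adding the identity makes it strictly
    increasing. *)
Lemma dominating_modulus (R : realType) (w : R -> \bar R) (err : R -> R) (B : R) :
  (forall r r', (r <= r')%R -> w r' <= w r) ->
  (forall r, 0 < w r) ->
  (forall y, (0 < y)%R -> w y <= 1 -> (0 <= err y <= B)%R) ->
  (forall e, (0 < e)%R -> exists Y, forall y, (Y <= y)%R -> (err y <= e)%R) ->
  exists g : R -> R,
    [/\ forall u, (0 < u <= 1)%R -> (0 <= g u)%R,
        forall u u', (0 < u)%R -> (u < u')%R -> (u' <= 1)%R -> (g u < g u')%R,
        g z @[z --> (0 : R)%R^'+] --> (0 : R)%R &
        forall y, (0 < y)%R -> w y <= 1 -> (err y <= g (fine (w y)))%R].
Proof.
move=> w_ni w0 errB err0.
(* the value [0] keeps the set nonempty when no point qualifies *)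
pose A u := [set v : R | v = 0%R \/ exists y, [/\ (0 < y)%R, w y <= 1,
   w y <= u%:E & v = err y]].
have A0 u : A u 0%R by left.
have B0 v u : A u v -> (v <= Num.max B 0)%R.
  move=> [->|[y [y0 wy _ ->]]]; rewrite le_max ?lexx ?orbT//.
  by case/andP: (errB y y0 wy) => _ ->.
have Asup u : has_sup (A u).
  by split; [exists 0%R|exists (Num.max B 0%R) => v; exact: B0].
have ge u v : A u v -> (v <= sup (A u))%R.
  by move=> Av; apply: ub_le_sup => //; exact: (Asup u).2.
exists (fun u => u + sup (A u))%R; split.
- by move=> u /andP[u0 _]; rewrite addr_ge0 ?ge// ltW.
- move=> u u' u0 uu' u1; rewrite ltr_leD//; apply: ge_sup; first exact: (Asup u).1.
  move=> v [->|[y [y0 wy wu ->]]]; first exact: ge.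
  apply: ge; right; exists y; split => //; apply: (le_trans wu).
  by rewrite lee_fin ltW.
- apply/cvgrPdist_lt => e e0.
  have e20 : (0 < e / 2)%R by rewrite divr_gt0.
  have [Y hY] := err0 _ e20.
  have [t [t0 tY]] : exists t : R, (0 < t)%R /\ t%:E <= w Y.
    have := w0 Y; case: (w Y) => [z|_|//]; last by exists 1%R; rewrite leey.
    by rewrite lte_fin => z0; exists z.
  near=> u.
  have u0 : (0 < u)%R by near: u; exact: nbhs_right_gt.
  have ut : (u < t)%R by near: u; exact: nbhs_right_lt.
  have ue : (u < e / 2)%R by near: u; exact: nbhs_right_lt.
  have se : (sup (A u) <= e / 2)%R.
    apply: ge_sup; first exact: (Asup u).1.
    move=> v [->|[y [y0 wy wu ->]]]; first exact: ltW.
    apply: hY; rewrite leNgt; apply/negP => yY.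
    have : t%:E <= u%:E by rewrite (le_trans tY)// (le_trans (w_ni _ _ (ltW yY))).
    by rewrite lee_fin leNgt ut.
  have s0 := ge u 0%R (A0 u).
  by rewrite sub0r normrN ger0_norm; lra.
- move=> y y0 wy.
  have wyE : w y = (fine (w y))%:E.
    by rewrite fineK// ge0_fin_numE ?(ltW (w0 y))// (le_lt_trans wy)// ltry.
  have h : (err y <= sup (A (fine (w y))))%R.
    by apply: ge; right; exists y; split => //; rewrite -wyE.
  by rewrite -[leLHS]add0r lerD// fine_ge0// ltW.
Unshelve. all: by end_near. Qed.

Section tails.
Context d0 (T0 : measurableType d0) (R : realType) (P0 : probability T0 R)
  (X : {RV P0 >-> mark R}) (sigma eta : R).
Hypothesis hA : assumptions X sigma eta.

Let N := offspring X.

(** The part of the second moment of the offspring number [N] that comes from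
    [N > k / s]; it vanishes as [s -> 0], at a rate that depends on the law. *)
Definition sq_tail (k s : R) : \bar R :=
  \int[P0]_t (if k < N t * s then N t ^+ 2 else 0)%R%:E.

Let mN : measurable_fun setT N. Proof. exact: measurable_offspring. Qed.

Let msq k s : measurable_fun setT (fun t => if k < N t * s then N t ^+ 2 else 0)%R.
Proof.
apply: measurable_fun_ifT => //; last exact: measurable_funX.
by apply: measurable_fun_ltr => //; exact: measurable_funM.
Qed.

Lemma sq_tail_fin k s : sq_tail k s \is a fin_num.
Proof.
rewrite ge0_fin_numE; last first.
  by apply: integral_ge0 => t _; rewrite lee_fin; case: ifP; rewrite ?sqr_ge0.
apply: (@le_lt_trans _ _ (\int[P0]_t (N t ^+ 2)%:E)).
  apply: ge0_le_integral => //.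
  - by move=> t _; rewrite lee_fin; case: ifP; rewrite ?sqr_ge0.
  - exact/measurable_EFinP.
  - by apply/measurable_EFinP; exact: measurable_funX.
  - by move=> t _; rewrite lee_fin; case: ifP => //; rewrite ?sqr_ge0.
by rewrite (offspring_sq hA) ltry.
Qed.

Lemma sq_tail_le k s s' : (s <= s')%R -> sq_tail k s <= sq_tail k s'.
Proof.
move=> ss'; apply: ge0_le_integral => //.
- by move=> t _; rewrite lee_fin; case: ifP; rewrite ?sqr_ge0.
- exact/measurable_EFinP.
- exact/measurable_EFinP.
- move=> t _; rewrite lee_fin; case: ifP => h1; case: ifP => h2 //.
    have := lt_le_trans h1 (ler_wpM2l (offspring_ge0 X t) ss').
    by rewrite -/N h2.
  exact: sqr_ge0.
Qed.

Lemma sq_tail0 k : (0 < k)%R -> forall e, (0 < e)%R ->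
  exists s0, (0 < s0)%R /\ sq_tail k s0 <= e%:E.
Proof.
move=> k0 e e0.
have h : (fun n => sq_tail k n.+1%:R^-1%R) @ \oo --> 0.
  have [|||||_ _] := @dominated_convergence _ _ _ P0 setT measurableT
    (fun n t => (if k < N t * n.+1%:R^-1 then N t ^+ 2 else 0)%R%:E)
    (cst 0) (fun t => (N t ^+ 2)%:E); last by rewrite integral0.
  - by move=> n; exact/measurable_EFinP.
  - exact: measurable_cst.
  - apply: aeW => t _; apply: (@cvg_trans _ ((cst (0 : \bar R)) @ \oo)); last exact: cvg_cst.
    apply: near_eq_cvg; near=> n; rewrite ifF//; apply/negbTE; rewrite -leNgt.
    rewrite ler_pdivrMr// -ler_pdivrMl//.
    have : (k^-1 * N t <= n%:R)%R by near: n; exact: nbhs_infty_ger.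
    by move=> /le_trans; apply; rewrite ler_nat.
  - apply/integrableP; split; first by apply/measurable_EFinP; exact: measurable_funX.
    under eq_integral do rewrite gee0_abs ?lee_fin ?sqr_ge0//.
    by rewrite (offspring_sq hA) ltry.
  - apply: aeW => t n _; rewrite lee_fin ger0_norm; case: ifP => //; rewrite ?sqr_ge0//.
have h' : (fun n => fine (sq_tail k n.+1%:R^-1)) @ \oo --> (0 : R)%R.
  exact: (fine_cvg h).
have [n _ /(_ n (leqnn n)) hn] := proj1 (cvgrPdist_lt _ _) h' e e0.
exists n.+1%:R^-1%R; split; first by rewrite invr_gt0.
move: hn; rewrite /= sub0r normrN => hn.
rewrite -[leLHS]fineK ?sq_tail_fin// lee_fin.
by rewrite (le_trans (ler_norm _))// ltW.
Unshelve. all: by end_near. Qed.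

(** The Chebyshev inequality, keeping only the part of the second moment
    where the event holds. *)
Lemma offspring_tail (d om : R) : (0 < d)%R -> (0 <= om)%R ->
  P0 [set t | (d < N t * om)%R] * (d ^+ 2)%:E <= (om ^+ 2)%:E * sq_tail d om.
Proof.
move=> d0' om0; have mE : measurable [set t | (d < N t * om)%R].
  rewrite -[X in measurable X]setTI; apply: (@measurable_fun_ltr _ _ _ _ (cst d) (fun t => N t * om)%R) => //.
  exact: measurable_funM.
have -> : P0 [set t | (d < N t * om)%R] =
    \int[P0]_t (\1_[set t | (d < N t * om)%R] t)%:E by rewrite integral_indic// setIT.
rewrite muleC -ge0_integralZl//; last 2 first.
- by apply/measurable_EFinP; exact: measurable_indic.
- by rewrite lee_fin sqr_ge0.
rewrite -ge0_integralZl//; last 3 first.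
- exact/measurable_EFinP.
- by move=> t _; rewrite lee_fin; case: ifP; rewrite ?sqr_ge0.
- by rewrite lee_fin sqr_ge0.
apply: ge0_le_integral => //.
- by move=> t _; rewrite -EFinM lee_fin mulr_ge0 ?sqr_ge0.
- by apply: emeasurable_funM => //; apply/measurable_EFinP; exact: measurable_indic.
- by apply: emeasurable_funM => //; exact/measurable_EFinP.
- move=> t _; rewrite -!EFinM lee_fin indicE.
  have [/set_mem /= h|h] := boolP (t \in _); last first.
    by rewrite mulr0 mulr_ge0 ?sqr_ge0//; case: ifP; rewrite ?sqr_ge0.
  rewrite h mulr1 mulrC -exprMn.
  by apply: lerXn2r; rewrite ?nnegrE; [exact: ltW|exact: le_trans (ltW d0') (ltW h)|exact: ltW].
Qed.

End tails.

(** * The cut-off of the offspring number *)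

Section parameters.
Context d0 (T0 : measurableType d0) (R : realType) (P0 : probability T0 R)
  (X : {RV P0 >-> mark R}) (sigma eta : R).
Hypothesis hA : assumptions X sigma eta.
Context (w : R -> \bar R).
Hypothesis w_ge0 : forall r, 0 <= w r.
Hypothesis w_ni : forall r r', (r <= r')%R -> w r' <= w r.
Hypothesis w_to0 : forall e : R, (0 < e)%R ->
  exists r0, forall r, (r0 <= r)%R -> w r <= e%:E.

Let N := offspring X.
Let k := (sigma ^+ 2 + 1)%R.
Let c : R := 16^-1%R.

Let k0 : (0 < k)%R. Proof. by rewrite /k; have := sigma2_gt0 hA; lra. Qed.
Let c0 : (0 < c)%R. Proof. by rewrite /c invr_gt0. Qed.

Let h y : R := fine (mine (w y) 1).

Let hE y : mine (w y) 1 = (h y)%:E.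
Proof.
rewrite /h fineK// ge0_fin_numE ?le_min ?w_ge0 ?lee01//.
by rewrite (@le_lt_trans _ _ 1)// ?ge_min ?lexx ?orbT// ltry.
Qed.

Let h01 y : (0 <= h y <= 1)%R.
Proof. by rewrite -!lee_fin -hE le_min w_ge0 lee01 ge_min lexx orbT. Qed.

Let h_ni y y' : (y <= y')%R -> (h y' <= h y)%R.
Proof.
move=> yy'; rewrite -lee_fin -!hE le_min !ge_min lexx orbT andbT.
by rewrite w_ni.
Qed.

Let hw y : w y <= 1 -> h y = fine (w y).
Proof. by move=> wy; rewrite /h min_l. Qed.

Let L y : R := (fine (sq_tail X c (Num.sqrt (h y))) / k)%R.

Let L01 y : (0 <= L y <= 1)%R.
Proof.
rewrite /L divr_ge0 ?(ltW k0)//=; last first.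
  apply: fine_ge0; apply: integral_ge0 => t _; rewrite lee_fin.
  by case: ifP; rewrite ?sqr_ge0.
rewrite ler_pdivrMr// mul1r -lee_fin fineK ?(sq_tail_fin hA)//.
rewrite /k -(offspring_sq hA); apply: ge0_le_integral => //.
- by move=> t _; rewrite lee_fin; case: ifP; rewrite ?sqr_ge0.
- apply/measurable_EFinP; apply: measurable_fun_ifT => //.
    apply: measurable_fun_ltr => //; apply: measurable_funM => //.
    exact: measurable_offspring.
  by apply: measurable_funX; exact: measurable_offspring.
- by apply/measurable_EFinP; apply: measurable_funX; exact: measurable_offspring.
- by move=> t _; rewrite lee_fin; case: ifP => _; rewrite ?sqr_ge0.
Qed.

Let L_ni y y' : (y <= y')%R -> (L y' <= L y)%R.
Proof.
move=> yy'; rewrite /L; apply: ler_wpM2r; first by rewrite invr_ge0 ltW.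
apply: fine_le; [exact: (sq_tail_fin hA)|exact: (sq_tail_fin hA)|].
by apply: sq_tail_le; rewrite ler_sqrt ?h_ni//; case/andP: (h01 y).
Qed.

Let h_to0 (e : R) : (0 < e)%R -> exists Y, forall y, (Y <= y)%R -> (h y <= e)%R.
Proof.
move=> e0; have [r0 hr0] := w_to0 e0; exists r0 => y /hr0 wy.
by rewrite -lee_fin -hE ge_min wy.
Qed.

Let sqrt_le (e x : R) : (0 < e)%R -> (x <= e ^+ 2 -> Num.sqrt x <= e)%R.
Proof.
move=> e0 xe; have -> : e = Num.sqrt (e ^+ 2) by rewrite sqrtr_sqr ger0_norm// ltW.
exact: ler_wsqrtr.
Qed.

Let L_to0 (e : R) : (0 < e)%R -> exists Y, forall y, (Y <= y)%R -> (L y <= e)%R.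
Proof.
move=> e0; have ek : (0 < e * k)%R by exact: mulr_gt0.
have [s0 [s00 hs0]] := sq_tail0 hA c0 ek.
have [Y hY] := h_to0 (exprn_gt0 2 s00); exists Y => y /hY hy.
rewrite /L ler_pdivrMr// -lee_fin fineK ?(sq_tail_fin hA)//.
by apply: le_trans hs0; apply: sq_tail_le; exact: sqrt_le.
Qed.

Let S y : R := Num.sqrt (Num.sqrt (L y)).

Let sqrt01 (x : R) : (0 <= x <= 1 -> 0 <= Num.sqrt x <= 1)%R.
Proof. by move=> /andP[x0 x1]; rewrite sqrtr_ge0 sqrt_le// expr1n. Qed.

Let S01 y : (0 <= S y <= 1)%R. Proof. by do 2 apply: sqrt01; exact: L01. Qed.

Let S_to0 (e : R) : (0 < e)%R -> exists Y, forall y, (Y <= y)%R -> (S y <= e)%R.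
Proof.
move=> e0; have [Y hY] := L_to0 (exprn_gt0 2 (exprn_gt0 2 e0)).
by exists Y => y /hY hy; do 2 (apply: sqrt_le; first by rewrite ?exprn_gt0).
Qed.

Let ud y : R := (c * (Num.sqrt (h y) + S y + (1 + y)^-1))%R.

Let inv1 (y : R) : (0 <= y -> 0 < (1 + y)^-1 <= 1)%R.
Proof.
move=> y0; rewrite invr_gt0 invf_le1; last by lra.
by apply/andP; split; lra.
Qed.

Let ud_to0 (e : R) : (0 < e)%R -> exists Y, (0 <= Y)%R /\
  forall y, (Y <= y)%R -> (ud y <= e)%R.
Proof.
move=> e0; have [Y1 h1] := h_to0 (exprn_gt0 2 e0); have [Y2 h2] := S_to0 e0.
exists (Num.max (Num.max Y1 Y2) (Num.max 0 e^-1))%R; split.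
  by rewrite !le_max lexx orbT.
move=> y; rewrite !ge_max => /andP[/andP[y1 y2] /andP[y0 ye]].
have a1 : (Num.sqrt (h y) <= e)%R by apply: sqrt_le => //; exact: h1.
have a2 := h2 _ y2.
have a3 : ((1 + y)^-1 <= e)%R.
  by rewrite -[leRHS]invrK lef_pV2 ?posrE ?invr_gt0//; lra.
rewrite /ud /c -ler_pdivlMl ?invr_gt0//; rewrite invrK; lra.
Qed.

(** The cut-off is [(sqrt w + sqrt (sqrt L) + 1 / (1 + y)) / 16], with [w]
    capped at [1], where [L <= 1] is the relative weight of the tail of
    [E [N ^ 2]] beyond a constant over [sqrt w]. The first term guarantees
    that [udelta y] is at least of order [sqrt w], so that the tail beyond
    [udelta y / w] is within that of [L]; by the restricted Chebyshev
    inequality the probability of exceeding [udelta y / w] is at most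
    [k w ^ 2 L / udelta y ^ 2], where [k] is the second moment of [N], and
    the second term makes this [O (w ^ 2 sqrt L)]; the last term makes the
    cut-off strictly decreasing and positive. *)
Lemma step_parameters : exists udelta err : R -> R,
  [/\ forall y, (0 <= y)%R -> (0 < udelta y < 4^-1)%R,
      forall y y', (0 <= y)%R -> (y < y')%R -> (udelta y' < udelta y)%R &
      udelta z @[z --> +oo%R] --> (0 : R)%R] /\
  [/\ exists B, forall y, (0 < y)%R -> w y <= 1 -> (0 <= err y <= B)%R,
      forall e, (0 < e)%R -> exists Y, forall y, (Y <= y)%R -> (err y <= e)%R &
      forall y om, (0 < y)%R -> w y <= 1 -> (0 <= om <= fine (w y))%R ->
        (16^-1 * Num.sqrt (fine (w y)) <= udelta y)%R /\
        exists e1, [/\ (0 <= e1)%R,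
          P0 [set t | (udelta y < N t * om)%R] <= (fine (w y) ^+ 2 * e1)%:E &
          (2 * e1 + (5 + 2 * k) * fine (w y) + 2 * k * udelta y <= err y)%R]].
Proof.
have hk : (0 < k)%R by exact: k0.
have ud_bounds y : (0 <= y)%R -> (0 < ud y < 4^-1)%R.
  move=> y0; have /andP[a1 a2] := inv1 y0; have /andP[b1 b2] := S01 y.
  have /andP[e1 e2] := sqrt01 (h01 y).
  by rewrite /ud /c; apply/andP; split; lra.
pose C := (k / c ^+ 2)%R; have C0 : (0 < C)%R by rewrite divr_gt0 ?exprn_gt0.
pose err y := (2 * (C * Num.sqrt (L y)) + (5 + 2 * k) * h y + 2 * k * ud y)%R.
exists ud, err; split; split.
- exact: ud_bounds.
- move=> y y' y0 yy'; rewrite /ud ltr_pM2l//; apply: ler_ltD.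
    apply: lerD; first by apply: ler_wsqrtr; apply: h_ni; exact: ltW.
    by do 2 apply: ler_wsqrtr; apply: L_ni; exact: ltW.
  by rewrite ltf_pV2 ?posrE; lra.
- apply/cvgrPdist_le => e e0; have [Y [Y0 hY]] := ud_to0 e0.
  near=> y; have Yy : (Y <= y)%R by near: y; apply: nbhs_pinfty_ge; exact: num_real.
  rewrite sub0r normrN ger0_norm; first exact: hY.
  by have /andP[/ltW] := ud_bounds y (le_trans Y0 Yy).
- exists (2 * C + (5 + 2 * k) + 2 * k)%R => y y0 _.
  have /andP[u1 u2] := ud_bounds y (ltW y0).
  have /andP[a1 a2] := sqrt01 (L01 y); have /andP[h1 h2] := h01 y.
  have x1 : (0 <= C * Num.sqrt (L y) <= C)%R.
    by rewrite mulr_ge0 ?(ltW C0)//= ler_piMr// ltW.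
  have x2 : (0 <= (5 + 2 * k) * h y <= 5 + 2 * k)%R.
    have k5 : (0 <= 5 + 2 * k)%R by lra.
    by rewrite mulr_ge0//= ler_piMr.
  have x3 : (0 <= 2 * k * ud y <= 2 * k)%R.
    have k5 : (0 <= 2 * k)%R by lra.
    by rewrite mulr_ge0 ?(ltW u1)//= ler_piMr//; lra.
  by rewrite /err; lra.
- move=> e e0; pose M := (2 * C + (5 + 2 * k) + 2 * k)%R.
  have M0 : (0 < M)%R by rewrite /M; lra.
  have eM : (0 < e / M)%R by exact: divr_gt0.
  have [Y1 h1] := h_to0 eM; have [Y2 [_ h2]] := ud_to0 eM.
  have [Y3 h3] := L_to0 (exprn_gt0 2 eM).
  exists (Num.max (Num.max Y1 Y2) Y3)%R => y.
  rewrite !ge_max => /andP[/andP[/h1 a1 /h2 a2] /h3/(sqrt_le eM) a3].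
  have eE : (e = (2 * C) * (e / M) + (5 + 2 * k) * (e / M) + (2 * k) * (e / M))%R.
    by rewrite -!mulrDl -/M mulrC divfK// gt_eqF.
  rewrite [leRHS]eE /err mulrA; apply: lerD; first apply: lerD.
  + by rewrite ler_pM2l//; lra.
  + by rewrite ler_pM2l//; lra.
  + by rewrite ler_pM2l//; lra.
- move=> y om y0 wy /andP[om0 omy].
  have hy := hw wy; rewrite -hy in omy *.
  have /andP[u1 u2] := ud_bounds y (ltW y0).
  have /andP[i1 _] := inv1 (ltW y0); have /andP[S0 _] := S01 y.
  have sh : (c * Num.sqrt (h y) <= ud y)%R.
    by rewrite /ud ler_pM2l//; lra.
  have cS : (c * S y <= ud y)%R.
    by rewrite /ud ler_pM2l//; have := sqrtr_ge0 (h y); lra.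
  split => //; exists (C * Num.sqrt (L y))%R.
  have e10 : (0 <= C * Num.sqrt (L y))%R by rewrite mulr_ge0 ?sqrtr_ge0// ltW.
  split => //.
  have /andP[hy0 _] := h01 y.
  have mset (x : R) : measurable [set t | (ud y < N t * x)%R].
    rewrite -[X in measurable X]setTI.
    apply: (@measurable_fun_ltr _ _ _ _ (cst (ud y)) (fun t => N t * x)%R) => //.
    by apply: measurable_funM => //; exact: measurable_offspring.
  apply: (@le_trans _ _ (P0 [set t | (ud y < N t * h y)%R])).
    apply: le_measure; rewrite ?inE// => t /= /lt_le_trans; apply.
    by apply: ler_wpM2l => //; exact: offspring_ge0.
  have P0E : P0 [set t | (ud y < N t * h y)%R] =
      (fine (P0 [set t | (ud y < N t * h y)%R]))%:E by rewrite fineK// fin_num_measure.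
  have := offspring_tail X u1 hy0; rewrite P0E.
  have : sq_tail X (ud y) (h y) <= (k * L y)%:E.
    rewrite /L mulrC divfK ?gt_eqF// fineK ?(sq_tail_fin hA)//.
    apply: ge0_le_integral => //.
    + by move=> t _; rewrite lee_fin; case: ifP; rewrite ?sqr_ge0.
    + apply/measurable_EFinP; apply: measurable_fun_ifT => //.
        apply: measurable_fun_ltr => //; apply: measurable_funM => //.
        exact: measurable_offspring.
      by apply: measurable_funX; exact: measurable_offspring.
    + apply/measurable_EFinP; apply: measurable_fun_ifT => //.
        apply: measurable_fun_ltr => //; apply: measurable_funM => //.
        exact: measurable_offspring.
      by apply: measurable_funX; exact: measurable_offspring.
    + move=> t _; rewrite lee_fin; case: ifP => a1; case: ifP => a2 //; last first.
        exact: sqr_ge0.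
      move/negbT: a2; rewrite -leNgt => a2.
      have : (N t * h y <= c * Num.sqrt (h y))%R.
        rewrite -{1}(sqr_sqrtr hy0) expr2 mulrA.
        by apply: ler_wpM2r => //; exact: sqrtr_ge0.
      by move=> /le_trans /(_ sh); rewrite leNgt a1.
  set p := fine _ => hS hT; have := le_trans hT (lee_wpmul2l _ hS).
  rewrite -!EFinM !lee_fin sqr_ge0 => /(_ isT) hp.
  have L0 := proj1 (andP (L01 y)).
  have cS2 : (c ^+ 2 * Num.sqrt (L y) <= ud y ^+ 2)%R.
    rewrite -[X in (_ * X)%R](sqr_sqrtr (sqrtr_ge0 (L y))) -exprMn.
    by apply: lerXn2r; rewrite ?nnegrE ?(ltW u1)// mulr_ge0 ?(ltW c0).
  (* [sqrt L] is divided by in the general case *)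
  have [L0'|Lpos] := eqVneq (L y) 0%R.
    rewrite L0' !mulr0 in hp; rewrite L0' sqrtr0 !mulr0.
    by rewrite -(@ler_pM2r _ (ud y ^+ 2)) ?mul0r ?exprn_gt0.
  have sL : (0 < Num.sqrt (L y))%R by rewrite sqrtr_gt0 lt_neqAle eq_sym Lpos.
  rewrite -(@ler_pM2r _ (c ^+ 2 * Num.sqrt (L y))%R) ?mulr_gt0 ?exprn_gt0//.
  have p0 : (0 <= p)%R by exact: fine_ge0.
  apply: (@le_trans _ _ (p * ud y ^+ 2)%R); first exact: ler_wpM2l.
  apply: (le_trans hp); rewrite le_eqVlt; apply/orP; left; apply/eqP.
  rewrite -{1}(sqr_sqrtr L0) /C; field; exact: lt0r_neq0.
Unshelve. all: by end_near. Qed.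

End parameters.

(** * Expectations and counting measures *)

Section expectation.
Context d (T : measurableType d) (R : realType) (P : probability T R).

Definition Intg (f : T -> R) := P.-integrable setT (fun t => (f t)%:E).
Definition Ex (f : T -> R) : R := fine (\int[P]_t (f t)%:E).

Lemma ExE f : Intg f -> \int[P]_t (f t)%:E = (Ex f)%:E.
Proof. by move=> intf; rewrite /Ex fineK//; exact: integrable_fin_num. Qed.

Lemma Intg_bounded (f : T -> R) (C : R) : measurable_fun setT f ->
  (forall t, (`|f t| <= C)%R) -> Intg f.
Proof.
move=> mf fC; apply: (@le_integrable _ _ _ P setT measurableT _ (cst C%:E)).
- exact/measurable_EFinP.
- move=> t _; rewrite /= lee_fin (le_trans (fC t))// ler_norm//.
- exact: finite_measure_integrable_cst.
Qed.

Lemma Ex_ge0 f : (forall t, (0 <= f t)%R) -> (0 <= Ex f)%R.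
Proof. by move=> f0; rewrite fine_ge0// integral_ge0// => t _; rewrite lee_fin. Qed.

Lemma Ex_cst c : Ex (fun=> c) = c.
Proof. by rewrite /Ex integral_cst//= probability_setT mule1. Qed.

Lemma Ex_lin (l : seq (R * (T -> R))) :
  (forall p, p \in [seq p.2 | p <- l] -> Intg p) ->
  Intg (fun t => \sum_(p <- l) p.1 * p.2 t)%R /\
  Ex (fun t => \sum_(p <- l) p.1 * p.2 t)%R = (\sum_(p <- l) p.1 * Ex p.2)%R.
Proof.
elim: l => [_|[a f] l IH intl].
  rewrite big_nil; under eq_fun do rewrite big_nil.
  split; last exact: Ex_cst.
  exact: integrable0.
have [|il El] := IH; first by move=> p pl; apply: intl; rewrite inE pl orbT.
have intf : Intg f by apply: intl; rewrite inE eqxx.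
have intaf : Intg (fun t => a * f t)%R.
  by rewrite /Intg; under eq_fun do rewrite EFinM; exact: integrableZl.
rewrite big_cons /=; under eq_fun do rewrite big_cons /=.
split.
  by rewrite /Intg; under eq_fun do rewrite EFinD; exact: integrableD.
rewrite {1}/Ex; under eq_integral do rewrite EFinD.
rewrite integralD// (ExE il) El.
under eq_integral do rewrite EFinM.
by rewrite integralZl// (ExE intf).
Qed.

(** A pointwise linear inequality between integrable functions passes to
    their means. Writing the combination as a list lets every estimate below
    be obtained by a single pointwise verification. *)
Lemma Ex_comb (l : seq (R * (T -> R))) :
  (forall p, p \in [seq p.2 | p <- l] -> Intg p) ->
  (forall t, (0 <= \sum_(p <- l) p.1 * p.2 t)%R) ->
  (0 <= \sum_(p <- l) p.1 * Ex p.2)%R.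
Proof. by move=> /Ex_lin[_ <-] h; exact: Ex_ge0. Qed.

End expectation.

Section counting_maps.
Context (R : realType).

Lemma measurable_counting d (Y : measurableType d) (f : Y -> counting_measures R) :
  (forall A, measurable A -> measurable_fun setT (fun y => cmeas (f y) A)) ->
  measurable_fun setT f.
Proof.
move=> mf; apply: (@measurability _ _ Y (counting_measures R) setT f (@evaluation_sets R)) => //.
move=> _ [_ [A [U [mA mU ->]]] <-].
by have := mf A mA measurableT U mU.
Qed.

Context d0 (T0 : measurableType d0) (X : T0 -> mark R).
Hypothesis mX : measurable_fun setT X.
Let ma := measurable_atoms mX.

Lemma measurable_chi_minus i : measurable_fun setT (chi_minus X i).
Proof.
apply: measurable_counting => A mA.
have dE (s : seq R) :
    (point_masses s : fin_counting R) A = \sum_(x <- s) (\1_A x)%:E.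
  rewrite /= /msum (big_nth 0%R) big_mkord; apply: eq_bigr => j _.
  by rewrite indicE; exact: diracE.
have mI : measurable_fun setT (fun x : R => (\1_A x)%:E : \bar R).
  by apply/measurable_EFinP; exact: measurable_indic.
have mchi : measurable_fun setT (fun t => \sum_(x <- atoms X t) (\1_A x)%:E : \bar R).
  apply: (measurable_sum_atoms ma (f := fun p => (\1_A p.2)%:E)).
  exact: (measurableT_comp mI measurable_snd).
apply: (@eq_measurable_fun _ _ _ _ _ (fun t => if (i < size (atoms X t))%N then
    \sum_(x <- atoms X t) (\1_A x)%:E - (\1_A (nth 0%R (atoms X t) i))%:E
    else \sum_(x <- atoms X t) (\1_A x)%:E)).
  move=> t _; case: ifPn => it.
    have := chi_minusE A it; rewrite {1}/chi dE => ->.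
    rewrite indicE [X in X + _ - _](_ : _ = (nth 0%R (atoms X t) i \in A)%:R%:E).
      by rewrite addeAC subee// add0e.
    exact: diracE.
  rewrite -leqNgt in it.
  by rewrite /chi_minus dE take_oversize// drop_oversize ?cats0// (leq_trans it).
apply: measurable_fun_ifT => //.
  apply: (@measurable_fun_bool _ _ _ _ true); rewrite setTI.
  exact: (measurable_size_set ma [set k | (i < k)%N]).
apply: emeasurable_funB => //.
exact: (measurableT_comp mI (measurable_atom ma i)).
Qed.

Lemma measurable_integral_counting (f : R -> \bar R) :
  measurable_fun setT f -> (forall x, 0 <= f x) ->
  measurable_fun setT (fun phi : counting_measures R => \int[cmeas phi]_x f x).
Proof.
move=> mf f0.
apply: (@measurable_fun_integral_kernel _ _ (counting_measures R) _ R (fun phi => cmeas phi)) => //.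
move=> U mU _ V mV; rewrite setTI; apply: sub_sigma_algebra.
by exists U, V.
Qed.

End counting_maps.

Section good_event.
Context d0 (T0 : measurableType d0) (R : realType) (P0 : probability T0 R)
  (X : {RV P0 >-> mark R}) (w : R -> \bar R).
Hypothesis w_ge0 : forall r, 0 <= w r.
Hypothesis w_ni : forall r r', (r <= r')%R -> w r' <= w r.

Let mX : measurable_fun setT X. Proof. exact: measurable_funPT. Qed.

Lemma measurable_good d (Y : measurableType d) (f : Y -> T0) (r rho : Y -> R) (delta : R) :
  measurable_fun setT f -> measurable_fun setT r -> measurable_fun setT rho ->
  measurable_fun setT (fun y => good X w (r y) (rho y) delta (f y)).
Proof.
move=> mf mr mrho; apply: (@measurable_fun_bool _ _ _ _ true); rewrite setTI.
rewrite (_ : _ @^-1` _ = [set y | (offspring X (f y))%:E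
      <= delta%:E * (w (r y - rho y)%R)^-1] `&` [set y | (Lam X (f y) <= rho y)%R]).
  apply: measurableI; last first.
    rewrite -[X in measurable X]setTI.
    apply: (@measurable_fun_ler _ _ _ _ (fun y => Lam X (f y)) rho) => //.
    exact: (measurableT_comp (measurable_Lam mX) mf).
  rewrite -[X in measurable X]setTI; apply: measurable_lee => //.
    apply/measurable_EFinP; exact: (measurableT_comp (measurable_offspring X) mf).
  apply: emeasurable_funM => //.
  apply: (@measurableT_comp _ _ _ _ _ _ (fun x : R => (w x)^-1)).
    apply: nondecreasing_emeasurable => x y xy.
    by rewrite lee_pV2 ?inE ?w_ge0// w_ni.
  exact: measurable_funB.
apply/seteqP; split => y /=.
  by move=> /set_mem[/=]; rewrite chiTE.
by move=> [h1 h2]; apply/mem_set; split => //; rewrite chiTE.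
Qed.

End good_event.

Section evaluation_sfinite.
Context d (Y : measurableType d) (R : realType).

Definition evaluation_mass n (p : Y * counting_measures R) :
    {measure set R -> \bar R} :=
  if cmeas p.2 setT == n%:R%:E then cmeas p.2 else mzero.

Lemma evaluation_massE n p U : evaluation_mass n p U =
  if cmeas p.2 setT == n%:R%:E then cmeas p.2 U else 0.
Proof. by rewrite /evaluation_mass; case: (_ == _). Qed.

Lemma measurable_evaluation_mass n U : measurable U ->
  measurable_fun setT (evaluation_mass n ^~ U).
Proof.
move=> mU; have me V : measurable V ->
    measurable_fun setT (fun p : Y * counting_measures R => cmeas p.2 V).
  exact: measurable_evaluation.
apply: (@eq_measurable_fun _ _ _ _ _ (fun p : Y * counting_measures R =>
    if (cmeas p.2 setT <= n%:R%:E) && (n%:R%:E <= cmeas p.2 setT)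
    then cmeas p.2 U else 0)).
  by move=> p _; rewrite -eq_le /evaluation_mass; case: ifP.
apply: measurable_fun_ifT => //; last exact: me.
by apply: measurable_and; apply: measurable_fun_lee_bool => //; exact: me.
Qed.

HB.instance Definition _ n :=
  isKernel.Build _ _ _ _ R (evaluation_mass n) (measurable_evaluation_mass n).

(** The mass of a counting measure is finite but unbounded, so the evaluation
    kernel is not finite; it is the sum of its restrictions to the counting
    measures of each given mass. *)
Lemma evaluation_sfinite : exists2 s : (R.-ker (Y * counting_measures R)%type ~> R)^nat,
    forall n, measure_fam_uub (s n) &
    forall p U, measurable U -> @evaluation _ Y R p U = kseries s p U.
Proof.
exists evaluation_mass => [n|p U mU].
  exists n.+1%:R%R => p; have := evaluation_massE n p setT.
  case: ifP => [/eqP nE mE|_ mE]; apply: (@le_lt_trans _ _ n%:R%:E); rewrite ?lte_fin ?ltr_nat//.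
    by rewrite -nE -mE.
  by apply: (@le_trans _ _ 0); rewrite ?lee_fin// -mE.
rewrite /kseries /= /mseries.
have [n nE] := cmeas_nat p.2 measurableT.
rewrite (@nneseriesD1 _ _ n)//= eseries0 ?adde0; last first.
  move=> k _ /= kn; apply: etrans (evaluation_massE k p U) _.
  by rewrite nE eqe eqr_nat eq_sym (negbTE kn).
by apply: esym; apply: etrans (evaluation_massE n p U) _; rewrite nE eqxx.
Qed.

HB.instance Definition _ := isSFiniteKernel_subdef.Build _ _ _ _ R
  (@evaluation _ Y R) evaluation_sfinite.

End evaluation_sfinite.

(** * Configurations with two atoms *)

Section constants.
Context d0 (T0 : measurableType d0) (R : realType) (P0 : probability T0 R)
  (X : {RV P0 >-> mark R}) (sigma eta : R).
Hypothesis hA : assumptions X sigma eta.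

Let mX : measurable_fun setT X. Proof. exact: measurable_funPT. Qed.

(** For large [r] these configurations satisfy the truncation, and their
    first atom, seen as a sibling of another one, contributes at least
    [w (r + K)]. *)
Definition tame_branching (K : R) : set T0 :=
  [set t | [&& 2 <= size (atoms X t), (offspring X t <= K)%R, (Lam X t <= K)%R
      & (- K <= nth 0 (atoms X t) 0)%R]%N].

Lemma measurable_tame K : measurable (tame_branching K).
Proof.
rewrite (_ : tame_branching K = [set t | (2 <= size (atoms X t))%N] `&`
   ([set t | (offspring X t <= K)%R] `&` ([set t | (Lam X t <= K)%R] `&`
    [set t | (- K <= nth 0 (atoms X t) 0)%R]))).
  apply: measurableI; first exact: measurable_offspring_ge.
  apply: measurableI.
    rewrite -[X in measurable X]setTI.
    by apply: (@measurable_fun_ler _ _ _ _ (offspring X) (cst K)) => //; exact: measurable_offspring.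
  apply: measurableI.
    rewrite -[X in measurable X]setTI.
    by apply: (@measurable_fun_ler _ _ _ _ (Lam X) (cst K)) => //; exact: measurable_Lam.
  rewrite -[X in measurable X]setTI.
  apply: (@measurable_fun_ler _ _ _ _ (cst (- K)) (fun t => nth 0 (atoms X t) 0))%R => //.
  exact: (measurable_atom (measurable_atoms mX)).
by apply/seteqP; split => t /= => [/and4P[]|[? [? []]]] // *; apply/and4P.
Qed.

Lemma tame_branching_pos : exists K, (0 < K)%R /\ 0 < P0 (tame_branching K).
Proof.
apply: contrapT => no.
have tame0 k : P0.-negligible (tame_branching k.+1%:R).
  apply/negligibleP; first exact: measurable_tame.
  apply/eqP; rewrite eq_le measure_ge0 andbT leNgt; apply/negP => h.
  by apply: no; exists k.+1%:R%R.
have := branching_pos hA; rewrite lt_neqAle measure_ge0 andbT => /eqP; apply.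
apply/esym; apply: measure_negligible; first exact: measurable_offspring_ge.
apply: negligibleS (negligible_bigcup tame0) => t /= t2.
pose M := Num.max (Num.max (offspring X t) (Lam X t)) (- nth 0 (atoms X t) 0)%R.
exists (Num.truncn M) => //=.
have : (M <= (Num.truncn M).+1%:R)%R by rewrite ltW// truncnS_gt.
rewrite {1}/M !ge_max => /andP[/andP[h1 h2] h3].
by apply/and4P; split => //; rewrite lerNl.
Qed.

End constants.

(** * Palm formulas on the truncated event *)

Section point_masses_sums.
Context (R : realType).

Lemma sum_remove (s : seq R) (i : nat) (f : R -> R) : (i < size s)%N ->
  (\sum_(x <- take i s ++ drop i.+1 s) f x = \sum_(x <- s) f x - f (nth 0 s i))%R.
Proof.
move=> si; have -> : (\sum_(x <- s) f x = \sum_(x <- take i s) f x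
    + (f (nth 0 s i) + \sum_(x <- drop i.+1 s) f x))%R.
  by rewrite -{1}(cat_take_drop i s) (drop_nth 0%R si) big_cat big_cons.
by rewrite big_cat /=; ring.
Qed.

Lemma sum_off_diagonal (s : seq R) (f g : R -> R) :
  (\sum_(i < size s) f (nth 0 s i) * (\sum_(x <- s) g x - g (nth 0 s i))
   = (\sum_(x <- s) f x) * (\sum_(x <- s) g x) - \sum_(x <- s) f x * g x)%R.
Proof.
rewrite (eq_bigr (fun i : 'I_(size s) => f (nth 0 s i) * (\sum_(x <- s) g x)
   - f (nth 0 s i) * g (nth 0 s i))%R); last by move=> i _; rewrite mulrBr.
rewrite sumrB -mulr_suml; congr (_ * _ - _)%R.
  by rewrite [RHS](big_nth 0%R) big_mkord.
by rewrite [RHS](big_nth 0%R) big_mkord.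
Qed.

End point_masses_sums.

(** The final computation of the one-step estimate, on numbers: [x] stands
    for [w r], [u] for [1 - F r], [m], [q], [p] for the means of [w1],
    [w1 ^ 2], [w1 * v1], [psi] for the tilted mean and [e] for the
    probability of the bad event. Eliminating [q + p / 2] between the
    expansions of [u] and of [psi] leaves [x - psi = (x - u) - m ^ 2] up to
    the error terms, and [x - u] and [m ^ 2] are both close to [x ^ 2]. *)
Lemma step_arith (R : realType) (o d x u m q p e psi k : R) :
  (x = u * (1 + x))%R -> (x <= o)%R -> (0 <= x)%R ->
  (m <= u + q + p / 2)%R -> (u + q + p / 2 <= e + m + d * (q + p))%R ->
  (q + p <= k * o ^+ 2)%R ->
  ((1 + m) * m <= psi + q + p / 2)%R ->
  (psi + q + p / 2 <= (1 + m + 4 * o ^+ 2) * m + d * p)%R ->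
  (0 <= m)%R -> (m <= o)%R -> (0 <= q)%R -> (0 <= p)%R -> (0 <= e)%R ->
  (1 <= k)%R -> (o <= 2^-1)%R -> (0 <= o)%R -> (0 < d)%R -> (d <= 4^-1)%R ->
  (`|x - psi| <= 2 * e + o ^+ 2 * ((5 + 2 * k) * o + 2 * k * d))%R.
Proof.
move=> wu wom x0 h1 h2 h3 h4 h5 m0 m1 q0 p0 e0 k1 o2 o0 d0 d4.
have u0 : (0 <= u)%R by nra.
have xx : (x - u = x * u)%R by lra.
have xux : (x * u <= x ^+ 2)%R by nra.
have x3 : (x ^+ 2 - x * u <= o ^+ 2 * o)%R.
  have -> : (x ^+ 2 - x * u = x * x * u)%R by rewrite expr2 -mulrBr xx mulrA.
  have : (x * x <= o * o)%R by exact: ler_pM.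
  have : (u <= o)%R by nra.
  by move=> a b; rewrite expr2; apply: ler_pM => //; exact: mulr_ge0.
have o20 : (0 <= o ^+ 2)%R by exact: sqr_ge0.
have d3 : (d * (q + p) <= d * (k * o ^+ 2))%R by apply: ler_wpM2l => //; exact: ltW.
have dp : (d * p <= d * (k * o ^+ 2))%R.
  by apply: le_trans d3; apply: ler_wpM2l; [exact: ltW|lra].
have mo : (o ^+ 2 * m <= o ^+ 2 * o)%R by exact: ler_wpM2l.
have xo : (x ^+ 2 <= o ^+ 2)%R by apply: lerXn2r; rewrite ?nnegrE.
have ko : (0 <= k * o ^+ 2)%R by apply: mulr_ge0 => //; lra.
have dko : (0 <= d * (k * o ^+ 2))%R by apply: mulr_ge0 => //; exact: ltW.
have oo : (0 <= o ^+ 2 * o)%R by exact: mulr_ge0.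
have oko : (0 <= k * o ^+ 2 * o)%R by exact: mulr_ge0.
rewrite ler_norml; apply/andP; split.
  have key : (m ^+ 2 - x ^+ 2 <= 2 * (k * o ^+ 2 * o))%R.
    have [mx|xm] := leP m x; first by nra.
    have dm : (m - x <= k * o ^+ 2)%R by nra.
    have -> : (m ^+ 2 - x ^+ 2 = (m - x) * (m + x))%R by ring.
    have -> : (2 * (k * o ^+ 2 * o) = (k * o ^+ 2) * (2 * o))%R by ring.
    by apply: ler_pM => //; lra.
  rewrite expr2 in key; lra.
have key : (x ^+ 2 - m ^+ 2 <= e + 2 * (o ^+ 2 * o) + d * (k * o ^+ 2))%R.
  have [xm|mx] := leP x m; first by nra.
  have dm : (x - m <= o ^+ 2 + e + d * (k * o ^+ 2))%R by lra.
  have -> : (x ^+ 2 - m ^+ 2 = (x - m) * (x + m))%R by ring.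
  apply: (@le_trans _ _ ((o ^+ 2 + e + d * (k * o ^+ 2)) * (2 * o))%R).
    by apply: ler_pM => //; lra.
  have : (e * (2 * o) <= e * 1)%R by apply: ler_wpM2l => //; lra.
  have : (d * (k * o ^+ 2) * (2 * o) <= d * (k * o ^+ 2) * 1)%R by apply: ler_wpM2l => //; lra.
  lra.
rewrite !expr2 in key *; rewrite !expr2 in dko oo oko d3; lra.
Qed.

Section palm_state.
Context d0 (T0 : measurableType d0) (R : realType) (P0 : probability T0 R)
  (X : {RV P0 >-> mark R}).
Hypothesis hX : reproduction_scheme X.
Context (F : R -> R) (w : R -> \bar R).
Hypothesis F01 : forall r, (0 <= F r <= 1)%R.
Hypothesis F_nd : forall r r', (r <= r')%R -> (F r <= F r')%R.
Hypothesis F_rec : forall r, (F r)%:E = one_generation X F r.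
Hypothesis wE : forall r, w r = (F r)%:E^-1 - 1.
Context dZ (TZ : measurableType dZ) (PZ : probability TZ R) (Z : {RV PZ >-> R})
  (J : R -> R -> R -> {RV PZ >-> bool})
  (K : R.-pker palm_param R ~> counting_measures R).
Hypothesis hpv : palm_variables X w Z J.
Hypothesis hpk : palm_kernel X w Z J K.

Variables (r rho dl : R).
Hypothesis rho_r : (0 <= rho <= r)%R.
Hypothesis dl0 : (0 < dl)%R.
Hypothesis w_lt : w (r - rho) < +oo.

Let wf x := fine (w x).
Let om := wf (r - rho).
Let N := offspring X.
Let Jz z := J r rho dl z.

Let w0 := w_ge0 F01 wE.
Let wni := w_ni F01 F_nd wE.
Let mw : measurable_fun setT w := measurable_w F01 F_nd wE.
Let mX : measurable_fun setT X. Proof. exact: measurable_funPT. Qed.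
Let ma := measurable_atoms mX.

Let mF : measurable_fun setT F.
Proof. by apply: nondecreasing_measurable => // *; exact: F_nd. Qed.

Let wf0 x : (0 <= wf x)%R. Proof. exact: (wf_ge0 F01 wE). Qed.

Let mwf : measurable_fun setT wf.
Proof. exact: (measurableT_comp (fine_measurable measurableT) mw). Qed.

Let mwfr : measurable_fun setT (fun x : R => wf (r - x)%R).
Proof. by apply: (measurableT_comp mwf); exact: measurable_funB. Qed.

Let mwr : measurable_fun setT (fun x : R => w (r - x)%R).
Proof. by apply: (measurableT_comp mw); exact: measurable_funB. Qed.

(** The almost sure inequality between the atoms and Lambda is built in, so
    that on this event all atoms are at most [rho], pointwise. *)
Definition good_atoms t :=
  good X w r rho dl t && all (fun x => x <= Lam X t)%R (atoms X t).

Lemma measurable_good_atoms : measurable_fun setT good_atoms.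
Proof.
apply: measurable_and.
  apply: (@measurable_good _ _ _ _ X w w0 wni _ T0 id (cst r) (cst rho) dl) => //.
have -> : (fun t => all (fun x => x <= Lam X t)%R (atoms X t)) =
    (fun t => \sum_(x <- atoms X t) (x > Lam X t)%R%:R%:E <= (0 : \bar R)).
  apply/funext => t; apply/idP/idP.
    move=> /allP h; rewrite big_seq big1// => x /h xt.
    by rewrite ltNge xt.
  move=> h; apply/allP => x xt; rewrite leNgt; apply/negP => lx.
  move: h; rewrite sumEFin lee_fin leNgt => /negP; apply.
  rewrite (big_rem _ xt) /= lx ltr_pwDl//.
  by apply: sumr_ge0 => y _; exact: ler0n.
apply: measurable_fun_lee_bool => //.
apply: (measurable_sum_atoms ma (f := fun p => (p.2 > Lam X p.1)%R%:R%:E)).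
apply/measurable_EFinP.
apply: (@measurableT_comp _ _ _ _ _ _ (fun b : bool => b%:R : R)) => //.
apply: measurable_fun_ltr; last exact: measurable_snd.
exact: (measurableT_comp (measurable_Lam mX) measurable_fst).
Qed.

Lemma good_atoms_ae : {ae P0, forall t, good X w r rho dl t = good_atoms t}.
Proof.
have := Lam_ge_sup hX; apply: filterS => t ht.
rewrite /good_atoms (_ : all _ _ = true) ?andbT//; apply/allP => x xt.
rewrite -lee_fin; apply: le_trans ht; apply: ereal_sup_ubound.
by exists x.
Qed.

Let wE' x : w x < +oo -> w x = (wf x)%:E. Proof. exact: (wfE F01 wE). Qed.

Lemma good_eventE t : good X w r rho dl t =
  ((N t * om <= dl)%R && (Lam X t <= rho)%R).
Proof.
apply/idP/andP => [/set_mem[]|[h1 h2]]; last apply/mem_set; rewrite /= ?chiTE.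
  move=> h ->; split => //; move: h; rewrite wE'// -/om inver.
  have [-> _|om0] := eqVneq om 0%R; first by rewrite mulr0 ltW.
  by rewrite -EFinM lee_fin ler_pdivlMr// lt_neqAle eq_sym om0 wf0.
split => //; rewrite chiTE wE'// -/om inver.
have [_|om0] := eqVneq om 0%R; first by rewrite gt0_muley ?lte_fin// leey.
by rewrite -EFinM lee_fin ler_pdivlMr// lt_neqAle eq_sym om0 wf0.
Qed.

Lemma good_atomsP t : good_atoms t ->
  [/\ (Lam X t <= rho)%R, (N t * om <= dl)%R &
      forall x, x \in atoms X t -> (r - rho <= r - x)%R].
Proof.
rewrite /good_atoms good_eventE => /andP[/andP[h1 h2] /allP h3]; split => // x xt.
by rewrite lerB// (le_trans (h3 _ xt)).
Qed.

Let atom_w x : (r - rho <= r - x)%R -> w (r - x)%R = (wf (r - x))%:E /\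
  (wf (r - x) <= om)%R /\ F (r - x)%R = (1 + wf (r - x))^-1%R.
Proof.
move=> h; have l : w (r - x)%R < +oo by exact: (w_lty_ni F01 F_nd wE h).
split; first exact: wE'; split; first exact: (wf_ni F01 F_nd wE h).
exact: (F_wf F01 wE).
Qed.

Definition wsum t := (\sum_(x <- atoms X t) wf (r - x))%R.
Definition wsq t := (\sum_(x <- atoms X t) wf (r - x) ^+ 2)%R.

Let sumE (f : R -> R) t :
  \sum_(x <- atoms X t) (f x)%:E = (\sum_(x <- atoms X t) f x)%R%:E :> \bar R.
Proof. by rewrite sumEFin. Qed.

Lemma measurable_rsum (f : R -> R) : measurable_fun setT f ->
  measurable_fun setT (fun t => \sum_(x <- atoms X t) f x)%R.
Proof.
move=> mf; apply/measurable_EFinP.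
apply: (@eq_measurable_fun _ _ _ _ _ (fun t => \sum_(x <- atoms X t) (f x)%:E)).
  by move=> t _; rewrite /= sumE.
apply: (measurable_sum_atoms ma (f := fun p => (f p.2)%:E)).
by apply/measurable_EFinP; exact: (measurableT_comp mf measurable_snd).
Qed.

Let mwsum : measurable_fun setT wsum. Proof. exact: measurable_rsum. Qed.
Let mwsq : measurable_fun setT wsq.
Proof. by apply: (measurable_rsum (f := fun x => wf (r - x) ^+ 2)%R); exact: measurable_funX. Qed.

Lemma wsum_bounds t : good_atoms t ->
  [/\ (0 <= wsum t)%R, (0 <= wsq t <= wsum t ^+ 2)%R, (wsum t <= N t * om)%R &
      (wsum t <= dl)%R].
Proof.
move=> /good_atomsP[_ h2 h3].
have a0 : (0 <= wsum t)%R by apply: sumr_ge0 => x _.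
have a1 : (wsum t <= N t * om)%R.
  rewrite /wsum /N /offspring mulrC mulr_natr -iter_addr_0 -count_predT -big_const_seq.
  by rewrite big_seq [leRHS]big_seq; apply: ler_sum => x /h3/atom_w[_ []].
split => //; last exact: le_trans h2.
have := @prod_inv_bounds R [seq wf (r - x)%R | x <- atoms X t].
case; first by move=> x /mapP[y _ ->].
by rewrite !big_map.
Qed.

(** The defining formula of [(Z, I)] for functions supported on [I = 1], with
    the truncated event replaced by its pointwise version. *)
Lemma palm_good (f : R -> R) : measurable_fun setT f -> (forall x, (0 <= f x)%R) ->
  \int[PZ]_z (if Jz z then f (Z z) else 0)%R%:E =
  \int[P0]_t (if good_atoms t then \sum_(x <- atoms X t) f x else 0)%R%:E.
Proof.
move=> mf f0.
have mif (b : R * bool -> bool) : measurable_fun setT b ->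
    measurable_fun setT (fun p : R * bool => (if b p then f p.1 else 0)%R%:E).
  move=> mb; apply/measurable_EFinP; apply: measurable_fun_ifT => //.
  exact: (measurableT_comp mf measurable_fst).
rewrite (hpv r rho dl (mif snd measurable_snd)); last first.
  by move=> p; rewrite lee_fin; case: ifP.
have chiE t : \int[chi X t]_x (if good X w r rho dl t then f x else 0)%R%:E =
    (if good X w r rho dl t then \sum_(x <- atoms X t) f x else 0)%R%:E.
  rewrite integral_point_masses.
  - by case: (good X w r rho dl t); [exact: sumE|rewrite big1].
  - by case: (good X w r rho dl t) => //; exact/measurable_EFinP.
  - by move=> x; rewrite lee_fin; case: ifP.
under eq_integral do rewrite /= chiE.
apply: ge0_ae_eq_integral => //.
- apply/measurable_EFinP; apply: measurable_fun_ifT => //; last exact: measurable_rsum.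
  exact: (@measurable_good _ _ _ _ X w w0 wni _ T0 id (cst r) (cst rho) dl).
- apply/measurable_EFinP; apply: measurable_fun_ifT => //; last exact: measurable_rsum.
  exact: measurable_good_atoms.
- by move=> t _; rewrite lee_fin; case: ifP => // _; exact: sumr_ge0.
- by move=> t _; rewrite lee_fin; case: ifP => // _; exact: sumr_ge0.
- by apply: filterS good_atoms_ae => t -> _.
Qed.

(** Applied to the siblings [phi] of the spine; its mean under the Palm
    kernel is [spine_w]. *)
Definition other_w (phi : counting_measures R) : \bar R :=
  \int[cmeas phi]_y w (r - y)%R.

Lemma measurable_other_w : measurable_fun setT other_w.
Proof. by apply: measurable_integral_counting => // x; exact: w0. Qed.

Lemma other_w_ge0 phi : 0 <= other_w phi.
Proof. by apply: integral_ge0 => x _; exact: w0. Qed.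

Lemma other_wE t i : good_atoms t -> (i < size (atoms X t))%N ->
  other_w (chi_minus X i t) = (wsum t - wf (r - nth 0 (atoms X t) i))%R%:E.
Proof.
move=> /good_atomsP[_ _ h] it.
rewrite /other_w /chi_minus integral_point_masses//.
rewrite -(sum_remove (fun x => wf (r - x))%R it) -sumEFin.
apply: eq_big_seq => x; rewrite mem_cat => xt.
have /h/atom_w[] // : x \in atoms X t.
by case/orP: xt; [exact: mem_take|exact: mem_drop].
Qed.

Let kap z := K ((r, rho, dl), (Z z, true)).

(** The analogue of [palm_good] for functions that also see the siblings. *)
Lemma palm_other (G : R * counting_measures R -> \bar R) :
  measurable_fun setT G -> (forall p, 0 <= G p) ->
  \int[PZ]_z (if Jz z then \int[kap z]_phi G (Z z, phi) else 0) =
  \int[P0]_t (if good_atoms t then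
     \sum_(i < size (atoms X t)) G (nth 0%R (atoms X t) i, chi_minus X i t) else 0).
Proof.
move=> mG G0.
pose g (p : R * bool * counting_measures R) : \bar R :=
  if p.1.2 then G (p.1.1, p.2) else 0.
have mg : measurable_fun setT g.
  apply: measurable_fun_ifT => //.
    exact: (measurableT_comp measurable_snd measurable_fst).
  apply: (measurableT_comp mG); apply: measurable_fun_pair => //.
  exact: (measurableT_comp measurable_fst measurable_fst).
have g0 p : 0 <= g p by rewrite /g; case: ifP.
have := hpk rho_r dl0 mg g0.
rewrite (_ : \int[PZ]_z _ =
    \int[PZ]_z (if Jz z then \int[kap z]_phi G (Z z, phi) else 0)); last first.
  apply: eq_integral => z _; rewrite /g /Jz /=.
  case E : (J r rho dl z) => //=.
  by rewrite integral0.
move=> <-.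
have mS : measurable_fun setT (fun t => \sum_(i < size (atoms X t))
    G (nth 0%R (atoms X t) i, chi_minus X i t)).
  apply: (measurable_by_size ma) => n.
  apply: (@eq_measurable_fun _ _ _ _ _ (fun t => \sum_(i < n)
    G (nth 0%R (atoms X t) i, chi_minus X i t))).
    by move=> t; rewrite inE /= => <-.
  apply: measurable_funTS; apply: emeasurable_sum => i.
  apply: (measurableT_comp mG); apply: measurable_fun_pair.
    exact: measurable_atom.
  exact: (measurable_chi_minus mX).
have gE t : \sum_(i < size (atoms X t))
      g (nth 0%R (atoms X t) i, good X w r rho dl t, chi_minus X i t) =
    (if good X w r rho dl t then
     \sum_(i < size (atoms X t)) G (nth 0%R (atoms X t) i, chi_minus X i t) else 0).
  by rewrite /g /=; case: (good X w r rho dl t) => //; rewrite big1.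
under eq_integral do rewrite gE.
apply: ge0_ae_eq_integral => //.
- apply: measurable_fun_ifT => //.
  exact: (@measurable_good _ _ _ _ X w w0 wni _ T0 id (cst r) (cst rho) dl).
- by apply: measurable_fun_ifT => //; exact: measurable_good_atoms.
- by move=> t _; case: ifP => // _; apply: sume_ge0.
- by move=> t _; case: ifP => // _; apply: sume_ge0.
- by apply: filterS good_atoms_ae => t -> _.
Qed.

Definition spine_w z := \int[palm_mean K r rho dl (Z z)]_y w (r - y)%R.

Lemma spine_wE z : spine_w z = \int[kap z]_phi other_w phi.
Proof.
exact: (@integral_kcomp _ _ _ _ _ _ R K (@evaluation _ (palm_param R) R)).
Qed.

Lemma spine_w_ge0 z : 0 <= spine_w z.
Proof. by apply: integral_ge0 => x _; exact: w0. Qed.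

Lemma measurable_spine_w : measurable_fun setT spine_w.
Proof.
apply: (@measurable_fun_integral_kernel _ _ TZ _ R
  (fun z => palm_mean K r rho dl (Z z))) => //.
move=> U mU; apply: (measurableT_comp (measurable_kernel (K \; @evaluation _ (palm_param R) R) U mU)).
apply: measurable_fun_pair => //; apply: measurable_fun_pair => //.
Qed.

(** On the truncated event all atoms are at most [rho], and the sum of [w]
    over the siblings is at most [N om <= dl]; the Palm formulas transfer
    both bounds to almost every point of [I = 1]. *)
Lemma spine_ae : {ae PZ, forall z, Jz z -> w (r - Z z)%R <= om%:E /\ spine_w z <= dl%:E}.
Proof.
have h1 : {ae PZ, forall z, Jz z -> w (r - Z z)%R <= om%:E}.
  pose f x : R := (om%:E < w (r - x)%R)%E%:R.
  have mf : measurable_fun setT f.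
    apply: (@measurableT_comp _ _ _ _ _ _ (fun b : bool => b%:R : R)) => //.
    rewrite (_ : (fun x => _) = fun x => ~~ (w (r - x)%R <= om%:E)).
      by apply: measurable_neg; exact: measurable_fun_lee_bool.
    by apply/funext => x; rewrite ltNge.
  have f0 x : (0 <= f x)%R by exact: ler0n.
  have := palm_good mf f0; rewrite [RHS]integral0_eq; last first.
    move=> t _; case: ifP => // /good_atomsP[_ _ h]; rewrite big_seq big1// => x /h/atom_w.
    by move=> [wx [xo _]]; rewrite /f wx lte_fin ltNge xo.
  move=> /integral_ge0_eq0; case.
  - apply/measurable_EFinP; apply: measurable_fun_ifT => //.
    by apply: (measurableT_comp mf).
  - by move=> z; rewrite lee_fin; case: ifP.
  - move=> A [mA A0 hA]; exists A; split => // z /= hz; apply: hA => /= -[h].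
    apply: hz => Jzz; move: h; rewrite Jzz /f leNgt.
    by case: (_ < _)%E => // /eqP; rewrite oner_eq0.
have h2 : {ae PZ, forall z, Jz z -> spine_w z <= dl%:E}.
  pose G (p : R * counting_measures R) : \bar R := (dl%:E < other_w p.2)%E%:R%:E.
  have mG2 : measurable_fun setT (fun phi => (dl%:E < other_w phi)%E%:R%:E : \bar R).
    apply/measurable_EFinP.
    apply: (@measurableT_comp _ _ _ _ _ _ (fun b : bool => b%:R : R)) => //.
    rewrite (_ : (fun x => _) = fun phi => ~~ (other_w phi <= dl%:E)).
      apply: measurable_neg; apply: measurable_fun_lee_bool => //.
      exact: measurable_other_w.
    by apply/funext => x; rewrite ltNge.
  have mG : measurable_fun setT G by exact: (measurableT_comp mG2 measurable_snd).
  have G0 p : 0 <= G p by rewrite lee_fin ler0n.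
  have := palm_other mG G0; rewrite [RHS]integral0_eq; last first.
    move=> t _; case: ifP => // gt; rewrite big1// => i _.
    rewrite /G /= other_wE// lte_fin ltNge (_ : (_ <= dl)%R = true)//.
    have [_ _ _ h] := wsum_bounds gt; have := wf0 (r - nth 0 (atoms X t) i)%R.
    by move=> h'; lra.
  have mk : measurable_fun setT (fun z => \int[kap z]_phi G (Z z, phi)).
    apply: (@measurable_fun_integral_kernel _ _ TZ _ R kap _
      (fun phi => (dl%:E < other_w phi)%E%:R%:E)) => //.
    move=> U mU; apply: (measurableT_comp (measurable_kernel K U mU)).
    by apply: measurable_fun_pair => //; apply: measurable_fun_pair.
  move=> /integral_ge0_eq0; case.
  - by apply: measurable_fun_ifT => //; exact: measurable_funPT.
  - by move=> z; case: ifP => // _; exact: integral_ge0.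
  - move=> A [mA A0 hA]; exists A; split => // z /= hz; apply: hA => /= h.
    apply: hz => Jzz; move: h; rewrite Jzz => h.
    rewrite spine_wE; apply: (@le_trans _ _ (\int[kap z]_phi dl%:E)); last first.
      by rewrite integral_cst//= prob_kernel mule1.
    apply: ae_ge0_le_integral => //.
    + by move=> phi _; exact: other_w_ge0.
    + exact: measurable_other_w.
    + by move=> phi _; rewrite lee_fin ltW.
    + have := @ae_eq_integral_abs _ _ R (kap z) setT measurableT (fun phi => G (Z z, phi)) mG2.
      case=> h' _; have := h' _; rewrite (_ : \int[kap z]_x `|_| = 0); last first.
        by rewrite -[RHS]h; apply: eq_integral => phi _; rewrite gee0_abs.
      move=> /(_ erefl); apply: filterS => phi /(_ I) /= + _.
      rewrite /G /= => -[]; rewrite leNgt.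
      by case: (_ < _)%E => // /eqP; rewrite oner_eq0.
by apply: filterS2 h1 h2 => z a b Jzz; split; [exact: a|exact: b].
Qed.

(** The event [I = 1] reduced by a null set on which the a.s. bounds may
    fail: on it everything is finite and bounded, and means are means of real
    functions. *)
Definition spine_good z :=
  Jz z && ((w (r - Z z)%R <= om%:E) && (spine_w z <= dl%:E)).
Definition w1 z : R := wf (r - Z z).
Definition v1 z : R := fine (spine_w z).
Definition on_spine (f : TZ -> R) z : R := if spine_good z then f z else 0%R.
Definition on_good (f : T0 -> R) t : R := if good_atoms t then f t else 0%R.

Lemma measurable_w1 : measurable_fun setT w1.
Proof. exact: (measurableT_comp mwfr). Qed.

Lemma measurable_v1 : measurable_fun setT v1.
Proof. exact: (measurableT_comp (fine_measurable measurableT) measurable_spine_w). Qed.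

Lemma measurable_spine_good : measurable_fun setT spine_good.
Proof.
apply: measurable_and; first exact: measurable_funPT.
apply: measurable_and; apply: measurable_fun_lee_bool => //.
  exact: (measurableT_comp mwr).
exact: measurable_spine_w.
Qed.

Lemma measurable_on_spine f : measurable_fun setT f -> measurable_fun setT (on_spine f).
Proof. by move=> mf; apply: measurable_fun_ifT => //; exact: measurable_spine_good. Qed.

Lemma measurable_on_good f : measurable_fun setT f -> measurable_fun setT (on_good f).
Proof. by move=> mf; apply: measurable_fun_ifT => //; exact: measurable_good_atoms. Qed.

Lemma spine_good_ae : {ae PZ, forall z, Jz z = spine_good z}.
Proof.
apply: filterS spine_ae => z h; rewrite /spine_good.
by case: (Jz z) h => // /(_ isT)[-> ->].
Qed.

Lemma spine_goodP z : spine_good z ->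
  [/\ (0 <= w1 z <= om)%R, (0 <= v1 z <= dl)%R, w (r - Z z)%R = (w1 z)%:E &
      spine_w z = (v1 z)%:E].
Proof.
move=> /andP[_ /andP[h1 h2]].
have wz : w (r - Z z)%R = (w1 z)%:E by rewrite wE'// (le_lt_trans h1)// ltry.
have vz : spine_w z = (v1 z)%:E.
  by rewrite /v1 fineK// ge0_fin_numE ?spine_w_ge0// (le_lt_trans h2)// ltry.
have h1' : (w1 z <= om)%R by rewrite -lee_fin -wz.
have h2' : (v1 z <= dl)%R by rewrite -lee_fin -vz.
have v0 : (0 <= v1 z)%R by rewrite fine_ge0// spine_w_ge0.
have w10 : (0 <= w1 z)%R by exact: wf0.
by split => //; apply/andP.
Qed.

Lemma on_spine_ae (f : TZ -> R) (g : TZ -> \bar R) :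
  measurable_fun setT f -> measurable_fun setT g -> (forall z, 0 <= g z) ->
  (forall z, spine_good z -> (0 <= f z)%R /\ g z = (f z)%:E) ->
  \int[PZ]_z (if Jz z then g z else 0) = \int[PZ]_z (on_spine f z)%:E.
Proof.
move=> mf mg g0 fg; apply: ge0_ae_eq_integral => //.
- by apply: measurable_fun_ifT => //; exact: measurable_funPT.
- by apply/measurable_EFinP; exact: measurable_on_spine.
- by move=> z _; case: ifP.
- by move=> z _; rewrite lee_fin /on_spine; case: ifP => // /fg[].
- apply: filterS spine_good_ae => z -> _; rewrite /on_spine; case: ifP => // /fg[_ ->//].
Qed.

Lemma spine_mean : \int[PZ]_z (if Jz z then w (r - Z z)%R else 0) =
  \int[PZ]_z (on_spine w1 z)%:E.
Proof.
apply: on_spine_ae.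
- exact: measurable_w1.
- exact: (measurableT_comp mwr).
- by move=> z; exact: w0.
- by move=> z /spine_goodP[/andP[? _] _ -> _].
Qed.

Lemma Ex_w1 : Ex PZ (on_spine w1) = Ex P0 (on_good wsum).
Proof.
congr fine; rewrite -(on_spine_ae measurable_w1 (g := fun z => (w1 z)%:E)).
- under eq_integral do rewrite -(fun_if EFin).
  exact: (palm_good (f := fun x => wf (r - x)) mwfr).
- by apply/measurable_EFinP; exact: measurable_w1.
- by move=> z; rewrite lee_fin; exact: wf0.
- by move=> z /spine_goodP[/andP[? _] _ _ _].
Qed.

Lemma Ex_w1_sq : Ex PZ (on_spine (fun z => w1 z ^+ 2)%R) = Ex P0 (on_good wsq).
Proof.
congr fine; rewrite -(@on_spine_ae (fun z => w1 z ^+ 2)%R (fun z => (w1 z ^+ 2)%:E)).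
- under eq_integral do rewrite -(fun_if EFin).
  apply: (palm_good (f := fun x => wf (r - x) ^+ 2)%R); first exact: measurable_funX.
  by move=> x; exact: sqr_ge0.
- by apply: measurable_funX; exact: measurable_w1.
- by apply/measurable_EFinP; apply: measurable_funX; exact: measurable_w1.
- by move=> z; rewrite lee_fin sqr_ge0.
- by move=> z _; rewrite sqr_ge0.
Qed.

(** The Palm formula sums over the pairs of distinct atoms, that is, gives
    the square of the sum minus the sum of the squares. *)
Lemma Ex_w1_v1 : Ex PZ (on_spine (fun z => w1 z * v1 z)%R) =
  Ex P0 (on_good (fun t => wsum t ^+ 2 - wsq t)%R).
Proof.
congr fine; rewrite -(@on_spine_ae (fun z => w1 z * v1 z)%R
  (fun z => (w1 z)%:E * spine_w z)).
- pose G (p : R * counting_measures R) : \bar R := (wf (r - p.1))%:E * other_w p.2.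
  have mG : measurable_fun setT G.
    apply: emeasurable_funM.
      by apply/measurable_EFinP; exact: (measurableT_comp mwfr measurable_fst).
    exact: (measurableT_comp measurable_other_w measurable_snd).
  have G0 p : 0 <= G p by rewrite mule_ge0 ?lee_fin ?wf0 ?other_w_ge0.
  transitivity (\int[PZ]_z (if Jz z then \int[kap z]_phi G (Z z, phi) else 0)).
    apply: eq_integral => z _; case: ifP => // _.
    rewrite spine_wE /G /= ge0_integralZl//.
    + exact: measurable_other_w.
    + by move=> phi _; exact: other_w_ge0.
    + by rewrite lee_fin; exact: wf0.
  rewrite (palm_other mG G0); apply: eq_integral => t _; rewrite /on_good.
  case: ifPn => // gt.
  rewrite (eq_bigr (fun i : 'I_(size (atoms X t)) =>
    (wf (r - nth 0 (atoms X t) i) * (wsum t - wf (r - nth 0 (atoms X t) i)))%R%:E)).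
    rewrite sumEFin (sum_off_diagonal _ (fun x => wf (r - x)) (fun x => wf (r - x)))%R.
    by rewrite expr2.
  by move=> i _; rewrite /G /= other_wE// EFinM.
- by apply: measurable_funM; [exact: measurable_w1|exact: measurable_v1].
- apply: emeasurable_funM; last exact: measurable_spine_w.
  by apply/measurable_EFinP; exact: measurable_w1.
- by move=> z; rewrite mule_ge0 ?spine_w_ge0// lee_fin; exact: wf0.
- by move=> z /spine_goodP[/andP[? _] /andP[? _] _ ->]; rewrite mulr_ge0.
Qed.

(** Each sibling value is counted once for each other atom. *)
Lemma integral_v1 : \int[PZ]_z (on_spine v1 z)%:E =
  \int[P0]_t (on_good (fun t => (N t - 1) * wsum t)%R t)%:E.
Proof.
rewrite -(@on_spine_ae v1 spine_w).
- pose G (p : R * counting_measures R) : \bar R := other_w p.2.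
  have mG : measurable_fun setT G.
    exact: (measurableT_comp measurable_other_w measurable_snd).
  have G0 p : 0 <= G p by exact: other_w_ge0.
  under eq_integral do rewrite spine_wE.
  rewrite (palm_other mG G0); apply: eq_integral => t _; rewrite /on_good.
  case: ifPn => // gt.
  rewrite (eq_bigr (fun i : 'I_(size (atoms X t)) =>
    (1 * (wsum t - wf (r - nth 0 (atoms X t) i)))%R%:E)).
    rewrite sumEFin (sum_off_diagonal _ (fun=> 1%R) (fun x => wf (r - x)))%R.
    rewrite mulrBl mul1r; congr (_ * _ - _)%R%:E.
      by rewrite big_const_seq count_predT iter_addr_0.
    by apply: eq_bigr => x _; rewrite mul1r.
  by move=> i _; rewrite /G /= other_wE// mul1r.
- exact: measurable_v1.
- exact: measurable_spine_w.
- by move=> z; exact: spine_w_ge0.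
- by move=> z /spine_goodP[_ /andP[? _] _ ->].
Qed.

Lemma Intg_spine (f : TZ -> R) (C : R) : (0 <= C)%R -> measurable_fun setT f ->
  (forall z, spine_good z -> (`|f z| <= C)%R) -> Intg PZ (on_spine f).
Proof.
move=> C0 mf fC; apply: (@Intg_bounded _ _ _ PZ _ C); first exact: measurable_on_spine.
by move=> z; rewrite /on_spine; case: ifP => [/fC//|_]; rewrite normr0.
Qed.

Lemma Intg_good (f : T0 -> R) (C : R) : (0 <= C)%R -> measurable_fun setT f ->
  (forall t, good_atoms t -> (`|f t| <= C)%R) -> Intg P0 (on_good f).
Proof.
move=> C0 mf fC; apply: (@Intg_bounded _ _ _ P0 _ C); first exact: measurable_on_good.
by move=> t; rewrite /on_good; case: ifP => [/fC//|_]; rewrite normr0.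
Qed.

Variables (sigma eta : R).
Hypothesis hA : assumptions X sigma eta.
Hypothesis dl4 : (dl <= 4^-1)%R.
Hypothesis om2 : (om <= 2^-1)%R.

Definition mean_w := Ex PZ (on_spine w1).
Definition cross_w := Ex PZ (on_spine (fun z => w1 z * v1 z)%R).
Definition sq_w := Ex PZ (on_spine (fun z => w1 z ^+ 2)%R).
Definition bad_prob := Ex P0 (fun t => if good_atoms t then 0 else 1)%R.

Let om0 : (0 <= om)%R. Proof. exact: wf0. Qed.

Lemma gen_integrand_good t : good_atoms t ->
  gen_integrand X F r t = (\prod_(x <- atoms X t) (1 + wf (r - x))^-1)%R.
Proof.
move=> /good_atomsP[h1 _ h3]; rewrite /gen_integrand ifT; last first.
  by apply: (le_trans h1); case/andP: rho_r.
by apply: eq_big_seq => x /h3/atom_w[_ []].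
Qed.

Let u_ := fun t => (1 - gen_integrand X F r t)%R.

Let u01 t : (0 <= u_ t <= 1)%R.
Proof. by have /andP[a b] := gen_integrand01 X r t F01; rewrite /u_; apply/andP; split; lra. Qed.

Let Iu : Intg P0 u_.
Proof.
apply: (@Intg_bounded _ _ _ P0 _ 1%R).
  by apply: measurable_funB => //; exact: measurable_gen_integrand.
by move=> t; have /andP[a b] := u01 t; rewrite ger0_norm.
Qed.

Let Eu : Ex P0 u_ = (1 - F r)%R.
Proof.
have Ig : Intg P0 (gen_integrand X F r).
  apply: (@Intg_bounded _ _ _ P0 _ 1%R); first exact: measurable_gen_integrand.
  by move=> t; have /andP[a b] := gen_integrand01 X r t F01; rewrite ger0_norm.
have EF : Ex P0 (gen_integrand X F r) = F r.
  by rewrite /Ex -[X in fine X]F_rec.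
have I1 : Intg P0 (fun=> 1%R) by exact: finite_measure_integrable_cst.
have [|_] := @Ex_lin _ _ _ P0 [:: (1, fun=> 1); (-1, gen_integrand X F r)]%R.
  by move=> p; rewrite !inE => /orP[] /eqP ->.
rewrite !big_cons big_nil /= Ex_cst EF => h.
rewrite (_ : u_ = fun t => \sum_(p <- [:: (1, fun=> 1); (-1, gen_integrand X F r)]) p.1 * p.2 t)%R.
  by rewrite h; ring.
by apply/funext => t; rewrite !big_cons big_nil /= /u_; ring.
Qed.

(** * The tilted step *)

Lemma gen_bounds t : good_atoms t -> let s := wsum t in let q := wsq t in
  let p := gen_integrand X F r t in
  [/\ (1 - s + (s ^+ 2 + q) / 2 - s ^+ 3 <= p)%R,
      (p <= 1 - s + (s ^+ 2 + q) / 2)%R & (p * (1 + s) <= 1)%R].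
Proof.
move=> gt; rewrite gen_integrand_good//=.
have := @prod_inv_bounds R [seq wf (r - x)%R | x <- atoms X t].
case; first by move=> x /mapP[y _ ->].
by rewrite !big_map.
Qed.

Let mwsum2 : measurable_fun setT (fun t => wsum t ^+ 2 - wsq t)%R.
Proof. by apply: measurable_funB => //; exact: measurable_funX. Qed.

Let IS : Intg P0 (on_good wsum).
Proof.
apply: (@Intg_good _ dl) => //; first exact: ltW.
by move=> t /wsum_bounds[a _ _ b]; rewrite ger0_norm.
Qed.

Let wsq_bounds t : good_atoms t ->
  (0 <= wsq t <= dl ^+ 2)%R /\ (0 <= wsum t ^+ 2 - wsq t <= dl ^+ 2)%R.
Proof.
move=> /wsum_bounds[a /andP[b c] _ e].
have f : (wsum t ^+ 2 <= dl ^+ 2)%R by apply: lerXn2r; rewrite ?nnegrE// ltW.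
by split; apply/andP; split; lra.
Qed.

Let IQ : Intg P0 (on_good wsq).
Proof.
apply: (@Intg_good _ (dl ^+ 2)) => //; first exact: sqr_ge0.
by move=> t /wsq_bounds[/andP[a b] _]; rewrite ger0_norm.
Qed.

Let IC : Intg P0 (on_good (fun t => wsum t ^+ 2 - wsq t)%R).
Proof.
apply: (@Intg_good _ (dl ^+ 2)) => //; first exact: sqr_ge0.
by move=> t /wsq_bounds[_ /andP[a b]]; rewrite ger0_norm.
Qed.

Let Ibad : Intg P0 (fun t => if good_atoms t then 0 else 1)%R.
Proof.
apply: (@Intg_bounded _ _ _ P0 _ 1%R).
  by apply: measurable_fun_ifT => //; exact: measurable_good_atoms.
by move=> t; case: ifP; rewrite ?normr0 ?normr1.
Qed.

Let IN2 : Intg P0 (fun t => N t ^+ 2)%R.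
Proof.
apply/integrableP; split.
  by apply/measurable_EFinP; apply: measurable_funX; exact: measurable_offspring.
under eq_integral do rewrite gee0_abs ?lee_fin ?sqr_ge0//.
by rewrite (offspring_sq hA) ltry.
Qed.

Let EN2 : Ex P0 (fun t => N t ^+ 2)%R = (sigma ^+ 2 + 1)%R.
Proof. by rewrite /Ex (offspring_sq hA). Qed.

(** The upper bound in the expansion of the product, integrated. *)
Lemma mean_le_death : (mean_w <= 1 - F r + sq_w + cross_w / 2)%R.
Proof.
have := @Ex_comb _ _ _ P0 [:: (1, u_); (1, on_good wsq);
  (2^-1, on_good (fun t => wsum t ^+ 2 - wsq t)); (-1, on_good wsum)]%R.
rewrite /= !big_cons big_nil /= Eu -Ex_w1_sq -Ex_w1_v1 -Ex_w1.
rewrite -/mean_w -/cross_w -/sq_w => h.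
suff : (0 <= 1 * (1 - F r) + (1 * sq_w + (2^-1 * cross_w + (-1 * mean_w + 0))))%R by lra.
apply: h => [p|t]; first by rewrite !inE => /or4P[] /eqP ->.
rewrite !big_cons big_nil /= /on_good /u_.
case: ifPn => [/gen_bounds[_ a _]|_]; last by have := u01 t; rewrite /u_; lra.
by lra.
Qed.

(** The lower bound in the expansion of the product, integrated; outside of
    the truncated event the left hand side is at most [1], which gives the
    probability of the bad event. *)
Lemma death_le_mean :
  (1 - F r + sq_w + cross_w / 2 <= bad_prob + mean_w + dl * (sq_w + cross_w))%R.
Proof.
have := @Ex_comb _ _ _ P0 [:: (-1, u_); (dl - 1, on_good wsq);
  (dl - 2^-1, on_good (fun t => wsum t ^+ 2 - wsq t)); (1, on_good wsum);
  (1, fun t => if good_atoms t then 0 else 1)]%R.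
rewrite /= !big_cons big_nil /= Eu -Ex_w1_sq -Ex_w1_v1 -Ex_w1.
rewrite -/mean_w -/cross_w -/sq_w -/bad_prob => h.
suff : (0 <= -1 * (1 - F r) + ((dl - 1) * sq_w + ((dl - 2^-1) * cross_w +
   (1 * mean_w + (1 * bad_prob + 0)))))%R by lra.
apply: h => [p|t]; first by rewrite !inE => /orP[|/or4P[]] /eqP ->.
rewrite !big_cons big_nil /= /on_good /u_.
case: ifPn => [gt|_]; last by have := u01 t; rewrite /u_; lra.
have [a _ _] := gen_bounds gt; have [b _ _ e] := wsum_bounds gt.
have : (wsum t ^+ 3 <= dl * wsum t ^+ 2)%R.
  by rewrite exprS; apply: ler_wpM2r => //; exact: sqr_ge0.
by lra.
Qed.

(** This cruder bound, with no quadratic term, keeps the mean proportional to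
    [1 - F r], hence comparable with [w (r + K)]; it uses
    [\prod (1 + w_i)^-1 (1 + s) <= 1] and [s <= dl]. *)
Lemma mean_le_death_mul : (mean_w <= (1 + dl) * (1 - F r))%R.
Proof.
have := @Ex_comb _ _ _ P0 [:: (1 + dl, u_); (-1, on_good wsum)]%R.
rewrite /= !big_cons big_nil /= Eu -Ex_w1 -/mean_w => h.
suff : (0 <= (1 + dl) * (1 - F r) + (-1 * mean_w + 0))%R by lra.
apply: h => [p|t]; first by rewrite !inE => /orP[] /eqP ->.
rewrite !big_cons big_nil /= /on_good.
have /andP[u0 u1] := u01 t; have dl0' := dl0.
case: ifPn => [gt|_]; last first.
  by rewrite mulr0 !addr0 mulr_ge0//; lra.
have [_ _ c] := gen_bounds gt; have [b _ _ e] := wsum_bounds gt.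
have : ((u_ t) * (1 + wsum t) <= u_ t * (1 + dl))%R by apply: ler_wpM2l => //; lra.
have : (u_ t * (1 + wsum t) = 1 + wsum t - gen_integrand X F r t * (1 + wsum t))%R.
  by rewrite /u_; ring.
by lra.
Qed.

Lemma sq_cross_le : (sq_w + cross_w <= (sigma ^+ 2 + 1) * om ^+ 2)%R.
Proof.
have := @Ex_comb _ _ _ P0 [:: (om ^+ 2, fun t => N t ^+ 2); (-1, on_good wsq);
  (-1, on_good (fun t => wsum t ^+ 2 - wsq t))]%R.
rewrite /= !big_cons big_nil /= EN2 -Ex_w1_sq -Ex_w1_v1.
rewrite -/cross_w -/sq_w => h.
suff : (0 <= om ^+ 2 * (sigma ^+ 2 + 1) + (-1 * sq_w + (-1 * cross_w + 0)))%R by lra.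
apply: h => [p|t]; first by rewrite !inE => /or3P[] /eqP ->.
rewrite !big_cons big_nil /= /on_good.
have h : (0 <= om ^+ 2 * N t ^+ 2)%R by rewrite mulr_ge0 ?sqr_ge0.
case: ifPn => [gt|_]; last by lra.
have [b _ c _] := wsum_bounds gt.
have : (wsum t ^+ 2 <= (N t * om) ^+ 2)%R.
  by apply: lerXn2r; rewrite ?nnegrE// mulr_ge0// offspring_ge0.
by rewrite exprMn; lra.
Qed.

Lemma mean_w_bounds : (0 <= mean_w <= om)%R.
Proof.
apply/andP; split.
  by apply: Ex_ge0 => z; rewrite /on_spine; case: ifP => // _; exact: wf0.
have := @Ex_comb _ _ _ PZ [:: (om, fun=> 1); (-1, on_spine w1)]%R.
rewrite /= !big_cons big_nil /= Ex_cst -/mean_w => h.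
suff : (0 <= om * 1 + (-1 * mean_w + 0))%R by lra.
apply: h => [p|z].
  rewrite !inE => /orP[] /eqP ->.
    exact: finite_measure_integrable_cst.
  apply: (@Intg_spine _ om) => //; first exact: measurable_w1.
  by move=> z /spine_goodP[/andP[a b] _ _ _]; rewrite ger0_norm.
rewrite !big_cons big_nil /= /on_spine; have := om0.
by case: ifP => [/spine_goodP[/andP[a b] _ _ _]|_]; lra.
Qed.

(** The factor that one step contributes to the weight of the process. *)
Definition tilt z : R := expR (mean_w - w1 z - v1 z / 2).

Lemma measurable_tilt : measurable_fun setT tilt.
Proof.
apply: (measurableT_comp (@measurable_expR R)); apply: measurable_funB.
  by apply: measurable_funB => //; exact: measurable_w1.
by apply: measurable_funM => //; exact: measurable_v1.
Qed.

Lemma tilt_bounds z : spine_good z ->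
  [/\ (1 + (mean_w - w1 z - v1 z / 2) <= tilt z)%R,
      (tilt z <= 1 + (mean_w - w1 z - v1 z / 2) + 4 * (mean_w - w1 z) ^+ 2 + dl * v1 z)%R &
      (tilt z <= 2)%R].
Proof.
move=> /spine_goodP[/andP[a0 a1] /andP[b0 b1] _ _]; have /andP[m0 m1] := mean_w_bounds.
have o2 := om2; have d4 := dl4; have d0' := dl0.
have th : (mean_w - w1 z - v1 z / 2 <= 2^-1)%R by lra.
have sq : (2 * (mean_w - w1 z - v1 z / 2) ^+ 2 <= 4 * (mean_w - w1 z) ^+ 2 + v1 z ^+ 2)%R.
  have := sqr_ge0 (2 * (mean_w - w1 z) + v1 z)%R; nra.
have vv : (v1 z ^+ 2 <= dl * v1 z)%R by rewrite expr2; exact: ler_wpM2r.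
have ub := expR_le_quad th; split; first exact: expR_ge1Dx.
  by rewrite /tilt; lra.
have := expR_ge1Dx (- 2^-1 : R)%R; rewrite /tilt => h.
rewrite (@le_trans _ _ (expR 2^-1))// ?ler_expR//.
rewrite -[leRHS]invrK -[leLHS]invrK -expRN lef_pV2 ?posrE ?invr_gt0 ?expR_gt0//; lra.
Qed.

Lemma tilt_ge0 z : (0 <= tilt z)%R. Proof. exact: expR_ge0. Qed.

Definition step_w := Ex PZ (on_spine (fun z => w1 z * tilt z)%R).
Definition step_one := Ex PZ (on_spine tilt).

Let Iw1 : Intg PZ (on_spine w1).
Proof.
apply: (@Intg_spine _ om) => //; first exact: measurable_w1.
by move=> z /spine_goodP[/andP[a b] _ _ _]; rewrite ger0_norm.
Qed.

Let Iv1 : Intg PZ (on_spine v1).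
Proof.
apply: (@Intg_spine _ dl) => //; [exact: ltW|exact: measurable_v1|].
by move=> z /spine_goodP[_ /andP[a b] _ _]; rewrite ger0_norm.
Qed.

Let Iw1sq : Intg PZ (on_spine (fun z => w1 z ^+ 2)%R).
Proof.
apply: (@Intg_spine _ (om ^+ 2)) => //; first exact: sqr_ge0.
  by apply: measurable_funX; exact: measurable_w1.
move=> z /spine_goodP[/andP[a b] _ _ _]; rewrite ger0_norm ?sqr_ge0//.
by apply: lerXn2r; rewrite ?nnegrE.
Qed.

Let Iw1v1 : Intg PZ (on_spine (fun z => w1 z * v1 z)%R).
Proof.
apply: (@Intg_spine _ (om * dl)) => //; first by rewrite mulr_ge0// ltW.
  by apply: measurable_funM; [exact: measurable_w1|exact: measurable_v1].
move=> z /spine_goodP[/andP[a b] /andP[e f] _ _]; rewrite ger0_norm ?mulr_ge0//.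
exact: ler_pM.
Qed.

Lemma Intg_tilt : Intg PZ (on_spine tilt).
Proof.
apply: (@Intg_spine _ 2%R) => //; first exact: measurable_tilt.
by move=> z /tilt_bounds[_ _ a]; rewrite ger0_norm// tilt_ge0.
Qed.

Lemma Intg_w1_tilt : Intg PZ (on_spine (fun z => w1 z * tilt z)%R).
Proof.
apply: (@Intg_spine _ (om * 2)%R) => //; first by rewrite mulr_ge0.
  by apply: measurable_funM; [exact: measurable_w1|exact: measurable_tilt].
move=> z gz; have [_ _ a] := tilt_bounds gz.
have /spine_goodP[/andP[b c] _ _ _] := gz.
rewrite ger0_norm ?mulr_ge0 ?tilt_ge0//.
by apply: ler_pM => //; exact: tilt_ge0.
Qed.

(** Multiply [1 + t <= exp t] by [w1] and integrate. *)
Lemma step_w_ge : ((1 + mean_w) * mean_w <= step_w + sq_w + cross_w / 2)%R.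
Proof.
have := @Ex_comb _ _ _ PZ [:: (1, on_spine (fun z => w1 z * tilt z));
  (1, on_spine (fun z => w1 z ^+ 2)); (2^-1, on_spine (fun z => w1 z * v1 z));
  (-(1 + mean_w), on_spine w1)]%R.
rewrite /= !big_cons big_nil /= -/step_w -/sq_w -/cross_w -/mean_w => h.
suff : (0 <= 1 * step_w + (1 * sq_w + (2^-1 * cross_w + (- (1 + mean_w) * mean_w + 0))))%R.
  by lra.
apply: h => [p|z].
  by rewrite !inE => /or4P[] /eqP -> //; exact: Intg_w1_tilt.
rewrite !big_cons big_nil /= /on_spine; case: ifPn => [gz|_]; last by lra.
have [a _ _] := tilt_bounds gz; have /spine_goodP[/andP[b c] _ _ _] := gz.
have := ler_wpM2l b a; lra.
Qed.

(** Multiply the quadratic upper bound of the exponential by [w1] and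
    integrate. *)
Lemma step_w_le : (step_w + sq_w + cross_w / 2
  <= (1 + mean_w + 4 * om ^+ 2) * mean_w + dl * cross_w)%R.
Proof.
have := @Ex_comb _ _ _ PZ [:: (-1, on_spine (fun z => w1 z * tilt z));
  (-1, on_spine (fun z => w1 z ^+ 2)); (dl - 2^-1, on_spine (fun z => w1 z * v1 z));
  (1 + mean_w + 4 * om ^+ 2, on_spine w1)]%R.
rewrite /= !big_cons big_nil /= -/step_w -/sq_w -/cross_w -/mean_w => h.
suff : (0 <= -1 * step_w + (-1 * sq_w + ((dl - 2^-1) * cross_w +
   ((1 + mean_w + 4 * om ^+ 2) * mean_w + 0))))%R by lra.
apply: h => [p|z].
  by rewrite !inE => /or4P[] /eqP -> //; exact: Intg_w1_tilt.
rewrite !big_cons big_nil /= /on_spine; case: ifPn => [gz|_]; last by lra.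
have [_ a _] := tilt_bounds gz; have /spine_goodP[/andP[b c] _ _ _] := gz.
have /andP[m0 m1] := mean_w_bounds.
have d2 : ((mean_w - w1 z) ^+ 2 <= om ^+ 2)%R by nra.
have : (w1 z * tilt z <= w1 z * (1 + (mean_w - w1 z - v1 z / 2) + 4 * om ^+ 2 + dl * v1 z))%R.
  by apply: ler_wpM2l => //; lra.
lra.
Qed.

(** The second order part of the tilt is at most
    [4 om (mean_w + w1) + dl v1], and its first order part has mean at most
    [1] minus half the mean of [v1], since dropping the indicator of the
    truncation from the constant [1 + mean_w] only increases the mean. *)
Lemma step_one_le : (step_one <= 1 + 8 * om * mean_w
  - (2^-1 - dl) * Ex PZ (on_spine v1))%R.
Proof.
have /andP[m0 m1] := mean_w_bounds; have o2 := om2; have o0 := om0.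
have om_m : (0 <= om * mean_w)%R by exact: mulr_ge0.
have := @Ex_comb _ _ _ PZ [:: (1 + mean_w + 4 * om * mean_w, fun=> 1);
  (4 * om - 1, on_spine w1); (dl - 2^-1, on_spine v1); (-1, on_spine tilt)]%R.
rewrite /= !big_cons big_nil /= Ex_cst -/step_one -/mean_w => h.
suff : (0 <= (1 + mean_w + 4 * om * mean_w) * 1 + ((4 * om - 1) * mean_w +
   ((dl - 2^-1) * Ex PZ (on_spine v1) + (-1 * step_one + 0))))%R by lra.
apply: h => [p|z].
  rewrite !inE => /or4P[] /eqP -> //; [exact: finite_measure_integrable_cst|exact: Intg_tilt].
rewrite !big_cons big_nil /= /on_spine; case: ifPn => [gz|_]; last by lra.
have [_ a _] := tilt_bounds gz; have /spine_goodP[/andP[b c] _ _ _] := gz.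
have : ((mean_w - w1 z) ^+ 2 <= om * (mean_w + w1 z))%R.
  have : (0 <= w1 z * mean_w)%R by exact: mulr_ge0.
  have : (mean_w * mean_w <= om * mean_w)%R by exact: ler_wpM2r.
  have : (w1 z * w1 z <= om * w1 z)%R by exact: ler_wpM2r.
  by nra.
lra.
Qed.

Let w_r : w r < +oo.
Proof.
apply: (w_lty_ni F01 F_nd wE _ w_lt).
by case/andP: rho_r => a _; lra.
Qed.

(** The four expansions above, combined by [step_arith]. *)
Lemma step_mean (k := (sigma ^+ 2 + 1)%R) :
  (`|wf r - step_w| <= 2 * bad_prob + om ^+ 2 * ((5 + 2 * k) * om + 2 * k * dl))%R.
Proof.
have h1 := mean_le_death; have h2 := death_le_mean; have h3 := sq_cross_le.
have h4 := step_w_ge; have h5 := step_w_le; have /andP[m0 m1] := mean_w_bounds.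
have wu := wf_u F01 wE w_r; rewrite -/(wf r) in wu.
have wom : (wf r <= om)%R.
  by apply: (wf_ni F01 F_nd wE _ w_lt); case/andP: rho_r => a _; lra.
have o2 := om2; have o0 := om0; have d0' := dl0; have d4 := dl4; have x0 := wf0 r.
have q0 : (0 <= sq_w)%R.
  by apply: Ex_ge0 => z; rewrite /on_spine; case: ifP => // _; exact: sqr_ge0.
have c0 : (0 <= cross_w)%R.
  apply: Ex_ge0 => z; rewrite /on_spine; case: ifP => // /spine_goodP[/andP[a _] /andP[b _] _ _].
  exact: mulr_ge0.
have e0 : (0 <= bad_prob)%R by apply: Ex_ge0 => t; case: ifP.
have k1 : (1 <= k)%R by rewrite /k; have := sqr_ge0 sigma; lra.
rewrite -/k in h3.
exact: (@step_arith _ om dl (wf r) (1 - F r)%R mean_w sq_w cross_w bad_prob).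
Qed.

Lemma bad_prob_le : (bad_prob%:E <= P0 [set t | (rho < Lam X t)%R]
  + P0 [set t | (dl < N t * om)%R])%E.
Proof.
have mL : measurable [set t | (rho < Lam X t)%R].
  rewrite -[X in measurable X]setTI.
  by apply: (@measurable_fun_ltr _ _ _ _ (cst rho) (Lam X)) => //; exact: measurable_Lam.
have mN : measurable [set t | (dl < N t * om)%R].
  rewrite -[X in measurable X]setTI.
  apply: (@measurable_fun_ltr _ _ _ _ (cst dl) (fun t => N t * om)%R) => //.
  by apply: measurable_funM => //; exact: measurable_offspring.
have mU := measurableU _ _ mL mN.
rewrite -(ExE Ibad); apply: (@le_trans _ _ (P0 ([set t | (rho < Lam X t)%R]
    `|` [set t | (dl < N t * om)%R]))); last exact: measureU2.
have -> : P0 ([set t | (rho < Lam X t)%R] `|` [set t | (dl < N t * om)%R]) =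
    \int[P0]_t (\1_([set t | (rho < Lam X t)%R] `|` [set t | (dl < N t * om)%R]) t)%:E.
  by rewrite integral_indic// setIT.
apply: ae_ge0_le_integral => //.
- by move=> t _; rewrite lee_fin; case: ifP.
- apply/measurable_EFinP; apply: measurable_fun_ifT => //; exact: measurable_good_atoms.
- by apply/measurable_EFinP; exact: measurable_indic.
- apply: filterS good_atoms_ae => t <- _; rewrite good_eventE lee_fin indicE.
  have [h|h] := boolP (_ && _); first exact: ler0n.
  rewrite mem_set//=; move: h; rewrite negb_and -!ltNge => /orP[h|h]; by [right|left].
Qed.

(** On [tame_branching] every atom is a sibling of another one, hence is
    counted at least once by [integral_v1], and the first atom contributes at
    least [w (r + K0)]. *)
Lemma step_other (K0 : R) : (K0 <= rho)%R -> (K0 * om <= dl)%R -> (0 <= K0)%R ->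
  (fine (P0 (tame_branching X K0)) * wf (r + K0)
   <= Ex PZ (on_spine v1))%R.
Proof.
move=> K1 K2 K3; set G := tame_branching X K0.
have mG : measurable G by exact: measurable_tame.
have wK : (0 <= wf (r + K0))%R by exact: wf0.
rewrite -lee_fin -(ExE Iv1) integral_v1 EFinM fineK ?fin_num_measure//.
rewrite muleC.
have -> : P0 G = \int[P0]_t (\1_G t)%:E by rewrite integral_indic// setIT.
rewrite -ge0_integralZl//; last by apply/measurable_EFinP; exact: measurable_indic.
apply: ae_ge0_le_integral => //.
- by move=> t _; rewrite -EFinM lee_fin mulr_ge0.
- by apply: emeasurable_funM => //; apply/measurable_EFinP; exact: measurable_indic.
- move=> t _; rewrite lee_fin /on_good; case: ifPn => // gt.
  have [s0 _ _ _] := wsum_bounds gt.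
  have [n0|n0] := posnP (size (atoms X t)).
    by rewrite /wsum (size0nil n0) big_nil mulr0.
  by rewrite mulr_ge0// subr_ge0 /N /offspring (ler_nat _ 1).
- apply/measurable_EFinP; apply: measurable_on_good; apply: measurable_funM => //.
  by apply: measurable_funB => //; exact: measurable_offspring.
- apply: filterS good_atoms_ae => t gE _; rewrite -EFinM lee_fin indicE /on_good -gE good_eventE.
  have [/set_mem /and4P[a1 a2 a3 a4]|_] := boolP (t \in G); last first.
    rewrite mulr0; case: ifPn => // gt; rewrite -good_eventE gE in gt.
    have [s0 _ _ _] := wsum_bounds gt.
    have [n0|n0] := posnP (size (atoms X t)).
      by rewrite /wsum (size0nil n0) big_nil mulr0.
    by rewrite mulr_ge0// subr_ge0 /N /offspring (ler_nat _ 1).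
  have g1 : (N t * om <= dl)%R && (Lam X t <= rho)%R.
    apply/andP; split; last exact: le_trans a3 K1.
    by apply: le_trans K2; exact: ler_wpM2r.
  rewrite g1 mulr1; have gt : good_atoms t by rewrite -gE good_eventE.
  have [s0 _ _ _] := wsum_bounds gt; have [_ _ hx] := good_atomsP gt.
  have s1 : (0 < size (atoms X t))%N by exact: leq_trans a1.
  have w_le : (wf (r + K0) <= wsum t)%R.
    have m0 := mem_nth 0%R s1.
    rewrite /wsum (big_rem _ m0) /=.
    apply: (@le_trans _ _ (wf (r - nth 0 (atoms X t) 0)))%R; last first.
      by rewrite lerDl; apply: sumr_ge0 => x _; exact: wf0.
    apply: (wf_ni F01 F_nd wE); first by move: a4; lra.
    by rewrite (atom_w (hx _ m0)).1 ltry.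
  apply: (le_trans w_le); rewrite -[leLHS]mul1r; apply: ler_wpM2r => //.
  by rewrite lerBrDr /N /offspring (ler_nat _ 2).
Qed.

(** The mean of [v] is at least [p k (1 - F r)], while the mean of [w1] is at
    most [2 (1 - F r)]: for [om] small the loss [- v / 2] exceeds the gain of
    second order. *)
Lemma step_one_le1 (K0 p k : R) : (0 <= K0 <= rho)%R -> (K0 * om <= dl)%R ->
  (p <= fine (P0 (tame_branching X K0)))%R ->
  (0 < p)%R -> (0 < k)%R ->
  (k * (1 - F r) <= 1 - F (r + K0))%R -> (64 * om <= p * k)%R -> (step_one <= 1)%R.
Proof.
move=> /andP[K00 K0r] K0om pG p0 k0 shift small.
have V := step_other K0r K0om K00.
have wK : w (r + K0) < +oo.
  by apply: (w_lty_ni F01 F_nd wE _ w_r); lra.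
have wu := wf_u F01 wE wK; rewrite -/(wf _) in wu.
have /andP[_ FK1] := F01 (r + K0); have /andP[_ Fr1] := F01 r.
have uw : (1 - F (r + K0) <= wf (r + K0))%R.
  have := wf0 (r + K0) => x0; rewrite wu mulrDr mulr1 lerDl; apply: mulr_ge0 => //.
  by lra.
have V1 : (p * (k * (1 - F r)) <= Ex PZ (on_spine v1))%R.
  apply: le_trans V; apply: ler_pM => //; first exact: ltW.
    by rewrite mulr_ge0 ?(ltW k0)//; lra.
  exact: le_trans uw.
have m2 : (mean_w <= 2 * (1 - F r))%R.
  apply: (le_trans mean_le_death_mul); apply: ler_wpM2r; first by lra.
  by have d4 := dl4; lra.
apply: (le_trans step_one_le).
have o0 := om0; have d4 := dl4; have d0' := dl0.
have a1 : (om * mean_w <= om * (2 * (1 - F r)))%R by exact: ler_wpM2l.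
have a2 : (64 * om * (1 - F r) <= p * k * (1 - F r))%R by apply: ler_wpM2r => //; lra.
have V0 : (0 <= Ex PZ (on_spine v1))%R.
  by apply: le_trans V1; rewrite !mulr_ge0 ?(ltW p0) ?(ltW k0)//; lra.
have a3 : (4^-1 * Ex PZ (on_spine v1) <= (2^-1 - dl) * Ex PZ (on_spine v1))%R.
  by apply: ler_wpM2r => //; lra.
lra.
Qed.

End palm_state.

(** * Disintegration along a kernel *)

Section disintegration.
Context d dE dF (T : measurableType d) (E : measurableType dE)
  (F : measurableType dF) (R : realType) (Q : probability T R).
Context (p : T -> E) (q : T -> F) (N : E -> {measure set F -> \bar R}).
Hypothesis mp : measurable_fun setT p.
Hypothesis mq : measurable_fun setT q.
Hypothesis mN : forall B, measurable B -> measurable_fun setT (N ^~ B).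
Hypothesis N1 : forall e, N e setT = 1.

Let Nk : E -> {measure set F -> \bar R} := N.
HB.instance Definition _ := isKernel.Build _ _ _ _ R Nk mN.
HB.instance Definition _ := Kernel_isProbability.Build _ _ _ _ R Nk N1.

Let mgraph (e : E) : measurable_fun setT (fun x : F => (e, x)).
Proof. exact: measurable_fun_pair. Qed.

Let fibre (ue : unit * E) : {measure set (E * F)%type -> \bar R}.
Proof.
refine (pushforward (Nk ue.2) (fun x => (ue.2, x)) : {measure set (E * F)%type -> \bar R}).
exact: mgraph.
Defined.

Let fibreE ue U : fibre ue U = N ue.2 (xsection U ue.2).
Proof. by rewrite xsectionE. Qed.

Let mfibre U : measurable U -> measurable_fun setT (fibre ^~ U).
Proof.
move=> mU; apply: (@eq_measurable_fun _ _ _ _ _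
    ((fun e => Nk e (xsection U e)) \o snd)).
  by move=> ue _; rewrite fibreE.
apply: measurableT_comp => //.
by apply: measurable_fun_xsection_finite_kernel; rewrite inE.
Qed.

HB.instance Definition _ := isKernel.Build _ _ _ _ R fibre mfibre.

Let fibre1 ue : fibre ue setT = 1.
Proof. by rewrite fibreE xsectionE preimage_setT N1. Qed.

HB.instance Definition _ := Kernel_isProbability.Build _ _ _ _ R fibre fibre1.

Let base (_ : unit) : {measure set E -> \bar R}.
Proof.
refine (pushforward Q p : {measure set E -> \bar R}).
exact: mp.
Defined.

Let mbase U : measurable U -> measurable_fun setT (base ^~ U).
Proof. by move=> mU; exact: measurable_cst. Qed.

HB.instance Definition _ := isKernel.Build _ _ _ _ R base mbase.

Let base1 u : base u setT = 1.
Proof. by rewrite /base /= /pushforward preimage_setT probability_setT. Qed.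

HB.instance Definition _ := Kernel_isProbability.Build _ _ _ _ R base base1.

(** The law of [(p, q)] and the composition of the law of [p] with the kernel
    [N] agree on rectangles, hence everywhere. *)
Lemma disintegration (f : E * F -> \bar R) :
  (forall A B, measurable A -> measurable B ->
    Q (p @^-1` A `&` q @^-1` B) = \int[Q]_(t in p @^-1` A) N (p t) B) ->
  measurable_fun setT f -> (forall x, 0 <= f x) ->
  \int[Q]_t f (p t, q t) = \int[Q]_t \int[N (p t)]_x f (p t, x).
Proof.
move=> rect mf f0.
have mpq : measurable_fun setT (fun t => (p t, q t)) by exact: measurable_fun_pair.
transitivity (\int[pushforward Q (fun t => (p t, q t))]_x f x).
  by rewrite ge0_integral_pushforward.
transitivity (\int[kcomp base fibre tt]_x f x).
  apply: eq_measure_integral => U mU _.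
  have GI : setI_closed [set A `*` B | A in @measurable _ E & B in @measurable _ F].
    move=> _ _ [A1 mA1 [B1 mB1 <-]] [A2 mA2 [B2 mB2 <-]].
    exists (A1 `&` A2); first exact: measurableI.
    by exists (B1 `&` B2); [exact: measurableI|rewrite setXI].
  apply: (measure_unique [set A `*` B | A in @measurable _ E & B in @measurable _ F]
     (fun=> setT)) => //.
  - exact: measurable_prod_measurableType.
  - by move=> _; exists setT => //; exists setT => //; rewrite setXTT.
  - by apply/seteqP; split => // x _; exists 0%N.
  - move=> _ [A mA [B mB <-]].
    transitivity (Q (p @^-1` A `&` q @^-1` B)) => //; rewrite rect//.
    rewrite /kcomp /=.
    transitivity (\int[pushforward Q p]_e (if e \in A then N e B else 0)).
      rewrite ge0_integral_pushforward//.
      + rewrite preimage_setT [LHS]integral_mkcond; apply: eq_integral => t _.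
        by rewrite patchE.
      + apply: measurable_fun_ifT => //; last exact: mN.
        apply: (@measurable_fun_bool _ _ _ _ true); rewrite setTI.
        by rewrite (_ : _ @^-1` _ = A)//; apply/seteqP; split => e /= => [/set_mem|/mem_set].
      + by move=> e _; case: ifP.
    apply: eq_integral => e _; apply/esym; apply: etrans (fibreE _ _) _ => /=.
    case: ifPn => eA; first by rewrite in_xsectionX.
    by rewrite notin_xsectionX// measure0.
  - move=> _; apply: (@le_lt_trans _ _ 1); last exact: ltry.
    by rewrite /= /pushforward preimage_setT probability_setT.
rewrite (@integral_kcomp _ _ _ _ _ _ R base fibre)//.
transitivity (\int[pushforward Q p]_e \int[N e]_x f (e, x)).
  apply: eq_integral => e _.
  transitivity (\int[pushforward (Nk e) (fun x => (e, x))]_z f z); first by [].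
  by rewrite ge0_integral_pushforward.
rewrite ge0_integral_pushforward//.
- exact: (@measurable_fun_integral_finite_kernel _ _ _ _ _ f Nk).
- by move=> e _; exact: integral_ge0.
Qed.

Lemma measurable_kernel_integral (f : E * F -> \bar R) :
  measurable_fun setT f -> (forall x, 0 <= f x) ->
  measurable_fun setT (fun e => \int[N e]_x f (e, x)).
Proof. by move=> mf f0; exact: (@measurable_fun_integral_finite_kernel _ _ _ _ _ f Nk). Qed.

End disintegration.

(** * The Markov property of the processes *)

Section palm_measurability.
Context (R : realType) (w : R -> \bar R)
  (K : R.-pker palm_param R ~> counting_measures R) (delta : R).
Hypothesis mw : measurable_fun setT w.
Hypothesis w_ge0 : forall r, 0 <= w r.

Definition spine_at (r rho x : R) : \bar R :=
  \int[palm_mean K r rho delta x]_y w (r - y)%R.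

(** The Palm mean is a composition of two kernels, and [r] also enters the
    integrand: the inner integral is a measurable function of the counting
    measure and of [r], to which the Palm kernel is then applied. *)
Lemma measurable_spine_at d (Y : measurableType d) (r rho x : Y -> R) :
  measurable_fun setT r -> measurable_fun setT rho -> measurable_fun setT x ->
  measurable_fun setT (fun y => spine_at (r y) (rho y) (x y)).
Proof.
move=> mr mrho mx.
pose h (q : R * counting_measures R) : \bar R := \int[@evaluation _ R R q]_y w (q.1 - y)%R.
have mh : measurable_fun setT h.
  apply: (@measurable_fun_integral_sfinite_kernel _ _ (R * counting_measures R)%type R R
     (fun p => w (p.1.1 - p.2)%R) (@evaluation _ R R)); first by move=> p; exact: w_ge0.
  apply: (measurableT_comp mw); apply: measurable_funB => //.
  exact: (measurableT_comp measurable_fst measurable_fst).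
have mG : measurable_fun setT (fun p : palm_param R =>
    \int[K p]_phi h (p.1.1.1, phi)).
  apply: (@measurable_fun_integral_finite_kernel _ _ (palm_param R) (counting_measures R) R
     (fun p => h (p.1.1.1.1, p.2)) K); first by move=> p; exact: integral_ge0.
  apply: (measurableT_comp mh); apply: measurable_fun_pair; last exact: measurable_snd.
  apply: (measurableT_comp measurable_fst); apply: (measurableT_comp measurable_fst).
  exact: (measurableT_comp measurable_fst measurable_fst).
apply: (@eq_measurable_fun _ _ _ _ _ (fun y =>
    \int[K ((r y, rho y, delta), (x y, true))]_phi h (r y, phi))).
  move=> y _; apply/esym; apply: etrans.
    apply: (@integral_kcomp _ _ _ _ _ _ R K (@evaluation _ (palm_param R) R) _
      (fun z => w (r y - z)%R)) => //.
    by apply: (measurableT_comp mw); exact: measurable_funB.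
  by [].
apply: (measurableT_comp mG (g := fun y => ((r y, rho y, delta), (x y, true)))).
apply: measurable_fun_pair; apply: measurable_fun_pair => //.
exact: measurable_fun_pair.
Qed.

Lemma spine_at_ge0 r rho x : 0 <= spine_at r rho x.
Proof. by apply: integral_ge0 => y _; exact: w_ge0. Qed.

End palm_measurability.

Section past.
Context d (T : measurableType d) (R : realType) (Q : probability T R).
Variables (S Rh dl : nat -> {RV Q >-> R}) (I : nat -> {RV Q >-> bool}).

Definition past_sets (n : nat) : set (set T) :=
  [set A | exists k, (k <= n)%N /\
     ((exists U : set R, measurable U /\
         (A = S k @^-1` U \/ A = Rh k @^-1` U \/ A = dl k @^-1` U)) \/
      (exists b : bool, (0 < k)%N /\ A = I k @^-1` [set b]))].

(** The type [T] with the sigma-algebra of the filtration at time [n], so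
    that measurability with respect to the past is measurability of functions
    on this space. *)
Definition past n := g_sigma_algebraType (past_sets n).

Lemma past_S k n : (k <= n)%N -> measurable_fun setT (S k : past n -> R).
Proof.
move=> kn _ U mU; rewrite setTI; apply: sub_sigma_algebra.
by exists k; split => //; left; exists U; split => //; left.
Qed.

Lemma past_R k n : (k <= n)%N -> measurable_fun setT (Rh k : past n -> R).
Proof.
move=> kn _ U mU; rewrite setTI; apply: sub_sigma_algebra.
by exists k; split => //; left; exists U; split => //; right; left.
Qed.

Lemma past_dl k n : (k <= n)%N -> measurable_fun setT (dl k : past n -> R).
Proof.
move=> kn _ U mU; rewrite setTI; apply: sub_sigma_algebra.
by exists k; split => //; left; exists U; split => //; right; right.
Qed.

Lemma past_I k n : (k < n)%N -> measurable_fun setT (I k.+1 : past n -> bool).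
Proof.
move=> kn; apply: (@measurable_fun_bool _ _ _ _ true); rewrite setTI.
apply: sub_sigma_algebra; exists k.+1; split => //; right.
by exists true.
Qed.

Lemma past_sub n : <<s past_sets n >> `<=` measurable.
Proof.
apply: smallest_sub; first exact: sigma_algebra_measurable.
move=> _ [k [kn [[U [mU [->|[->|->]]]]|[b [k0 ->]]]]]; exact: measurable_funPTI.
Qed.

Lemma past_full n d' (E : measurableType d') (f : T -> E) :
  measurable_fun setT (f : past n -> E) -> measurable_fun setT f.
Proof.
move=> mf _ B mB; have := mf measurableT B mB; rewrite !setTI.
exact: past_sub.
Qed.

Lemma past_weaken n m d' (E : measurableType d') (f : T -> E) : (n <= m)%N ->
  measurable_fun setT (f : past n -> E) -> measurable_fun setT (f : past m -> E).
Proof.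
move=> nm mf _ B mB; have := mf measurableT B mB; rewrite !setTI.
apply: sub_sigma_algebra2 => A [k [kn h]].
by exists k; split => //; exact: leq_trans nm.
Qed.

Context d0 (T0 : measurableType d0) (P0 : probability T0 R)
  (X : {RV P0 >-> mark R}) (w : R -> \bar R).
Hypothesis w_ge0 : forall r, 0 <= w r.
Hypothesis w_ni : forall r r', (r <= r')%R -> w r' <= w r.
Context dZ (TZ : measurableType dZ) (PZ : probability TZ R) (Z : {RV PZ >-> R})
  (J : R -> R -> R -> {RV PZ >-> bool}).
Hypothesis hpv : palm_variables X w Z J.
Variable delta : R.
Hypothesis hdl : forall n t, dl n t = delta.
Hypothesis hstep : step_law S Rh dl I Z J.

Definition jump n (t : T) (z : TZ) : R * bool :=
  ((- Z z)%R, J (S n t) (Rh n t) delta z).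

Lemma measurable_jump n t : measurable_fun setT (jump n t).
Proof.
apply: measurable_fun_pair; last exact: measurable_funPT.
by apply: measurableT_comp => //; exact: measurable_funPT.
Qed.

Definition jump_law n (t : past n) : {measure set (R * bool)%type -> \bar R}.
Proof.
refine (pushforward PZ (jump n t) : {measure set (R * bool)%type -> \bar R}).
exact: measurable_jump.
Defined.

(** Nothing is assumed on the dependence of [J] on its parameters; the Palm
    formula rewrites the probability as an integral over the reproduction
    law, where the parameters enter through [good] only. *)
Lemma measurable_jump_law n B : measurable B -> measurable_fun setT (@jump_law n ^~ B).
Proof.
move=> mB.
pose f (p : R * bool) : \bar R := (\1_B ((- p.1)%R, p.2))%:E.
have mf : measurable_fun setT f.
  apply/measurable_EFinP; apply: measurableT_comp; first exact: measurable_indic.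
  by apply: measurable_fun_pair => //; apply: measurableT_comp => //; exact: measurable_fst.
pose g (p : past n * T0) : \bar R := \sum_(x <- atoms X p.2)
   f (x, good X w (S n p.1) (Rh n p.1) delta p.2).
have mX : measurable_fun setT X by exact: measurable_funPT.
have mg : measurable_fun setT g.
  have ma : measurable_fun setT (fun p : past n * T0 => atoms X p.2 : atom_seqs R).
    exact: (measurableT_comp (measurable_atoms mX) measurable_snd).
  apply: (measurable_sum_atoms ma (f := fun p : (past n * T0) * R =>
    f (p.2, good X w (S n p.1.1) (Rh n p.1.1) delta p.1.2))).
  apply: (measurableT_comp mf); apply: measurable_fun_pair; first exact: measurable_snd.
  apply: (@measurable_good _ _ _ _ X w w_ge0 w_ni _ _ (fun p : (past n * T0) * R => p.1.2)
     (fun p => S n p.1.1) (fun p => Rh n p.1.1) delta).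
  - exact: (measurableT_comp measurable_snd measurable_fst).
  - exact: (measurableT_comp (past_S (leqnn n)) (measurableT_comp measurable_fst measurable_fst)).
  - exact: (measurableT_comp (past_R (leqnn n)) (measurableT_comp measurable_fst measurable_fst)).
apply: (@eq_measurable_fun _ _ _ _ _ (fun t : past n => \int[P0]_s g (t, s))).
  move=> t _; apply/esym.
  transitivity (\int[PZ]_z f (Z z, J (S n t) (Rh n t) delta z)).
    transitivity (\int[PZ]_z (\1_(jump n t @^-1` B) z)%:E).
      rewrite integral_indic ?setIT//.
      by have := measurable_jump n t measurableT mB; rewrite setTI.
    by apply: eq_integral.
  rewrite (hpv _ _ _ mf) /g; last by move=> p; rewrite lee_fin.
  apply: eq_integral => s _.
  rewrite integral_point_masses; [by []| |by move=> x; rewrite lee_fin].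
  by apply: (measurableT_comp mf); exact: measurable_fun_pair.
have g0 p : 0 <= g p by apply: sume_ge0 => x _; rewrite lee_fin.
have := @measurable_fun_fubini_tonelli_F _ _ (past n) T0 R P0 g mg g0.
by [].
Qed.

Let jump_integralE n (f : past n * (R * bool) -> \bar R) t :
  measurable_fun setT f -> (forall p, 0 <= f p) ->
  \int[jump_law t]_x f (t, x) = \int[PZ]_z f (t, jump n t z).
Proof.
move=> mf f0; transitivity (\int[pushforward PZ (jump n t)]_x f (t, x)); first by [].
have mj := measurable_jump n t.
have mft : measurable_fun setT (fun x : R * bool => f (t, x)).
  apply: (measurableT_comp mf).
  by apply: (@measurable_fun_pair _ _ _ _ (past n) _ (fun=> t) id).
by rewrite (@ge0_integral_pushforward _ _ _ _ R (jump n t) mj PZ setT).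
Qed.

Lemma measurable_jump_integral n (f : past n * (R * bool) -> \bar R) :
  measurable_fun setT f -> (forall p, 0 <= f p) ->
  measurable_fun setT (fun t : past n => \int[PZ]_z f (t, jump n t z)).
Proof.
move=> mf f0.
apply: (@eq_measurable_fun _ _ _ _ _ (fun t : past n => \int[jump_law t]_x f (t, x))).
  by move=> t _; exact: jump_integralE.
apply: (@measurable_kernel_integral _ _ (past n) _ R (@jump_law n)) => //.
  by move=> B mB; exact: measurable_jump_law.
by move=> t; rewrite /jump_law /= /pushforward preimage_setT probability_setT.
Qed.

(** The Markov property at time [n]: the jump may depend on the past through
    the current state only, and its conditional law is the image of [PZ] by
    [jump]. *)
Lemma one_jump n (f : past n * (R * bool) -> \bar R) :
  measurable_fun setT f -> (forall p, 0 <= f p) ->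
  \int[Q]_t f (t, ((S n.+1 t - S n t)%R, I n.+1 t)) =
  \int[Q]_t \int[PZ]_z f (t, jump n t z).
Proof.
move=> mf f0.
have mid : measurable_fun setT (id : T -> past n).
  by move=> _ B mB; rewrite setTI; exact: (@past_sub n B mB).
have mq : measurable_fun setT (fun t => ((S n.+1 t - S n t)%R, I n.+1 t)).
  apply: measurable_fun_pair; last exact: measurable_funPT.
  by apply: measurable_funB; exact: measurable_funPT.
rewrite (@disintegration _ _ _ T (past n) (R * bool)%type R Q id _ (@jump_law n))//.
- by apply: eq_integral => t _; exact: jump_integralE.
- by move=> B mB; exact: (@measurable_jump_law n B mB).
- by move=> t; rewrite /jump_law /= /pushforward preimage_setT probability_setT.
- move=> A B mA mB; rewrite (@hstep n A B)//.
  by apply: eq_integral => t _; rewrite hdl.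
Qed.

End past.

(** * The stopped weight *)

Section ae_integral.
Import HBNNSimple.
Context d (T : measurableType d) (R : realType) (mu : {measure set T -> \bar R}).

Let le_integral_ae (f g : T -> \bar R) : (forall t, 0 <= f t) ->
  (forall t, 0 <= g t) -> {ae mu, forall t, f t = g t} ->
  \int[mu]_t f t <= \int[mu]_t g t.
Proof.
move=> f0 g0 [N [mN N0 fgN]]; rewrite !ge0_integralE// !patch_setT.
apply: ge_ereal_sup => _ [h /= hf <-].
have mNC := measurableC mN.
pose h' := proj_nnsfun h mNC.
have hh' t : h' t = (h \_ (~` N)) t by rewrite (mrestrict h mNC).
apply: le_trans; last first.
  apply: ereal_sup_ubound => /=; exists h'; last by [].
  move=> t; rewrite hh' patchE; case: ifPn => [tN|_]; last exact: g0.
  suff <- : f t = g t by exact: hf.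
  by move: tN; rewrite inE /=; apply: contra_notP => fgt; exact: fgN.
rewrite -!integralT_nnsfun le_eqVlt; apply/orP; left; apply/eqP; apply: ae_eq_integral => //.
  by apply/measurable_EFinP; exact: measurable_funPT.
  by apply/measurable_EFinP; exact: measurable_funPT.
exists N; split => // t /= tN; apply: contra_notP tN => tN _.
move: (hh' t); rewrite patchE mem_set// => e.
by congr (_%:E); exact/esym/e.
Qed.

(** Without measurability of [f] and [g]: the integral of a nonnegative
    function is a supremum over simple functions below it, and a simple
    function may be set to zero on a null set. *)
Lemma ge0_integral_ae (f g : T -> \bar R) : (forall t, 0 <= f t) ->
  (forall t, 0 <= g t) -> {ae mu, forall t, f t = g t} ->
  \int[mu]_t f t = \int[mu]_t g t.
Proof.
move=> f0 g0 fg; apply/eqP; rewrite eq_le !le_integral_ae//.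
by apply: filterS fg => t ->.
Qed.

End ae_integral.

Section stopped.
Context d (T : measurableType d) (R : realType) (Q : probability T R).
Variables (S Rh dl : nat -> {RV Q >-> R}) (I : nat -> {RV Q >-> bool}).
Context d0 (T0 : measurableType d0) (P0 : probability T0 R)
  (X : {RV P0 >-> mark R}) (w : R -> \bar R).
Hypothesis w_ge0 : forall r, 0 <= w r.
Hypothesis w_ni : forall r r', (r <= r')%R -> w r' <= w r.
Context dZ (TZ : measurableType dZ) (PZ : probability TZ R) (Z : {RV PZ >-> R})
  (J : R -> R -> R -> {RV PZ >-> bool}).
Hypothesis hpv : palm_variables X w Z J.
Variable delta : R.
Hypothesis hdl : forall n t, dl n t = delta.
Hypothesis hstep : step_law S Rh dl I Z J.
Variables (K : R.-pker palm_param R ~> counting_measures R).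

Local Notation past := (past S Rh dl I).
Local Notation jump := (jump S Rh Z J delta).
Local Notation spine := (spine_at w K delta).

Let mw : measurable_fun setT w.
Proof. exact: nonincreasing_emeasurable. Qed.

Definition mean_at r rho : \bar R :=
  \int[PZ]_z (if J r rho delta z then w (r - Z z)%R else 0).

Definition tilt_at r rho z : R :=
  expR (fine (mean_at r rho) - fine (w (r - Z z)) - fine (spine r rho (Z z)) / 2)%R.

Definition jumped k (t : T) : past k * (R * bool) :=
  (t, ((S k.+1 t - S k t)%R, I k.+1 t)).

Definition place k (p : past k * (R * bool)) : R := (S k p.1 + p.2.1)%R.

Lemma place_jumped k t : place (jumped k t) = S k.+1 t.
Proof. by rewrite /place /jumped /= addrC subrK. Qed.

Lemma measurable_place k : measurable_fun setT (@place k).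
Proof.
apply: measurable_funD.
  exact: (measurableT_comp (@past_S _ T R Q S Rh dl I k k (leqnn k)) measurable_fst).
exact: (measurableT_comp measurable_fst measurable_snd).
Qed.

Lemma measurable_jumped k :
  measurable_fun setT (fun t : past k.+1 => jumped k t).
Proof.
apply: (@measurable_fun_pair _ _ _ (past k.+1) (past k)).
  move=> _ B mB; rewrite setTI.
  apply: sub_sigma_algebra2 mB => A [j [jk h]].
  by exists j; split => //; exact: leq_trans (leqnSn k).
apply: measurable_fun_pair; last exact: past_I.
by apply: measurable_funB; exact: past_S.
Qed.

Lemma measurable_mean_at k :
  measurable_fun setT (fun t : past k => mean_at (S k t) (Rh k t)).
Proof.
have mf : measurable_fun setT (fun p : past k * (R * bool) =>
    if p.2.2 then w (place p) else 0).
  apply: measurable_fun_ifT; last exact: measurable_cst.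
    exact: (measurableT_comp measurable_snd measurable_snd).
  exact: (measurableT_comp mw (@measurable_place k)).
apply: (measurable_jump_integral w_ge0 w_ni hpv delta mf).
by move=> p; case: ifP => // _; exact: w_ge0.
Qed.

Definition spine_jump k (p : past k * (R * bool)) : \bar R :=
  spine (S k p.1) (Rh k p.1) (- p.2.1)%R.

Lemma measurable_spine_jump k : measurable_fun setT (@spine_jump k).
Proof.
apply: measurable_spine_at => //.
- exact: (measurableT_comp (@past_S _ T R Q S Rh dl I k k (leqnn k)) measurable_fst).
- exact: (measurableT_comp (@past_R _ T R Q S Rh dl I k k (leqnn k)) measurable_fst).
- apply: measurableT_comp => //.
  exact: (measurableT_comp measurable_fst measurable_snd).
Qed.

(** The factor of one step, as a function of the past and of the jump: under
    the law of the jump it is the tilt of the current state ([factor_jump]),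
    and along the process it is the factor of the weight. *)
Definition factor k (p : past k * (R * bool)) : R :=
  if p.2.2 then
    expR (fine (mean_at (S k p.1) (Rh k p.1)) - fine (w (place p))
          - fine (spine_jump p) / 2)%R
  else 0%R.

Lemma factor_ge0 k (p : past k * (R * bool)) : (0 <= factor p)%R.
Proof. by rewrite /factor; case: ifP => // _; exact: expR_ge0. Qed.

Lemma factor_jump k t z : factor ((t, jump k t z) : past k * (R * bool)) =
  if J (S k t) (Rh k t) delta z then tilt_at (S k t) (Rh k t) z else 0%R.
Proof. by rewrite /factor /tilt_at /spine_jump /place /= opprK. Qed.

Lemma measurable_factor k : measurable_fun setT (@factor k).
Proof.
apply: measurable_fun_ifT; last exact: measurable_cst.
  exact: (measurableT_comp measurable_snd measurable_snd).
apply: (measurableT_comp (@measurable_expR R)).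
have mfine : measurable_fun setT (@fine R) by exact: fine_measurable measurableT.
apply: measurable_funB; last first.
  apply: measurable_funM; last exact: measurable_cst.
  exact: (measurableT_comp mfine (@measurable_spine_jump k)).
apply: measurable_funB; apply: (measurableT_comp mfine).
  exact: (measurableT_comp (@measurable_mean_at k) measurable_fst).
exact: (measurableT_comp mw (@measurable_place k)).
Qed.

Definition density k (t : T) : R := (\prod_(j < k) factor (jumped j t))%R.

Lemma density_ge0 k t : (0 <= density k t)%R.
Proof. by apply: prodr_ge0 => j _; exact: factor_ge0. Qed.

Lemma measurable_density k : measurable_fun setT (density k : past k -> R).
Proof.
apply: measurable_prod => j _.
apply: (past_weaken (ltn_ord j)).
exact: (measurableT_comp (@measurable_factor j) (@measurable_jumped j)).
Qed.

(** Functions of the past factor out of the conditional mean. *)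
Lemma weighted_jump k (G : past k -> R) (h : past k * (R * bool) -> \bar R) :
  measurable_fun setT G -> (forall t, 0 <= G t)%R ->
  measurable_fun setT h -> (forall p, 0 <= h p) ->
  \int[Q]_t ((G t)%:E * h (jumped k t)) =
  \int[Q]_t ((G t)%:E * \int[PZ]_z h (t, jump k t z)).
Proof.
move=> mG G0 mh h0.
transitivity (\int[Q]_t \int[PZ]_z ((G t)%:E * h (t, jump k t z))).
  apply: (one_jump w_ge0 w_ni hpv hdl hstep
    (f := fun p => (G p.1)%:E * h p)).
    apply: emeasurable_funM => //; apply/measurable_EFinP.
    exact: (measurableT_comp mG measurable_fst).
  by move=> p; rewrite mule_ge0 ?lee_fin.
apply: eq_integral => t _; rewrite ge0_integralZl ?lee_fin//.
apply: (measurableT_comp mh).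
apply: (@measurable_fun_pair _ _ _ _ (past k)); first exact: measurable_cst.
exact: measurable_jump.
Qed.

Variable Cnd : nat -> T -> \bar R.
Hypothesis hC : cond_exp_steps S Rh dl I w Cnd.
Variables (tau : T -> nat) (m : nat) (eps : R).
Hypothesis tau_le : forall t, (tau t <= m)%N.
Hypothesis eps_ge0 : (0 <= eps)%R.
Definition alive k t := (k < tau t)%N.
Hypothesis alive_past : forall k,
  measurable_fun setT (alive k : past k -> bool).

Definition mean_tilt r rho : \bar R := \int[PZ]_z
  (if J r rho delta z then fine (w (r - Z z)) * tilt_at r rho z else 0)%R%:E.

Hypothesis start_fin : forall t, w (S 0 t) < +oo.
Hypothesis alive_fin : forall k t, alive k t -> w (S k t) < +oo.
Hypothesis alive_jump_fin : forall k t, alive k t ->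
  {ae PZ, forall z, J (S k t) (Rh k t) delta z ->
     w (S k t - Z z)%R < +oo /\ spine (S k t) (Rh k t) (Z z) < +oo}.
Hypothesis alive_mean : forall k t, alive k t -> mean_at (S k t) (Rh k t) <= 1.
Hypothesis alive_tilt : forall k t, alive k t ->
  mean_tilt (S k t) (Rh k t) <= w (S k t) + eps%:E /\
  w (S k t) <= mean_tilt (S k t) (Rh k t) + eps%:E.
Hypothesis alive_mass : forall k t, alive k t ->
  \int[PZ]_z (if J (S k t) (Rh k t) delta z then tilt_at (S k t) (Rh k t) z
              else 0)%R%:E <= 1.

Let id_past k : measurable_fun setT (id : T -> past k).
Proof. by move=> _ B mB; rewrite setTI; exact: (@past_sub _ _ _ _ S Rh dl I k B mB). Qed.

Definition past_law k : {measure set (past k) -> \bar R}.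
Proof.
refine (pushforward Q (id : T -> past k) : {measure set (past k) -> \bar R}).
exact: id_past.
Defined.

Lemma integral_past_law k (f : past k -> \bar R) E : measurable E ->
  measurable_fun setT f -> (forall t, 0 <= f t) ->
  \int[past_law k]_(t in E) f t = \int[Q]_(t in E) f t.
Proof.
move=> mE mf f0.
transitivity (\int[pushforward Q (id : T -> past k)]_(t in E) f t); first by [].
by rewrite (ge0_integral_pushforward (@id_past k))//; exact: measurable_funTS.
Qed.

Lemma mean_at_ge0 r rho : 0 <= mean_at r rho.
Proof. by apply: integral_ge0 => z _; case: ifP => // _; exact: w_ge0. Qed.

Let integral_restrict G (f : T -> \bar R) :
  \int[Q]_(t in G) f t = \int[Q]_t ((\1_G t)%:E * f t).
Proof.
rewrite integral_mkcond; apply: eq_integral => t _.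
by rewrite patchE indicE; case: ifPn => _; rewrite ?mul1e ?mul0e.
Qed.

(** By the Markov property both functions have, over every past event, the
    integral of [I w (S (k + 1))]. *)
Lemma cond_integral k (G : set (past k)) : measurable G ->
  \int[Q]_(t in G) Cnd k t = \int[Q]_(t in G) mean_at (S k t) (Rh k t).
Proof.
move=> mG; have [_ _ hk] := hC k.
rewrite (hk G mG) integral_restrict [RHS]integral_restrict.
pose h (p : past k * (R * bool)) : \bar R := if p.2.2 then w (place p) else 0.
transitivity (\int[Q]_t ((\1_G t)%:E * h (jumped k t))).
  apply: eq_integral => t _; rewrite /h place_jumped /=.
  by case: ifPn => _; rewrite ?mul1e ?mul0e.
rewrite (@weighted_jump k (\1_G)).
- by [].
- exact: measurable_indic.
- by move=> t; rewrite indicE ler0n.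
- apply: measurable_fun_ifT; last exact: measurable_cst.
    exact: (measurableT_comp measurable_snd measurable_snd).
  exact: (measurableT_comp mw (@measurable_place k)).
- by move=> p; rewrite /h; case: ifP => // _; exact: w_ge0.
Qed.

(** A version of the conditional expectation is determined up to a null set
    as long as it is integrable, which is known only where the process has
    not stopped yet. *)
Lemma cond_ae k :
  {ae Q, forall t, alive k t -> Cnd k t = mean_at (S k t) (Rh k t)}.
Proof.
have [C0 mC _] := hC k.
pose mu := past_law k.
pose D : set (past k) := [set t | alive k t].
have mD : measurable D.
  have mtrue : measurable [set true] by [].
  by have := @alive_past k measurableT _ mtrue; rewrite setTI.
have mCk : measurable_fun setT (Cnd k : past k -> \bar R).
  by move=> _ B mB; rewrite setTI; exact: mC.
have [N [mN N0 hN]] : ae_eq mu D (fun t => mean_at (S k t) (Rh k t)) (Cnd k).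
  apply: integral_ae_eq => //.
  - apply/integrableP; split; first exact: (measurable_funTS (@measurable_mean_at k)).
    apply: (@le_lt_trans _ _ (\int[mu]_(t in D) 1)).
      apply: ge0_le_integral => //.
      + by apply: measurableT_comp => //; exact: (measurable_funTS (@measurable_mean_at k)).
      + by move=> t Dt; rewrite gee0_abs ?mean_at_ge0//; exact: alive_mean.
    rewrite integral_cst// mul1e; apply: (@le_lt_trans _ _ 1); last exact: ltry.
    exact: (@probability_le1 _ _ _ Q D (past_sub mD)).
  - exact: measurable_funTS.
  - move=> E ED mE; rewrite !integral_past_law// ?cond_integral//.
    + exact: measurable_mean_at.
    + by move=> t; exact: mean_at_ge0.
exists N; split; [exact: past_sub mN|exact: N0|].
by move=> t /= nt; apply: hN => /= e; apply: nt => Dt; apply/esym/e.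
Qed.

(** The exceptional set of the almost sure bounds at the current state has
    probability zero under the law of the jump, hence along the process. *)
Lemma jump_fin_ae k : {ae Q, forall t, alive k t -> I k.+1 t ->
  w (S k.+1 t) < +oo /\ spine (S k t) (Rh k t) (S k t - S k.+1 t)%R < +oo}.
Proof.
pose h (p : past k * (R * bool)) : \bar R :=
  if p.2.2 && ((+oo <= w (place p)) || (+oo <= spine_jump p)) then 1 else 0.
have h0 p : 0 <= h p by rewrite /h; case: ifP.
have mh : measurable_fun setT h.
  apply: measurable_fun_ifT; [|exact: measurable_cst|exact: measurable_cst].
  apply: measurable_and; first exact: (measurableT_comp measurable_snd measurable_snd).
  apply: measurable_or; apply: measurable_fun_lee_bool => //.
    exact: (measurableT_comp mw (@measurable_place k)).
  exact: measurable_spine_jump.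
pose G t : R := if alive k t then 1%R else 0%R.
have mG : measurable_fun setT (G : past k -> R).
  by apply: measurable_fun_ifT => //; exact: alive_past.
have G0 t : (0 <= G t)%R by rewrite /G; case: ifP.
have Ih : \int[Q]_t ((G t)%:E * h (jumped k t)) = 0.
  rewrite (weighted_jump mG)//.
  transitivity (\int[Q]_t (cst 0 t : \bar R)); last by rewrite integral0.
  apply: eq_integral => t _; rewrite /G; case: ifPn => [at_|]; last by rewrite mul0e.
  rewrite mul1e; transitivity (\int[PZ]_z (cst 0 z : \bar R)); last by rewrite integral0.
  apply: ge0_integral_ae => //; apply: filterS (alive_jump_fin at_) => z hz.
  rewrite /h /spine_jump /place /= opprK; case: ifPn => // /andP[/hz[h1 h2]].
  by rewrite !leNgt h1 h2.
apply: filterS (integral_ge0_eq0 (P := Q) _ _ Ih).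
- move=> t; rewrite /G /h /= => + at_ It; rewrite at_ It place_jumped mul1e /=.
  case: ifPn => [_ /eqP|]; first by rewrite onee_eq0.
  rewrite negb_or -!ltNge => /andP[h1 h2] _; split => //.
  by move: h2; rewrite /spine_jump /= opprB.
- apply: emeasurable_funM; first by apply/measurable_EFinP; exact: (past_full mG).
  apply: (@past_full _ T R Q S Rh dl I k.+1).
  exact: (measurableT_comp mh (@measurable_jumped k)).
- by move=> t; rewrite mule_ge0// lee_fin.
Qed.

Lemma densityS k t : density k.+1 t = (density k t * factor (jumped k t))%R.
Proof. by rewrite /density big_ord_recr. Qed.

(** All the quantities in the exponent are finite almost surely, so that the
    exponential of the sum is the product of the exponentials; this holds at
    all times up to the stopping time simultaneously. *)
Lemma W_density : {ae Q, forall t, forall k,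
  (forall j, (j < k)%N -> alive j t) ->
  W S Rh dl I w K Cnd k t = (density k t * fine (w (S k t)))%:E}.
Proof.
have hc : {ae Q, forall t, forall k, alive k t -> Cnd k t = mean_at (S k t) (Rh k t)}.
  by apply: ae_foralln => k; exact: cond_ae.
have hj : {ae Q, forall t, forall k, alive k t -> I k.+1 t ->
  w (S k.+1 t) < +oo /\ spine (S k t) (Rh k t) (S k t - S k.+1 t)%R < +oo}.
  by apply: ae_foralln => k; exact: jump_fin_ae.
move: hc hj; apply: filterS2 => t hc hj k ak; rewrite /W /calW.
case: ifPn => [/forallP Ik|]; last first.
  move=> /forallPn[j /negbTE Ij]; rewrite mul0e /density.
  by rewrite (bigD1 j)//= {1}/factor /= Ij !mul0r.
have fK (x : \bar R) : 0 <= x -> x < +oo -> x = (fine x)%:E.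
  by move=> x0 xoo; rewrite fineK// ge0_fin_numE.
have mK (j : 'I_k) : Cnd j t = (fine (mean_at (S j t) (Rh j t)))%:E.
  rewrite hc ?ak//; apply: fK; first exact: mean_at_ge0.
  by apply: (le_lt_trans (alive_mean (ak j (ltn_ord j)))); exact: ltry.
have wK (j : 'I_k) : w (S j.+1 t) = (fine (w (S j.+1 t)))%:E.
  by apply: fK => //; have [] := hj j (ak j (ltn_ord j)) (Ik j).
have sK (j : 'I_k) : \int[palm_mean K (S j t) (Rh j t) (dl j t)
    (S j t - S j.+1 t)]_z w (S j t - z)%R =
    (fine (spine (S j t) (Rh j t) (S j t - S j.+1 t)))%:E.
  rewrite hdl; apply: fK; first exact: spine_at_ge0.
  by have [] := hj j (ak j (ltn_ord j)) (Ik j).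
have wSk : w (S k t) = (fine (w (S k t)))%:E.
  case: k Ik ak {mK wK sK} => [|k] Ik ak; first exact: fK.
  by apply: fK => //; have [] := hj k (ak k (ltnSn k)) (Ik ord_max).
rewrite wSk EFinM; congr (_ * _).
under eq_bigr do rewrite mK wK -EFinB.
rewrite sumEFin; under [in X in _ - X]eq_bigr do rewrite sK.
rewrite sumEFin -EFinM -EFinN -EFinD /= /density; congr (_%:E).
rewrite -sumrN mulr_sumr -sumrB expR_sum; apply: eq_bigr => j _.
rewrite /factor /= Ik; congr expR.
by rewrite place_jumped /spine_jump /= !opprB mulrC.
Qed.

Definition alive_density k t : R := if alive k t then density k t else 0%R.

Lemma alive_density_ge0 k t : (0 <= alive_density k t)%R.
Proof. by rewrite /alive_density; case: ifP => // _; exact: density_ge0. Qed.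

Lemma measurable_alive_density k :
  measurable_fun setT (alive_density k : past k -> R).
Proof.
by apply: measurable_fun_ifT => //; exact: measurable_density.
Qed.

Let mfine : measurable_fun setT (@fine R).
Proof. exact: fine_measurable measurableT. Qed.

Let mfactorE k : measurable_fun setT (fun p : past k * (R * bool) => (factor p)%:E).
Proof. by apply/measurable_EFinP; exact: measurable_factor. Qed.

(** The one-step tilt has mean at most [1], so the means decrease in [k]. *)
Lemma alive_density_mean k : \int[Q]_t (alive_density k t)%:E <= 1.
Proof.
have mD j : measurable_fun setT (fun t => (alive_density j t)%:E).
  by apply/measurable_EFinP; exact: (past_full (@measurable_alive_density _)).
elim: k => [|k IH].
  apply: (@le_trans _ _ (\int[Q]_t (cst 1 t))).
    apply: ge0_le_integral => // t _; first by rewrite lee_fin alive_density_ge0.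
    by rewrite /alive_density /density big_ord0; case: ifP => _; rewrite lee_fin// ler01.
  by rewrite integral_cst// mul1e probability_le1.
apply: le_trans IH.
apply: (@le_trans _ _ (\int[Q]_t ((alive_density k t)%:E * (factor (jumped k t))%:E))).
  apply: ge0_le_integral => //.
  - by move=> t _; rewrite lee_fin alive_density_ge0.
  - apply: emeasurable_funM => //; apply: (@past_full _ T R Q S Rh dl I k.+1).
    exact: (measurableT_comp (@mfactorE k) (@measurable_jumped k)).
  - move=> t _; rewrite -EFinM lee_fin /alive_density.
    case: ifPn => [aS|_]; last first.
      by rewrite mulr_ge0 ?factor_ge0//; case: ifP => // _; exact: density_ge0.
    have ak : alive k t := ltnW aS.
    by rewrite ak densityS.
rewrite (weighted_jump (h := fun p => (factor p)%:E) (@measurable_alive_density k))//; last 2 first.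
- by move=> t; exact: alive_density_ge0.
- by move=> p; rewrite lee_fin factor_ge0.
apply: ge0_le_integral => //.
- move=> t _; rewrite mule_ge0 ?lee_fin ?alive_density_ge0//.
  by apply: integral_ge0 => z _; rewrite lee_fin factor_ge0.
- apply: emeasurable_funM => //; apply: (@past_full _ T R Q S Rh dl I k).
  apply: (measurable_jump_integral w_ge0 w_ni hpv delta
    (f := fun p : past k * (R * bool) => (factor p)%:E) (@mfactorE k)).
  by move=> p; rewrite lee_fin factor_ge0.
- move=> t _; rewrite /alive_density; case: ifPn => [ak|_]; last by rewrite mul0e.
  rewrite -[leRHS]mule1; apply: lee_wpmul2l; first by rewrite lee_fin density_ge0.
  under eq_integral do rewrite factor_jump; exact: alive_mass.
Qed.

(** The weight at time [min (k, tau)], defined recursively so that its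
    measurability and the comparison of consecutive times are read off the
    definition. *)
Fixpoint stopped k t : R :=
  if k is j.+1 then
    if alive j t then (density k t * fine (w (S k t)))%R else stopped j t
  else fine (w (S 0 t)).

Lemma stoppedE k t :
  stopped k t = (density (minn k (tau t)) t * fine (w (S (minn k (tau t)) t)))%R.
Proof.
elim: k => [|k IH]; first by rewrite min0n /density big_ord0 mul1r.
rewrite /= IH /alive; case: ltnP => kt; first by rewrite (minn_idPl kt).
by rewrite (minn_idPr (leqW kt)).
Qed.

Let wf_ge0 r : (0 <= fine (w r))%R.
Proof. by rewrite fine_ge0. Qed.

Let dw_ge0 k t : (0 <= density k t * fine (w (S k t)))%R.
Proof. by rewrite mulr_ge0 ?density_ge0. Qed.

Lemma stopped_ge0 k t : (0 <= stopped k t)%R.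
Proof. by rewrite stoppedE. Qed.

Let m_wS k : measurable_fun setT (fun t : past k => fine (w (S k t))).
Proof.
apply: (measurableT_comp mfine); apply: (measurableT_comp mw).
exact: (@past_S _ T R Q S Rh dl I k k (leqnn k)).
Qed.

Lemma measurable_stopped k : measurable_fun setT (stopped k).
Proof.
elim: k => [|k IH]; first exact: (past_full (@m_wS 0)).
apply: measurable_fun_ifT => //; first exact: (past_full (@alive_past k)).
apply: measurable_funM; first exact: (past_full (@measurable_density _)).
exact: (past_full (@m_wS k.+1)).
Qed.

Let tilted k (p : past k * (R * bool)) : \bar R := (fine (w (place p)) * factor p)%R%:E.

Let tilted_ge0 k (p : past k * (R * bool)) : 0 <= tilted p.
Proof. by rewrite lee_fin mulr_ge0 ?factor_ge0. Qed.

Let m_tilted k : measurable_fun setT (@tilted k).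
Proof.
apply/measurable_EFinP; apply: measurable_funM; last exact: measurable_factor.
by apply: (measurableT_comp mfine); apply: (measurableT_comp mw); exact: measurable_place.
Qed.

Let mean_tiltE k t : \int[PZ]_z tilted ((t, jump k t z) : past k * (R * bool)) =
  mean_tilt (S k t) (Rh k t).
Proof.
apply: eq_integral => z _; rewrite /tilted factor_jump /place /=.
by case: ifP => // _; rewrite mulr0.
Qed.

Let mean_tilt_ge0 r rho : 0 <= mean_tilt r rho.
Proof.
apply: integral_ge0 => z _; rewrite lee_fin; case: ifP => // _.
by rewrite mulr_ge0 ?expR_ge0.
Qed.

Let m_mean_tilt k : measurable_fun setT (fun t : past k => mean_tilt (S k t) (Rh k t)).
Proof.
apply: (@eq_measurable_fun _ _ (past k) _ _ (fun t : past k =>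
  \int[PZ]_z tilted ((t, jump k t z) : past k * (R * bool)))).
  by move=> t _; exact: mean_tiltE.
exact: (measurable_jump_integral w_ge0 w_ni hpv delta (@m_tilted k)).
Qed.

Let frozen k t : R := if alive k t then 0%R else stopped k t.

Let m_frozen k : measurable_fun setT (fun t => (frozen k t)%:E).
Proof.
apply/measurable_EFinP; apply: measurable_fun_ifT => //.
  exact: (past_full (@alive_past k)).
exact: measurable_stopped.
Qed.

Let frozen_ge0 k t : 0 <= (frozen k t)%:E.
Proof. by rewrite lee_fin /frozen; case: ifP => // _; exact: stopped_ge0. Qed.

Let gE k t := (alive_density k t)%:E.
Let m_gE k : measurable_fun setT (gE k).
Proof. by apply/measurable_EFinP; exact: (past_full (@measurable_alive_density _)). Qed.
Let gE_ge0 k t : 0 <= gE k t.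
Proof. by rewrite lee_fin alive_density_ge0. Qed.

Let stopped_now k : \int[Q]_t (stopped k t)%:E =
  \int[Q]_t (gE k t * (fine (w (S k t)))%:E) + \int[Q]_t (frozen k t)%:E.
Proof.
rewrite -ge0_integralD//.
- apply: eq_integral => t _; rewrite /gE -EFinM -EFinD /alive_density /frozen.
  case: ifPn => ak; last by rewrite mul0r add0r.
  by rewrite addr0 stoppedE (minn_idPl (ltnW ak)).
- by move=> t _; apply: mule_ge0; rewrite // ?lee_fin.
- apply: emeasurable_funM => //; apply/measurable_EFinP.
  have h := @m_wS k; exact: (past_full h).
Qed.

Let stopped_next k : \int[Q]_t (stopped k.+1 t)%:E =
  \int[Q]_t (gE k t * mean_tilt (S k t) (Rh k t)) + \int[Q]_t (frozen k t)%:E.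
Proof.
transitivity (\int[Q]_t (gE k t * tilted (jumped k t)) + \int[Q]_t (frozen k t)%:E).
  rewrite -ge0_integralD//.
  - apply: eq_integral => t _; rewrite /gE /tilted -EFinM -EFinD /alive_density /frozen /=.
    case: ifPn => ak; last by rewrite mul0r add0r.
    by rewrite addr0 place_jumped densityS; congr (_%:E); ring.
  - by move=> t _; exact: mule_ge0.
  - apply: emeasurable_funM => //; apply: (@past_full _ T R Q S Rh dl I k.+1).
    exact: (measurableT_comp (@m_tilted k) (@measurable_jumped k)).
congr (_ + _).
rewrite (weighted_jump (@measurable_alive_density k) (@alive_density_ge0 k)
  (@m_tilted k) (@tilted_ge0 k)).
by apply: eq_integral => t _; rewrite mean_tiltE.
Qed.

Let weighted_le k (a b : T -> \bar R) : measurable_fun setT a ->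
  measurable_fun setT b -> (forall t, 0 <= a t) -> (forall t, 0 <= b t) ->
  (forall t, alive k t -> a t <= b t + eps%:E) ->
  \int[Q]_t (gE k t * a t) <= \int[Q]_t (gE k t * b t) + eps%:E.
Proof.
move=> ma mb a0 b0 ab.
apply: (@le_trans _ _ (\int[Q]_t (gE k t * b t + gE k t * eps%:E))).
  apply: ge0_le_integral => //.
  - by move=> t _; exact: mule_ge0.
  - exact: emeasurable_funM.
  - by apply: emeasurable_funD; apply: emeasurable_funM.
  - move=> t _; rewrite -ge0_muleDr ?lee_fin//.
    rewrite /gE /alive_density; case: ifPn => [ak|]; last by rewrite !mul0e.
    by rewrite lee_wpmul2l ?lee_fin ?density_ge0 ?ab.
rewrite ge0_integralD//; last 4 first.
- by move=> t _; exact: mule_ge0.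
- exact: emeasurable_funM.
- move=> t _; apply: mule_ge0; first exact: gE_ge0.
  exact: eps_ge0.
- exact: emeasurable_funM.
rewrite leeD2l// ge0_integralZr//.
rewrite muleC -[leRHS]mule1.
by apply: lee_wpmul2l; rewrite ?lee_fin//; exact: alive_density_mean.
Qed.

(** The two times differ only on the event that the process is still alive at
    time [k]; there, the conditional mean of the next value is the tilted
    mean of the current state, which is within [eps] of the current value,
    and the weights have total mean at most [1]. *)
Lemma stopped_step k :
  \int[Q]_t (stopped k.+1 t)%:E <= \int[Q]_t (stopped k t)%:E + eps%:E /\
  \int[Q]_t (stopped k t)%:E <= \int[Q]_t (stopped k.+1 t)%:E + eps%:E.
Proof.
have mwS : measurable_fun setT (fun t => (fine (w (S k t)))%:E).
  by apply/measurable_EFinP; exact: (past_full (@m_wS k)).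
have mt : measurable_fun setT (fun t => mean_tilt (S k t) (Rh k t)).
  exact: (past_full (@m_mean_tilt k)).
have wK t : alive k t -> (fine (w (S k t)))%:E = w (S k t).
  by move=> /alive_fin h; rewrite fineK// ge0_fin_numE.
rewrite stopped_next (stopped_now k); split; rewrite addeAC leeD2r//.
  apply: weighted_le => //.
  by move=> t; rewrite lee_fin.
  by move=> t ak; rewrite wK//; case: (alive_tilt ak).
apply: weighted_le => //.
  by move=> t; rewrite lee_fin.
by move=> t ak; rewrite wK//; case: (alive_tilt ak).
Qed.

Lemma stopped_error :
  \int[Q]_t W S Rh dl I w K Cnd (tau t) t <=
    \int[Q]_t w (S 0 t) + (m%:R * eps)%:E /\
  \int[Q]_t w (S 0 t) <=
    \int[Q]_t W S Rh dl I w K Cnd (tau t) t + (m%:R * eps)%:E.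
Proof.
have -> : \int[Q]_t w (S 0 t) = \int[Q]_t (stopped 0 t)%:E.
  by apply: eq_integral => t _; rewrite /= fineK// ge0_fin_numE.
have -> : \int[Q]_t W S Rh dl I w K Cnd (tau t) t = \int[Q]_t (stopped m t)%:E.
  apply: ge0_integral_ae.
  - move=> t; rewrite /W mule_ge0// /calW; case: ifP => // _; exact: expeR_ge0.
  - by move=> t; rewrite lee_fin stopped_ge0.
  - apply: filterS W_density => t ->; last by [].
    by rewrite stoppedE (minn_idPr (tau_le t)).
elim: m => [|n [IH1 IH2]]; first by rewrite mul0r !adde0.
have [h1 h2] := stopped_step n.
rewrite -natr1 mulrDl mul1r EFinD; split.
  by apply: (le_trans h1); rewrite addeA leeD2r.
by apply: (le_trans IH2); rewrite (addeC (_%:E)) addeA leeD2r.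
Qed.

End stopped.

(** * The one-step estimates for the processes *)

Section one_step.
Context d0 (T0 : measurableType d0) (R : realType) (P0 : probability T0 R)
  (X : {RV P0 >-> mark R}) (sigma eta : R).
Hypothesis hX : reproduction_scheme X.
Hypothesis hA : assumptions X sigma eta.
Context (F : R -> R) (w : R -> \bar R).
Hypothesis F01 : forall r, (0 <= F r <= 1)%R.
Hypothesis F_nd : forall r r', (r <= r')%R -> (F r <= F r')%R.
Hypothesis F_rec : forall r, (F r)%:E = one_generation X F r.
Hypothesis wE : forall r, w r = (F r)%:E^-1 - 1.
Context dZ (TZ : measurableType dZ) (PZ : probability TZ R) (Z : {RV PZ >-> R})
  (J : R -> R -> R -> {RV PZ >-> bool})
  (K : R.-pker palm_param R ~> counting_measures R).
Hypothesis hpv : palm_variables X w Z J.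
Hypothesis hpk : palm_kernel X w Z J K.
Variables (r rho dl : R).
Hypothesis rho_r : (0 <= rho <= r)%R.
Hypothesis dl0 : (0 < dl)%R.
Hypothesis dl4 : (dl <= 4^-1)%R.
Hypothesis w_lt : w (r - rho) < +oo.
Local Notation om := (fine (w (r - rho)%R)).
Hypothesis om2 : (om <= 2^-1)%R.

Lemma jump_fin : {ae PZ, forall z, J r rho dl z ->
  w (r - Z z)%R < +oo /\ spine_at w K dl r rho (Z z) < +oo}.
Proof.
apply: filterS (spine_ae hX F01 F_nd wE hpv hpk rho_r dl0 w_lt) => z h /h[h1 h2].
by split; [apply: (le_lt_trans h1)|apply: (le_lt_trans h2)]; exact: ltry.
Qed.

Lemma fine_mean_at : fine (mean_at w Z J dl r rho) = mean_w w Z J K r rho dl.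
Proof.
by rewrite /mean_at (spine_mean hX F01 F_nd wE hpv hpk rho_r dl0 w_lt).
Qed.

Lemma mean_at_le1 : mean_at w Z J dl r rho <= 1.
Proof.
rewrite /mean_at (spine_mean hX F01 F_nd wE hpv hpk rho_r dl0 w_lt).
apply: (@le_trans _ _ (\int[PZ]_z (cst 1 z))); last first.
  by rewrite integral_cst// mul1e probability_le1.
have o2 := om2; apply: ge0_le_integral => //.
- move=> z _; rewrite lee_fin /on_spine; case: ifP => // h.
  by have [/andP[]] := spine_goodP F01 wE h.
- apply/measurable_EFinP; apply: (measurable_on_spine F01 F_nd wE).
  exact: (measurable_w1 F01 F_nd wE).
- move=> z _; rewrite lee_fin /on_spine; case: ifP => [h|_]; last exact: ler01.
  have [/andP[_ h1] _ _ _] := spine_goodP F01 wE h; lra.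
Qed.

Lemma tilt_atE z : tilt_at w Z J dl K r rho z = tilt w Z J K r rho dl z.
Proof. by rewrite /tilt_at fine_mean_at. Qed.

Lemma mean_tiltE : mean_tilt w Z J dl K r rho = (step_w w Z J K r rho dl)%:E.
Proof.
rewrite -(ExE (@Intg_w1_tilt _ _ _ F01 F_nd wE _ _ _ Z J K r rho dl dl0 dl4 om2)).
have mf : measurable_fun setT (fun z => w1 w Z r z * tilt w Z J K r rho dl z)%R.
  apply: measurable_funM; first exact: (measurable_w1 F01 F_nd wE).
  exact: (measurable_tilt F01 F_nd wE).
rewrite -(on_spine_ae hX F01 F_nd wE hpv hpk rho_r dl0 w_lt
  (g := fun z => (w1 w Z r z * tilt w Z J K r rho dl z)%R%:E) mf) => //.
- by apply: eq_integral => z _; rewrite tilt_atE; case: ifP.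
- by apply/measurable_EFinP.
- move=> z; rewrite lee_fin mulr_ge0 ?expR_ge0//; exact: (wf_ge0 F01 wE).
- by move=> z _; split => //; rewrite mulr_ge0 ?expR_ge0//; exact: (wf_ge0 F01 wE).
Qed.

Lemma mass_tiltE : \int[PZ]_z
    (if J r rho dl z then tilt_at w Z J dl K r rho z else 0)%R%:E =
  (step_one w Z J K r rho dl)%:E.
Proof.
rewrite -(ExE (@Intg_tilt _ _ _ F01 F_nd wE _ _ _ Z J K r rho dl dl0 dl4 om2)).
have mf := @measurable_tilt _ _ _ F01 F_nd wE _ _ _ Z J K r rho dl.
rewrite -(on_spine_ae hX F01 F_nd wE hpv hpk rho_r dl0 w_lt
  (g := fun z => (tilt w Z J K r rho dl z)%:E) mf) => //.
- by apply: eq_integral => z _; rewrite tilt_atE; case: ifP.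
- by apply/measurable_EFinP.
- by move=> z; rewrite lee_fin expR_ge0.
- by move=> z _; split => //; exact: expR_ge0.
Qed.

Lemma mean_tilt_error eps :
  (2 * bad_prob X w r rho dl + om ^+ 2 * ((5 + 2 * (sigma ^+ 2 + 1)) * om
     + 2 * (sigma ^+ 2 + 1) * dl) <= eps)%R ->
  mean_tilt w Z J dl K r rho <= w r + eps%:E /\
  w r <= mean_tilt w Z J dl K r rho + eps%:E.
Proof.
move=> heps.
have := step_mean hX F01 F_nd F_rec wE hpv hpk rho_r dl0 w_lt hA dl4 om2.
move=> /= /le_trans/(_ heps); rewrite ler_norml => /andP[h1 h2].
have wr : w r = (fine (w r))%:E.
  apply: (wfE F01 wE); apply: (w_lty_ni F01 F_nd wE _ w_lt).
  by move: rho_r => /andP[rho0 _]; rewrite lerBlDr lerDl.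
rewrite mean_tiltE wr -!EFinD !lee_fin; split; lra.
Qed.

End one_step.

(** * The stopping time *)

Lemma ltn_hit_before (C : nat -> Prop) m k :
  (k < hit_before C m)%N <-> (k < m)%N /\ forall n, (n <= k)%N -> ~ C n.
Proof.
rewrite /hit_before; set p := fun n => _; split=> [kf|[km nC]].
  have km : (k < m)%N.
    by rewrite (leq_trans kf)// (leq_trans (find_size _ _))// size_iota.
  split => // n nk Cn; have := before_find 0%N (leq_ltn_trans nk kf).
  by rewrite nth_iota ?(leq_ltn_trans nk km)// add0n => /negP; apply; apply/asboolP.
rewrite ltnNge; apply/negP => fk.
have fm : (find p (iota 0 m) < m)%N by exact: leq_ltn_trans fk km.
have := nth_find 0%N (a := p) (s := iota 0 m).
rewrite has_find size_iota fm nth_iota// add0n => /(_ isT)/asboolP.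
exact: nC.
Qed.

Section stopping_time.
Context d (T : measurableType d) (R : realType) (Q : probability T R).
Variables (S Rh dl : nat -> {RV Q >-> R}) (I : nat -> {RV Q >-> bool}).
Variable w : R -> \bar R.
Hypothesis w_ge0 : forall r, 0 <= w r.
Hypothesis w_ni : forall r r', (r <= r')%R -> w r' <= w r.
Variables (x y cR rb delta0 a A : R).
Hypothesis a_ge0 : (0 <= a)%R.
Local Notation past := (past S Rh dl I).
Local Notation tau := (T' S Rh dl w x y cR rb delta0 a A).
Local Notation horizon := (Num.truncn (fine (A%:E / w x))).

Definition running n (t : T) : bool :=
  [&& x < S n t, 2 * rb <= S n t, rb <= Rh n t, Rh n t <= S n t - rb,
      0 < dl n t, dl n t < delta0,
      ((Rh n t)%:E <= a%:E / sqrte (w (S n t)))%E,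
      y <= S n t - Rh n t & cR <= Rh n t]%R.

Lemma runningP n t : reflect (~ tau_cond S x t n /\
  ~ T_cond S Rh dl w rb delta0 a t n /\ ~ rho_cond S Rh y cR t n) (running n t).
Proof.
apply: (iffP idP) => [/and5P[h1 h2 h3 h4 /and5P[h5 h6 h7 h8 h9]]|[h1 [h2 h3]]].
  split; [|split].
  - by apply/negP; rewrite -ltNge.
  - case.
    + by rewrite ltNge h2.
    + by rewrite h3 h4.
    + by rewrite h5 h6.
    + by rewrite ltNge h7.
  - by case; rewrite ltNge ?h8 ?h9.
have n1 (b c : R) : ~ (b < c)%R -> (c <= b)%R by move=> /negP; rewrite -leNgt.
have h4 : (rb <= Rh n t <= S n t - rb)%R.
  by apply: contrapT => h; apply: h2; exact: Or42.
have h5 : (0 < dl n t < delta0)%R.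
  by apply: contrapT => h; apply: h2; exact: Or43.
have /andP[h41 h42] := h4; have /andP[h51 h52] := h5.
apply/and5P; split => //.
- by move/negP: h1; rewrite -ltNge.
- by apply: n1 => h; apply: h2; exact: Or41.
apply/and5P; split => //.
- by rewrite leNgt; apply/negP => h; apply: h2; exact: Or44.
- by apply: n1 => h; apply: h3; left.
- by apply: n1 => h; apply: h3; right.
Qed.

(** In this form the event visibly depends on the past only, which the
    definition of the stopping time as a minimum of searches hides. *)
Lemma alive_T'E k t : alive tau k t = (k < horizon)%N && all (running^~ t) (iota 0 k.+1).
Proof.
apply/idP/andP; rewrite /alive /T' !ltn_min.
  move=> /and4P[/ltn_hit_before[km h1] /ltn_hit_before[_ h2] /ltn_hit_before[_ h3] _].
  split => //; apply/allP => n; rewrite mem_iota add0n ltnS => /andP[_ nk].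
  by apply/runningP; split; [exact: h1|split; [exact: h2|exact: h3]].
move=> [km /allP h]; have run n : (n <= k)%N -> running n t.
  by move=> nk; apply: h; rewrite mem_iota add0n ltnS nk.
rewrite km andbT; apply/and3P; split; apply/ltn_hit_before; split => // n /run/runningP[h1 [h2 h3]];
  [exact: h1|exact: h2|exact: h3].
Qed.

Lemma T'_le t : (tau t <= horizon)%N.
Proof. by rewrite /T' !geq_min leqnn !orbT. Qed.

Let measurable_level : measurable_fun setT (fun s => a%:E / sqrte (w s)).
Proof.
apply: nondecreasing_emeasurable => s s' ss'.
apply: lee_wpmul2l; first by rewrite lee_fin.
by rewrite lee_pV2 ?inE ?sqrte_ge0// lee_sqrt// w_ni.
Qed.

Lemma measurable_running n k : (n <= k)%N ->
  measurable_fun setT (running n : past k -> bool).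
Proof.
move=> nk.
have mS : measurable_fun setT (S n : past k -> R) by exact: past_S.
have mR : measurable_fun setT (Rh n : past k -> R) by exact: past_R.
have mD : measurable_fun setT (dl n : past k -> R) by exact: past_dl.
have c (b : R) : measurable_fun setT (fun _ : past k => b) by exact: measurable_cst.
have mSR (b : R) : measurable_fun setT (fun t : past k => S n t - b)%R by exact: measurable_funB.
rewrite /running; do ?apply: measurable_and.
- by apply: (@measurable_fun_ltr _ (past k) R setT (fun=> x) (S n)).
- by apply: (@measurable_fun_ler _ (past k) R setT (fun=> 2 * rb)%R (S n)).
- by apply: (@measurable_fun_ler _ (past k) R setT (fun=> rb) (Rh n)).
- exact: (@measurable_fun_ler _ (past k) R setT (Rh n) (fun t => S n t - rb)%R).
- by apply: (@measurable_fun_ltr _ (past k) R setT (fun=> 0%R) (dl n)).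
- by apply: (@measurable_fun_ltr _ (past k) R setT (dl n) (fun=> delta0)).
- apply: (@measurable_fun_lee_bool _ (past k) R); first exact/measurable_EFinP.
  exact: (measurableT_comp measurable_level mS).
- apply: (@measurable_fun_ler _ (past k) R setT (fun=> y) (fun t => S n t - Rh n t)%R) => //.
  exact: measurable_funB.
- by apply: (@measurable_fun_ler _ (past k) R setT (fun=> cR) (Rh n)).
Qed.

Lemma alive_T'_past k : measurable_fun setT (alive tau k : past k -> bool).
Proof.
have mall (s : seq nat) : (forall n, n \in s -> (n <= k)%N) ->
    measurable_fun setT (fun t : past k => all (running^~ t) s).
  elim: s => [|n s IH] ns; first exact: measurable_cst.
  apply: measurable_and; first by apply: measurable_running; rewrite ns ?mem_head.
  by apply: IH => j js; rewrite ns// in_cons js orbT.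
apply: (@eq_measurable_fun _ _ (past k) bool setT (fun t : past k =>
  (k < horizon)%N && all (running^~ t) (iota 0 k.+1))).
  by move=> t _; rewrite alive_T'E.
apply: measurable_and; first exact: measurable_cst.
by apply: mall => n; rewrite mem_iota add0n ltnS => /andP[].
Qed.

End stopping_time.

(** * Choice of the constants *)

Section constants_choice.
Context d0 (T0 : measurableType d0) (R : realType) (P0 : probability T0 R)
  (X : {RV P0 >-> mark R}) (sigma eta : R).
Hypothesis hX : reproduction_scheme X.
Hypothesis hA : assumptions X sigma eta.
Context (F : R -> R) (w : R -> \bar R).
Hypothesis F01 : forall r, (0 <= F r <= 1)%R.
Hypothesis F_nd : forall r r', (r <= r')%R -> (F r <= F r')%R.
Hypothesis F_rec : forall r, (F r)%:E = one_generation X F r.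
Hypothesis wE : forall r, w r = (F r)%:E^-1 - 1.

Lemma w_to0 (e : R) : (0 < e)%R ->
  exists r0, forall r, (r0 <= r)%R -> w r <= e%:E.
Proof.
move=> e0; have e1 : (0 < e / (1 + e))%R by rewrite divr_gt0// addr_gt0.
have [r0 hr0] := F_to1 hA F01 F_nd F_rec e1; exists r0 => r /hr0 h.
have e10 : (0 < 1 + e)%R by rewrite addr_gt0.
have he : (1 - e / (1 + e) = (1 + e)^-1)%R.
  by apply: (@mulIf _ (1 + e)%R); rewrite ?gt_eqF// mulrBl divfK ?gt_eqF// mulVf ?gt_eqF//; lra.
rewrite he in h; have Fr : (0 < F r)%R by apply: lt_trans h; rewrite invr_gt0.
rewrite (w_fin wE Fr) lee_fin lerBlDr -(invrK (e + 1)%R) lef_pV2 ?posrE ?invr_gt0//; last by rewrite addrC.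
by rewrite addrC; exact: ltW.
Qed.

Lemma w_gt0 r : 0 < w r.
Proof.
have F1 := F_lt1 hA F01 F_nd F_rec r (Lam_ge0 hX).
have /andP[F0 _] := F01 r.
move: F0; rewrite le_eqVlt => /predU1P[F0|F0].
  by rewrite wE -F0 inve0 addye// lt0y.
by rewrite (w_fin wE F0) lte_fin subr_gt0 invf_gt1.
Qed.

(** All the smallness conditions on [w] bear on [w r0] only, by monotonicity.
    The third one gives [K0 * w <= sqrt w / 16], which the cut-off dominates. *)
Lemma small_scale : exists K0 p k r0 : R,
  [/\ (0 < K0 <= r0)%R, (0 < p)%R /\ (0 < k)%R,
      (p <= fine (P0 (tame_branching X K0)))%R,
      forall r, (k * (1 - F r) <= 1 - F (r + K0))%R &
      forall r, (r0 <= r)%R -> [/\ w r < +oo, (fine (w r) <= 2^-1)%R,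
        (16 * K0 * Num.sqrt (fine (w r)) <= 1)%R &
        (64 * fine (w r) <= p * k)%R]].
Proof.
have [K0 [K00 hp]] := tame_branching_pos hA.
have [k [k0 hk]] := F_shift hA F01 F_nd F_rec K0.
pose p := fine (P0 (tame_branching X K0)).
have p0 : (0 < p)%R.
  rewrite fine_gt0// hp/=; apply: (@le_lt_trans _ _ 1); last exact: ltry.
  apply: probability_le1.
  exact: measurable_tame.
pose e := Num.min (2^-1)%R (Num.min ((16 * K0)^-1 ^+ 2)%R (p * k / 64)%R).
have K16 : (0 < 16 * K0)%R by rewrite mulr_gt0.
have e0 : (0 < e)%R.
  by rewrite !lt_min invr_gt0 ltr0n/= exprn_gt0 ?invr_gt0//= divr_gt0 ?mulr_gt0 ?ltr0n.
have [r1 hr1] := w_to0 e0.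
exists K0, p, k, (Num.max K0 r1); split => //.
  by rewrite K00 le_max lexx.
move=> r; rewrite ge_max => /andP[_ /hr1 wr].
have woo : w r < +oo by apply: (le_lt_trans wr); exact: ltry.
have : (fine (w r) <= e)%R by rewrite -lee_fin -(wfE F01 wE woo).
rewrite !le_min => /and3P[h1 h2 h3]; split => //; last by move: h3; rewrite ler_pdivlMr ?ltr0n// mulrC.
rewrite -(@ler_pM2l _ (16 * K0)^-1) ?invr_gt0// mulKf ?gt_eqF// mulr1.
have := ler_wsqrtr h2; rewrite sqrtr_sqr ger0_norm; last by rewrite invr_ge0 ltW.
by [].
Qed.

End constants_choice.

Lemma probability_fine d (T : measurableType d) (R : realType)
  (P : probability T R) (B : set T) : measurable B -> P B = (fine (P B))%:E.
Proof.
move=> mB; rewrite fineK// ge0_fin_numE//.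
by apply: (le_lt_trans (probability_le1 _ mB)); exact: ltry.
Qed.

Lemma total_error (R : realType) (b om wy q e1 dl C D err : R) :
  (0 <= om <= wy)%R -> (0 <= dl)%R -> (0 <= C)%R -> (0 <= D)%R ->
  (b <= q + wy ^+ 2 * e1)%R -> (2 * e1 + C * wy + D * dl <= err)%R ->
  (2 * b + om ^+ 2 * (C * om + D * dl) <= 2 * q + wy ^+ 2 * err)%R.
Proof.
move=> /andP[u0 ow] dl0 C0 D0 hb herr.
have w0 := le_trans u0 ow.
have h1 : (om ^+ 2 * (C * om + D * dl) <= wy ^+ 2 * (C * wy + D * dl))%R.
  apply: ler_pM; rewrite ?sqr_ge0//.
  - by rewrite addr_ge0 ?mulr_ge0.
  - by apply: lerXn2r; rewrite ?nnegrE.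
  - by rewrite lerD2r ler_wpM2l.
have h2 := ler_wpM2l (sqr_ge0 wy) herr; nra.
Qed.

Section one_state.
Context (R : realType)
  (d0 : measure_display) (T0 : measurableType d0) (P : probability T0 R)
  (X : {RV P >-> mark R}) (sigma eta : R).
Hypothesis hX : reproduction_scheme X.
Hypothesis hA : assumptions X sigma eta.
Context (F : R -> R) (w : R -> \bar R).
Hypothesis F01 : forall r, (0 <= F r <= 1)%R.
Hypothesis F_nd : forall r r', (r <= r')%R -> (F r <= F r')%R.
Hypothesis F_rec : forall r, (F r)%:E = one_generation X F r.
Hypothesis wE : forall r, w r = (F r)%:E^-1 - 1.
Variables (K0 p k r0 : R).
Hypothesis K0_r0 : (0 < K0 <= r0)%R.
Hypothesis pk0 : (0 < p)%R /\ (0 < k)%R.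
Hypothesis p_le : (p <= fine (P (tame_branching X K0)))%R.
Hypothesis k_le : forall r, (k * (1 - F r) <= 1 - F (r + K0))%R.
Hypothesis r0_small : forall r, (r0 <= r)%R -> [/\ w r < +oo, (fine (w r) <= 2^-1)%R,
        (16 * K0 * Num.sqrt (fine (w r)) <= 1)%R &
        (64 * fine (w r) <= p * k)%R].
Variables (y cR udelta err : R).
Hypothesis udelta_bounds : (0 < udelta < 4^-1)%R.
Hypothesis w_y : w y <= 1.
Hypothesis udelta_ge : (16^-1 * Num.sqrt (fine (w y)) <= udelta)%R.
Hypothesis tail_y : forall om, (0 <= om <= fine (w y))%R -> exists e1,
  [/\ (0 <= e1)%R,
      P [set t | (udelta < offspring X t * om)%R] <= (fine (w y) ^+ 2 * e1)%:E &
      (2 * e1 + (5 + 2 * (sigma ^+ 2 + 1)) * fine (w y) + 2 * (sigma ^+ 2 + 1) * udelta <= err)%R].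
Context dZ (TZ : measurableType dZ) (PZ : probability TZ R) (Z : {RV PZ >-> R})
  (J : R -> R -> R -> {RV PZ >-> bool})
  (K : R.-pker palm_param R ~> counting_measures R).
Hypothesis hpv : palm_variables X w Z J.
Hypothesis hpk : palm_kernel X w Z J K.

Let q := fine (P [set t | (cR < Lam X t)%R]).

Lemma measurable_Lam_gt s : measurable [set t | (s < Lam X t)%R].
Proof.
have mX : measurable_fun setT X by exact: measurable_funPT.
have := measurable_Lam mX measurableT (measurable_itv `]s, +oo[).
rewrite setTI; congr (measurable _); apply/seteqP; split => t /=;
  by rewrite in_itv /= andbT.
Qed.

(** The state satisfies the hypotheses of the one-step estimates:
    [w (r - rho)] is at most both [w r0] and [w y], and the probability of
    the bad event is bounded by the tail of Lambda at [cR] and by the tail of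
    the offspring number. *)
Lemma step_facts r rho : (r0 <= rho <= r - r0)%R -> (y <= r - rho)%R -> (cR <= rho)%R ->
  [/\ w r < +oo,
      {ae PZ, forall z, J r rho udelta z ->
         w (r - Z z)%R < +oo /\ spine_at w K udelta r rho (Z z) < +oo},
      mean_at w Z J udelta r rho <= 1,
      mean_tilt w Z J udelta K r rho <= w r + (2 * q + fine (w y) ^+ 2 * err)%:E /\
      w r <= mean_tilt w Z J udelta K r rho + (2 * q + fine (w y) ^+ 2 * err)%:E &
      \int[PZ]_z (if J r rho udelta z then tilt_at w Z J udelta K r rho z else 0)%R%:E <= 1].
Proof.
move=> /andP[rho0 rhor] yr cRrho.
have /andP[K00 K0r] := K0_r0; have [p0 k0] := pk0; have /andP[u0 u4] := udelta_bounds.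
have r0r : (r0 <= r - rho)%R by lra.
have [woo w2 wK wpk] := r0_small r0r.
have rho_r : (0 <= rho <= r)%R by apply/andP; split; lra.
have wr : w r < +oo.
  by apply: (w_lty_ni F01 F_nd wE _ woo); move: rho_r => /andP[h _]; rewrite lerBlDr lerDl.
have wyoo : w y < +oo by apply: (le_lt_trans w_y); exact: ltry.
have om0 := wf_ge0 F01 wE (r - rho)%R.
have om_y : (fine (w (r - rho)%R) <= fine (w y))%R by exact: (wf_ni F01 F_nd wE).
have omy : (0 <= fine (w (r - rho)%R) <= fine (w y))%R by rewrite om0.
have u4' := ltW u4.
have K0om : (K0 * fine (w (r - rho)%R) <= udelta)%R.
  apply: le_trans udelta_ge.
  rewrite -{1}(sqr_sqrtr om0) expr2 mulrA.
  have hs := ler_wsqrtr om_y; have s0 := sqrtr_ge0 (fine (w (r - rho)%R)).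
  have hs0 := sqrtr_ge0 (fine (w y)).
  apply: (@le_trans _ _ (16^-1 * Num.sqrt (fine (w (r - rho)%R))))%R; last by rewrite ler_wpM2l.
  by rewrite ler_wpM2r// -(ler_pM2l (ltr0n R 16)) mulrA mulfV ?pnatr_eq0.
have [e [e0 he heerr]] := tail_y omy.
split => //.
- exact: (jump_fin hX F01 F_nd wE hpv hpk rho_r u0 woo).
- exact: (mean_at_le1 hX F01 F_nd wE hpv hpk rho_r u0 woo w2).
- apply: (mean_tilt_error hX hA F01 F_nd F_rec wE hpv hpk rho_r u0 u4' woo w2).
  have wy0 := wf_ge0 F01 wE y.
  apply: (total_error omy (ltW u0) _ _ _ heerr).
  + by rewrite addr_ge0// mulr_ge0// addr_ge0// sqr_ge0.
  + by rewrite mulr_ge0// addr_ge0// sqr_ge0.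
  have := bad_prob_le hX F01 F_nd wE u0 woo => /le_trans hb.
  rewrite -lee_fin; apply: hb; rewrite EFinD leeD//.
  rewrite /q -probability_fine; last exact: measurable_Lam_gt.
  apply: le_measure; rewrite ?inE; [exact: measurable_Lam_gt|exact: measurable_Lam_gt|].
  by move=> t /=; exact: le_lt_trans.
- rewrite (mass_tiltE hX F01 F_nd wE hpv hpk rho_r u0 u4' woo w2) lee_fin.
  apply: (step_one_le1 hX F01 F_nd F_rec wE hpv hpk rho_r u0 woo u4' w2 (K0 := K0) (p := p) (k := k)) => //.
  by apply/andP; split; lra.
Qed.

End one_state.

(** * The bound *)

Lemma abse_le (R : realType) (u : R) (v : \bar R) (e : R) :
  v <= u%:E + e%:E -> u%:E <= v + e%:E -> `|u%:E - v| <= e%:E.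
Proof.
case: v => [v| |].
- rewrite -!EFinD !lee_fin ler_norml => h1 h2.
  by apply/andP; split; lra.
- by rewrite -EFinD leye_eq.
- by rewrite addNye leeNy_eq.
Qed.

Lemma error_times_steps (R : realType) (n q W err g : R) : (0 <= n)%R ->
  (0 <= q)%R -> (0 <= err <= g)%R ->
  (n * (2 * q + W ^+ 2 * err) <= 100 * n * (q + W ^+ 2 * g))%R.
Proof.
move=> n0 q0 /andP[e0 eg].
have h := ler_wpM2l (sqr_ge0 W) eg; have h' := mulr_ge0 (sqr_ge0 W) e0.
have key : (2 * q + W ^+ 2 * err <= 100 * (q + W ^+ 2 * g))%R by lra.
by have := ler_wpM2l n0 key; rewrite mulrCA mulrA.
Qed.

Theorem corollary18
  (R : realType)
  (d0 : measure_display) (T0 : measurableType d0) (P : probability T0 R)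
  (X : {RV P >-> mark R})
  (d1 : measure_display) (T1 : measurableType d1) (P1 : probability T1 R)
  (c : seq nat -> {RV P1 >-> mark R})
  (sigma eta : R)
  (hX : reproduction_scheme X)
  (hA : assumptions X sigma eta)
  (hc : iid_copies X c) :
  exists (r0 delta0 a0 : R) (udelta g : R -> R),
    [/\ (0 < r0)%R, (0 < delta0)%R & (0 < a0)%R] /\
    [/\ forall y, (0 <= y)%R -> (0 < udelta y < delta0)%R,
        forall y y', (0 <= y)%R -> (y < y')%R -> (udelta y' < udelta y)%R &
        udelta z @[z --> +oo%R] --> (0 : R)%R] /\
    [/\ forall u, (0 < u <= 1)%R -> (0 <= g u)%R,
        forall u u', (0 < u)%R -> (u < u')%R -> (u' <= 1)%R -> (g u < g u')%R &
        g z @[z --> (0 : R)%R^'+] --> (0 : R)%R] /\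
    forall (a A cR y r x rb : R),
      (0 < a < a0)%R -> (0 < A)%R -> (0 < cR)%R ->
      (0 < y)%R -> w c y <= 1 ->
      (r0 <= x <= r)%R -> (r0 <= rb)%R -> (2 * rb <= r)%R ->
    forall (dZ : measure_display) (TZ : measurableType dZ)
      (PZ : probability TZ R) (Z : {RV PZ >-> R})
      (J : R -> R -> R -> {RV PZ >-> bool})
      (K : R.-pker palm_param R ~> counting_measures R),
      palm_variables X (w c) Z J -> palm_kernel X (w c) Z J K ->
    forall (d2 : measure_display) (T2 : measurableType d2)
      (Q : probability T2 R)
      (S Rh dl : nat -> {RV Q >-> R})
      (I : nat -> {RV Q >-> bool}) (Cnd : nat -> T2 -> \bar R),
      (forall t, S 0%N t = r) ->
      (forall n t, dl n t = udelta y) ->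
      step_law S Rh dl I Z J ->
      cond_exp_steps S Rh dl I (w c) Cnd ->
      `| w c r -
         \int[Q]_t W S Rh dl I (w c) K Cnd
                     (T' S Rh dl (w c) x y cR rb delta0 a A t) t |
      <= (100 * A)%:E / w c x *
         (P [set t | (cR < Lam X t)%R] + (w c y) ^+ 2 * (g (fine (w c y)))%:E).
Proof.
pose F := supF c.
have F01 := supF01 c : forall r, (0 <= F r <= 1)%R.
have F_nd := @supF_nd _ _ _ _ c : forall r r', (r <= r')%R -> (F r <= F r')%R.
have F_rec := supF_rec hc : forall r, (F r)%:E = one_generation X F r.
have hwE := wE c : forall r, w c r = (F r)%:E^-1 - 1.
have w0 := w_ge0 F01 hwE; have wni := w_ni F01 F_nd hwE.
have wpos := w_gt0 hX hA F01 F_nd F_rec hwE.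
have [K0 [p [k [r0 [K0r0 pk p_le k_le r0s]]]]] := small_scale hA F01 F_nd F_rec hwE.
have [udelta [err [[ud0 ud_decr ud_cvg] [[B errB] err0 ud_err]]]] :=
  step_parameters hA w0 wni (w_to0 hA F01 F_nd F_rec hwE).
have [g [g0 g_incr g_cvg err_g]] := dominating_modulus wni wpos errB err0.
have r00 : (0 < r0)%R by case/andP: K0r0 => h; exact: lt_le_trans.
(* the expansions of the exponential are made for cut-offs below [1 / 4] *)
exists r0, (4^-1)%R, 1%R, udelta, g; split; first by split => //; rewrite invr_gt0.
split => //; split => //.
move=> a A cR y r x rb /andP[a0 _] A0 cR0 y0 wy1 /andP[r0x xr] r0rb rbr.
move=> dZ TZ PZ Z J K hpv hpk d2 T2 Q S Rh dl I Cnd S0 hdl hstep hC.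
have yge0 := ltW y0.
have [wxoo _ _ _] := r0s x r0x.
have [wroo _ _ _] := r0s r (le_trans r0x xr).
set tau := T' S Rh dl (w c) x y cR rb 4^-1 a A.
pose m := Num.truncn (fine (A%:E / w c x)).
pose q := fine (P [set t | (cR < Lam X t)%R]).
pose eps := (2 * q + fine (w c y) ^+ 2 * err y)%R.
have /andP[err_ge0 _] := errB y y0 wy1.
have q0 : (0 <= q)%R by rewrite fine_ge0.
have eps0 : (0 <= eps)%R by apply: addr_ge0; apply: mulr_ge0; rewrite ?sqr_ge0.
have facts j t : alive tau j t ->
  [/\ w c (S j t) < +oo,
      {ae PZ, forall z, J (S j t) (Rh j t) (udelta y) z ->
         w c (S j t - Z z)%R < +oo /\
         spine_at (w c) K (udelta y) (S j t) (Rh j t) (Z z) < +oo},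
      mean_at (w c) Z J (udelta y) (S j t) (Rh j t) <= 1,
      mean_tilt (w c) Z J (udelta y) K (S j t) (Rh j t) <= w c (S j t) + eps%:E /\
      w c (S j t) <= mean_tilt (w c) Z J (udelta y) K (S j t) (Rh j t) + eps%:E &
      \int[PZ]_z (if J (S j t) (Rh j t) (udelta y) z
         then tilt_at (w c) Z J (udelta y) K (S j t) (Rh j t) z else 0)%R%:E <= 1].
  rewrite /tau alive_T'E => /andP[_ /allP/(_ j)].
  rewrite mem_iota add0n leq0n ltnSn => /(_ isT).
  move=> /and5P[_ _ h1 h2 /and5P[_ _ _ h3 h4]].
  have ud_ge := (ud_err y 0%R y0 wy1 _).1.
  apply: (step_facts hX hA F01 F_nd F_rec hwE K0r0 pk p_le k_le r0s
    (ud0 y yge0) wy1 _ _ hpv hpk _ h3 h4).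
  - by apply: ud_ge; rewrite lexx fine_ge0.
  - by move=> om /(ud_err y om y0 wy1)[].
  - by rewrite (le_trans r0rb h1)/=; apply: (le_trans h2); rewrite lerB.
have tau_m t : (tau t <= m)%N by exact: T'_le.
have tau_past j : measurable_fun setT (alive tau j : past S Rh dl I j -> bool).
  by apply: alive_T'_past => //; exact: ltW.
have [up down] := @stopped_error _ _ _ Q S Rh dl I _ _ P X (w c) w0 wni _ _ PZ Z J
  hpv (udelta y) (fun n t => hdl n t) hstep K Cnd hC tau m eps
  tau_m eps0 tau_past
  (fun t => eq_ind_r (fun s => w c s < +oo) wroo (S0 t))
  (fun j t h => let: And5 h1 _ _ _ _ := facts j t h in h1)
  (fun j t h => let: And5 _ h1 _ _ _ := facts j t h in h1)
  (fun j t h => let: And5 _ _ h1 _ _ := facts j t h in h1)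
  (fun j t h => let: And5 _ _ _ h1 _ := facts j t h in h1)
  (fun j t h => let: And5 _ _ _ _ h1 := facts j t h in h1).
have start : \int[Q]_t w c (S 0%N t) = (fine (w c r))%:E.
  transitivity (\int[Q]_t (cst (w c r) t)); first by apply: eq_integral => t _; rewrite S0.
  rewrite integral_cst// [X in _ * X](_ : _ = 1); last exact: probability_setT.
  by rewrite mule1 -(wfE F01 hwE).
rewrite start in up down.
rewrite [w c r](wfE F01 hwE wroo); apply: (le_trans (abse_le up down)).
have wx0 : (0 < fine (w c x))%R by rewrite fine_gt0// wpos.
have wyE : w c y = (fine (w c y))%:E.
  by apply: (wfE F01 hwE); apply: (le_lt_trans wy1); exact: ltry.
rewrite (probability_fine P (measurable_Lam_gt X cR)) -/q wyE.
rewrite [w c x](wfE F01 hwE wxoo) inver gt_eqF//=.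
rewrite -!EFinM lee_fin.
rewrite -expr2.
have hm : (m%:R <= A / fine (w c x))%R.
  rewrite /m (wfE F01 hwE wxoo) inver gt_eqF//= truncn_le//.
  by rewrite divr_ge0// ltW.
have hg := err_g y y0 wy1.
apply: (@le_trans _ _ (A / fine (w c x) * eps)%R); first exact: ler_wpM2r.
rewrite -(mulrA 100%R); apply: error_times_steps => //; last by rewrite err_ge0.
by rewrite divr_ge0// ltW.
Qed.
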